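(* Let $\mu\in V$ with $\mu+\rho\in\mathcal C$, and let $\Lambda\in\overline{\mathcal C}$ be a vector which is admissible for $\mu$ (as defined in the context). Then $$\underline N_{\mu+\Lambda}=\mathbf P\,\mathbf F_\Lambda\,\underline N_\mu .$$
   Context: **Alcove geometry.** $\Delta$ is the root system of a simple Lie algebra $\mathfrak g$ with positive roots $\Delta_+$, finite Weyl group $W$, weight lattice $X$, $V=X\otimes_{\mathbb Z}\mathbb R$, and bilinear form $\cdot$ normalized by $\alpha\cdot\alpha=2$ for short roots; $\theta$ is the highest root, $\rho$ is half the sum of the positive roots, and $l$ is a positive integer larger than the dual Coxeter number of $\mathfrak g$. For $\alpha\in\Delta_+$, $r\in\mathbb Z$ put $E_{\alpha,r}=\{x\in V: x\cdot\alpha=r\}$, with positive side $\{x\cdot\alpha>r\}$ and negative side $\{x\cdot\alpha<r\}$. $\mathcal W$ is the group generated by $W$ and the affine reflection in $E_{\theta,l}$; $w(x)$ denotes its defining action on $V$, and $w.x=w(x+\rho)-\rho$. $\mathcal E=\{E_{\alpha,ml}:\alpha\in\Delta_+,m\in\mathbb Z\}$; alcoves are the connected components of $V\setminus\bigcup_{E\in\mathcal E}E$. $\mathcal C=\{x: x\cdot\alpha>0 \text{ for all simple }\alpha\}$ is the (open) dominant Weyl chamber with closure $\overline{\mathcal C}$, $\mathcal A_+$ the set of alcoves contained in $\mathcal C$, and $A_+=\mathcal C\cap\{x\cdot\theta<l\}$. A facet is a nonempty set $F\subset V$ of all points satisfying, for each $\alpha\in\Delta_+$, either one condition $x\cdot\alpha=m_\alpha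 l$ or one condition $m_\alpha l<x\cdot\alpha<(m_\alpha+1)l$ ($m_\alpha\in\mathbb Z$). $A_+(F)$ is the alcove containing $F$ in its closure which lies on the positive side of every hyperplane of $\mathcal E$ containing $F$. $F(x)$ denotes the facet containing the point $x$. For facets $F\subset\overline{G}$, $\mathbf a_F(G)$ (resp. $\mathbf b_F(G)$) is the number of hyperplanes in $\mathcal E$ containing $F$ which have $G$ on their negative (resp. positive) side. **Hecke module.** $\mathcal S$ is the set of reflections in the walls of $A_+$; $(\mathcal W,\mathcal S)$ is a Coxeter group with length function $\ell$. $\mathcal H$ is its Hecke algebra over $\mathbb Z[v,v^{-1}]$, with basis $H_x$, $x\in\mathcal W$, satisfying $H_xH_y=H_{xy}$ if $\ell(xy)=\ell(x)+\ell(y)$ and $H_s^2=1+(v^{-1}-v)H_s$ for $s\in\mathcal S$; it has the ring involution $\bar v=v^{-1}$, $\overline{H_x}=(H_{x^{-1}})^{-1}$. $\mathcal N=\mathbb Z[v,v^{-1}]\otimes_{\mathcal H_f}\mathcal H$ is the right $\mathcal H$-module induced from the sign representation $H_s\mapsto -v$ of the Hecke algebra $\mathcal H_f$ of $W$. It has basis $N_x=1\otimes H_x$, $x\in\mathcal W^f$ (minimal length representatives of the cosets $Wx$), and the involution $\overline{a\otimes b}=\bar a\otimes\bar b$; fixed elements are called self-dual. $\mathcal N$ has a unique basis of self-dual elements $\underline N_x\in N_x+\sum_{y<x}v\mathbb Z[v]N_y$; write $\underline N_x=N_x+\sum_{y<x}n_{y,x}N_y$, and $n_{x,x}=1$, $n_{y,x}=0$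 if $y\not\le x$ (Bruhat order). The bijection $x\mapsto xA_+$ from $\mathcal W^f$ to $\mathcal A_+$ is used to index these objects by alcoves: $N_A,\underline N_A,n_{B,A}$; $\prec$ is the order on $\mathcal A_+$ corresponding to the Bruhat order on $\mathcal W^f$ (so for $s\in\mathcal S$ with $A,As\in\mathcal A_+$, where $(wA_+)s=wsA_+$, $As\succ A$ iff $As$ is on the positive side of the hyperplane separating $A$ and $As$). **Points.** For $\mu\in V$ with $\mu+\rho\in\mathcal C$ let $A_+(\mu)=A_+(F(\mu+\rho))$. For two such points, $n_{\lambda\mu}=n_{A_+(\lambda),A_+(\mu)}$ if $\lambda\in\mathcal W.\mu$ and $n_{\lambda\mu}=0$ otherwise. $\mathcal M$ is the free $\mathbb Z[v,v^{-1}]$-module with basis $\{N_\lambda:\lambda+\rho\in\mathcal C\}$, and $\underline N_\mu=\sum_\lambda n_{\lambda\mu}N_\lambda\in\mathcal M$. An element of $\mathcal M$ is self-dual if it is a linear combination of elements $\underline N_\mu$ with coefficients in $\mathbb Z[v,v^{-1}]_0=\{f:\bar f=f\}$. For $\lambda\in\mathcal W.\mu$, $\lambda<\mu$ means $A_+(\lambda)\prec A_+(\mu)$. **Admissible vectors and $\mathbf F_\Lambda$.** A vector $\Lambda\in V$ is admissible for $\mu$ if, with $F_0=F(\mu+\rho)$ and $F_1=F(\mu+\rho+\Lambda)$, there is a facet $F$ contained in the closures of both $F_0$ and $F_1$ such that the segment from $\mu+\rho$ to $\mu+\rho+\Lambda$ meets $F$ and is contained in $F_0\cup F\cup F_1$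 (the degenerate cases $F=F_0$ and $F=F_1$ are allowed). For $\lambda=w.\mu$ ($w\in\mathcal W$) with $\lambda+\rho\in\mathcal C$ put $F'=w(F)$ and let $O_\lambda$ be the orbit of the point $w(\mu+\rho+\Lambda)$ under the group generated by the reflections in the hyperplanes of $\mathcal E$ containing $F'$ (these do not depend on the choice of $w$). Define $$\mathbf F^{(\lambda)}=\begin{cases}0&\text{if }F'\not\subset\mathcal C,\\ \sum_{\gamma:\,\gamma+\rho\in O_\lambda}v^{\mathbf a_{F'}(F(\gamma+\rho))-\mathbf b_{F'}(F(\lambda+\rho))}N_\gamma&\text{if }F'\subset\mathcal C,\end{cases}\qquad \mathbf F_\Lambda\underline N_\mu=\sum_{\lambda\in\mathcal W.\mu,\ \lambda+\rho\in\mathcal C}n_{\lambda\mu}\,\mathbf F^{(\lambda)} .$$ **Positivity operator $\mathbf P$.** Let $R=\sum_{\lambda\le\nu}a_\lambda N_\lambda$ be self-dual with $a_\lambda\in\mathbb Z[v,v^{-1}]$, $a_\nu=1$. Let $i_0$ be the smallest exponent of $v$ occurring in any $a_\lambda$ with $\lambda<\nu$. If $i_0>0$, put $\mathbf PR=R$. If $i_0<0$, replace $R$ by $R-\sum_{\lambda<\nu}(v^{i_0}+v^{-i_0})\,c_\lambda\,\underline N_\lambda$, where $c_\lambda$ is the coefficient of $v^{i_0}$ in $a_\lambda$; if $i_0=0$, replace $R$ by $R-\sum_{\lambda<\nu}c_\lambda\underline N_\lambda$, where $c_\lambda$ is the constant coefficient of $a_\lambda$. Iterate until all $a_\lambda$,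 $\lambda<\nu$, lie in $v\mathbb Z[v]$; the result is $\mathbf PR$. *)

(* Defs.v *)
From HB Require Import structures.
From mathcomp Require Import all_boot all_order all_algebra finmap.
From mathcomp Require Import all_classical all_reals topology normedtype.
(* The notations of monalg clash with those of mathcomp-analysis. *)
From mathcomp Require Import -(notations) monalg.
Import Order.TTheory GRing.Theory Num.Theory numFieldNormedType.Exports.

Set Implicit Arguments.
Unset Strict Implicit.
Unset Printing Implicit Defensive.

Local Open Scope classical_set_scope.
Local Open Scope ring_scope.

Notation "{ 'malg' G [ K ] }" := (@monalg.malg K G)
  (at level 0, G at level 2, format "{ 'malg'  G [ K ] }") : type_scope.

(** * Laurent polynomials Z[v, v^-1] *)

(* A Laurent polynomial is a finitely supported function int -> int, the
   coefficient of v^i in f being [mcoeff i f]; the product is the convolution.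
   (monalg's own algebra structure needs a monoid of exponents in which
   x + y = 0 implies x = y = 0, hence does not apply to int.) *)
Definition laurent : Type := {malg int[int]}.
HB.instance Definition _ := GRing.Zmodule.on laurent.

Section LaurentRing.
Implicit Types f g : laurent.

Definition laurent_one : laurent := mkmalgU 0 1.

Definition laurent_mul f g : laurent :=
  \sum_(i <- msupp f) \sum_(j <- msupp g)
    mkmalgU (i + j) (mcoeff i f * mcoeff j g).

Lemma laurent_mulw (d1 d2 : {fset int}) f g :
  (msupp f `<=` d1)%fset -> (msupp g `<=` d2)%fset ->
  laurent_mul f g = \sum_(i <- d1) \sum_(j <- d2)
    mkmalgU (i + j) (mcoeff i f * mcoeff j g).
Proof.
move=> le1 le2; rewrite /laurent_mul (big_fset_incl _ le1) /=.
  apply: eq_bigr => i _; apply: big_fset_incl => // j _ /mcoeff_outdom ->.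
  by rewrite mulr0 monalgU0.
move=> i _ /mcoeff_outdom fi.
by rewrite big1 // => j _; rewrite fi mul0r monalgU0.
Qed.

Lemma laurent_mulC : commutative laurent_mul.
Proof.
move=> f g; rewrite /laurent_mul exchange_big /=.
by apply: eq_bigr => i _; apply: eq_bigr => j _; rewrite addrC mulrC.
Qed.

Lemma laurent_mul0 f : laurent_mul 0 f = 0.
Proof. by rewrite /laurent_mul msupp0 big_seq_fset0. Qed.

Lemma laurent_mulU a b (i j : int) :
  laurent_mul (mkmalgU i a) (mkmalgU j b) = mkmalgU (i + j) (a * b).
Proof.
by rewrite (laurent_mulw msuppU_le msuppU_le) !big_seq_fset1 !mcoeffUU.
Qed.

Lemma laurent_mul1 : left_id laurent_one laurent_mul.
Proof.
move=> f; rewrite (laurent_mulw msuppU_le (fsubset_refl _)) big_seq_fset1.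
rewrite [RHS]monalgE; apply: eq_bigr => j _.
by rewrite mcoeffUU mul1r add0r.
Qed.

Lemma laurent_mulDl : left_distributive laurent_mul +%R.
Proof.
move=> f1 f2 g.
rewrite [in RHS](laurent_mulw (fsubsetUl _ (msupp f2)) (fsubset_refl _)).
rewrite [in RHS](laurent_mulw (fsubsetUr (msupp f1) _) (fsubset_refl _)).
rewrite (laurent_mulw (msuppD_le _ _) (fsubset_refl _)).
rewrite -big_split /=; apply: eq_bigr => i _.
rewrite -big_split /=; apply: eq_bigr => j _.
by rewrite mcoeffD mulrDl monalgUD.
Qed.

Lemma laurent_mul_suml (I : Type) (r : seq I) (F : I -> laurent) g :
  laurent_mul (\sum_(i <- r) F i) g = \sum_(i <- r) laurent_mul (F i) g.
Proof.
exact: (big_morph (laurent_mul^~ g) (fun _ _ => laurent_mulDl _ _ _)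
  (laurent_mul0 _)).
Qed.

Lemma laurent_mul_sumr (I : Type) (r : seq I) (F : I -> laurent) g :
  laurent_mul g (\sum_(i <- r) F i) = \sum_(i <- r) laurent_mul g (F i).
Proof.
rewrite laurent_mulC laurent_mul_suml.
by apply: eq_bigr => i _; rewrite laurent_mulC.
Qed.

Lemma laurent_mulA : associative laurent_mul.
Proof.
have sumE f : exists (r : seq int) (a : int -> int),
    f = \sum_(i <- r) mkmalgU i (a i).
  by exists (msupp f), (mcoeff^~ f); exact: monalgE.
move=> f g h.
have [rf [a ->]] := sumE f; have [rg [b ->]] := sumE g.
have [rh [c ->]] := sumE h.
rewrite !(laurent_mul_suml rf); apply: eq_bigr => i _.
rewrite (laurent_mul_suml rg) !(laurent_mul_sumr rg) (laurent_mul_suml rg).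
apply: eq_bigr => j _.
rewrite !(laurent_mul_sumr rh); apply: eq_bigr => k _.
by rewrite !laurent_mulU addrA mulrA.
Qed.

Lemma laurent_oner_neq0 : laurent_one != 0 :> laurent.
Proof. by rewrite /laurent_one monalgU_eq0. Qed.

HB.instance Definition _ := GRing.Zmodule_isComNzRing.Build laurent
  laurent_mulA laurent_mulC laurent_mul1 laurent_mulDl laurent_oner_neq0.

Definition vpow (i : int) : laurent := mkmalgU i 1.

Definition lbar f : laurent := \sum_(i <- msupp f) mkmalgU (- i) (mcoeff i f).

Definition in_vZv f := forall i : int, mcoeff i f != 0 -> 0 < i.

End LaurentRing.

(** * Bases of modules and generated groups *)

Definition is_basis (I : choiceType) (M : lmodType laurent) (D : set I)
    (b : I -> M) := forall m : M, exists! c : {malg laurent[I]},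
  (forall i, i \in msupp c -> D i) /\ m = \sum_(i <- msupp c) mcoeff i c *: b i.

Definition basis_coord (I : choiceType) (M : lmodType laurent) (D : set I)
    (b : I -> M) (m : M) : {malg laurent[I]} :=
  xget 0 [set c | (forall i, i \in msupp c -> D i) /\
                  m = \sum_(i <- msupp c) mcoeff i c *: b i].

Inductive word (T : Type) (S : set (T -> T)) : nat -> (T -> T) -> Prop :=
| word_nil : word S 0 id
| word_cons k g w : S g -> word S k w -> word S k.+1 (g \o w).

(* The group generated by S; no inverses are needed, as this is only used for
   sets S closed under inversion (reflections and finite groups). *)
Definition generated (T : Type) (S : set (T -> T)) : set (T -> T) :=
  [set w | exists k, word S k w].

(** * Root systems *)

Section EuclideanSpace.
Context {R : realType} {n : nat}.
Implicit Types x y a : 'rV[R]_n.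

Definition dot x y : R := \sum_(i < n) x 0 i * y 0 i.

(* The orthogonal reflection in the hyperplane [x . a = r]. *)
Definition aff_refl a (r : R) x : 'rV[R]_n :=
  x - ((dot x a - r) * 2 / dot a a) *: a.

Definition hyperplane a (r : R) : set 'rV[R]_n := [set x | dot x a = r].
Definition pos_side a (r : R) : set 'rV[R]_n := [set x | r < dot x a].
Definition neg_side a (r : R) : set 'rV[R]_n := [set x | dot x a < r].

Definition nneg_comb (s : 'I_n -> 'rV[R]_n) x :=
  exists c : 'I_n -> nat, x = \sum_(i < n) (c i)%:R *: s i.

End EuclideanSpace.

(* The root system of a simple Lie algebra of rank n, i.e. an irreducible
   reduced crystallographic root system, with a base and the highest root.
   An orthonormal basis identifies the Euclidean space with R^n. *)
Record rootSystem (R : realType) (n : nat) := RootSystem {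
  roots : seq 'rV[R]_n;
  simple : 'I_n -> 'rV[R]_n;
  theta : 'rV[R]_n;
  roots_uniq : uniq roots;
  roots_neq0 : 0 \notin roots;
  roots_reflect : forall a b, a \in roots -> b \in roots ->
    aff_refl a 0 b \in roots;
  roots_integral : forall a b, a \in roots -> b \in roots ->
    2 * dot b a / dot a a \is a Num.int;
  roots_reduced : forall a (c : R), a \in roots -> c *: a \in roots ->
    c = 1 \/ c = -1;
  roots_irreducible : forall P : pred 'rV[R]_n,
    (exists2 a, a \in roots & P a) -> (exists2 b, b \in roots & ~~ P b) ->
    exists a b, [/\ a \in roots, b \in roots, P a, ~~ P b & dot a b != 0];
  roots_short : exists2 a, a \in roots & dot a a = 2;
  roots_long : forall a, a \in roots -> 2 <= dot a a;
  simple_root : forall i, simple i \in roots;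
  simple_basis : \matrix_(i < n) simple i \in unitmx;
  simple_base : forall a, a \in roots ->
    nneg_comb simple a \/ nneg_comb simple (- a);
  theta_root : theta \in roots;
  theta_highest : forall a, a \in roots -> nneg_comb simple (theta - a)
}.

Section AlcoveGeometry.
Context {R : realType} {n : nat} (Phi : rootSystem R n) (l : nat).
Local Notation V := 'rV[R]_n.
Implicit Types (A F G : set V) (x mu lam Lam : V).

Definition pos_roots : seq V :=
  [seq a <- roots Phi | `[< nneg_comb (simple Phi) a >]].

Definition rho : V := 2^-1 *: \sum_(a <- pos_roots) a.

(* 1 + (rho, theta^vee) *)
Definition dual_coxeter : R :=
  1 + 2 * dot rho (theta Phi) / dot (theta Phi) (theta Phi).

Definition lmul (m : int) : R := m%:~R * l%:R.

Definition Wfin : set (V -> V) :=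
  generated [set g | exists2 a, a \in roots Phi & g = aff_refl a 0].

Definition Waff : set (V -> V) :=
  generated (Wfin `|` [set aff_refl (theta Phi) l%:R]).

Definition wdot (w : V -> V) x : V := w (x + rho) - rho.

Definition arrangement : set V :=
  [set x | exists a m, a \in pos_roots /\ hyperplane a (lmul m) x].

Definition is_alcove A :=
  exists2 x, (~` arrangement) x & A = connected_component (~` arrangement) x.

Definition chamber : set V := [set x | forall i, 0 < dot x (simple Phi i)].

Definition Aplus : set V := chamber `&` neg_side (theta Phi) l%:R.

Definition is_facet F := F !=set0 /\
  exists (b : V -> bool) (m : V -> int), F = [set x | forall a, a \in pos_roots ->
    if b a then dot x a = lmul (m a)
    else lmul (m a) < dot x a < lmul (m a + 1)].

Definition facet x : set V := xget set0 [set F | is_facet F /\ F x].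

Definition alcove_plus F : set V := xget set0 [set A |
  [/\ is_alcove A, F `<=` closure A &
      forall a m, a \in pos_roots -> F `<=` hyperplane a (lmul m) ->
        A `<=` pos_side a (lmul m)]].

(* A nonempty F lies on at most one hyperplane of each direction, and distinct
   positive roots have distinct directions: counting hyperplanes containing F
   amounts to counting positive roots. *)
Definition neg_count F G : nat := count (fun a => `[< exists m : int,
  F `<=` hyperplane a (lmul m) /\ G `<=` neg_side a (lmul m) >]) pos_roots.

Definition pos_count F G : nat := count (fun a => `[< exists m : int,
  F `<=` hyperplane a (lmul m) /\ G `<=` pos_side a (lmul m) >]) pos_roots.

(* [hyperplane a (lmul m)] contains a facet of codimension 1 in [closure A]. *)
Definition is_wall A (a : V) (m : int) := a \in pos_roots /\
  exists2 x, closure A x & forall b k, b \in pos_roots ->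
    (hyperplane b (lmul k) x <-> b = a /\ k = m).

Definition simple_refl : set (V -> V) :=
  [set s | exists a m, is_wall Aplus a m /\ s = aff_refl a (lmul m)].

Definition cox_length (w : V -> V) : nat := xget 0%N [set k |
  word simple_refl k w /\ forall j, word simple_refl j w -> (k <= j)%N].

Definition cox_reflection (t : V -> V) := exists w w' s,
  [/\ Waff w, Waff w', w \o w' = id, simple_refl s & t = w \o s \o w'].

Inductive bruhat_le (x : V -> V) : (V -> V) -> Prop :=
| bruhat_refl : bruhat_le x x
| bruhat_step y t : bruhat_le x y -> cox_reflection t ->
    (cox_length y < cox_length (t \o y))%N -> bruhat_le x (t \o y).

Definition bruhat_lt (x y : V -> V) := bruhat_le x y /\ x <> y.

Definition Wf : set (V -> V) := [set x | Waff x /\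
  forall w, Wfin w -> (cox_length x <= cox_length (w \o x))%N].

(* The inverse of the bijection x |-> x(A_+) from Wf to the alcoves contained
   in the chamber, and the transported order. *)
Definition alcove_elt A : V -> V := xget (@id V) [set x | Wf x /\ x @` Aplus = A].

Definition alcove_lt A B := bruhat_lt (alcove_elt A) (alcove_elt B).

Definition dominant mu := chamber (mu + rho).

Definition pt_alcove mu : set V := alcove_plus (facet (mu + rho)).

Definition linked lam mu := exists2 w, Waff w & lam = wdot w mu.

Definition pt_lt lam mu := [/\ dominant lam, dominant mu, linked lam mu &
  alcove_lt (pt_alcove lam) (pt_alcove mu)].

Definition segment mu Lam : set V :=
  [set mu + rho + t *: Lam | t in [set t : R | 0 <= t <= 1]].

Definition admissible_facet mu Lam F :=
  let F0 := facet (mu + rho) in let F1 := facet (mu + rho + Lam) in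
  [/\ is_facet F, F `<=` closure F0 /\ F `<=` closure F1,
      segment mu Lam `&` F !=set0 & segment mu Lam `<=` F0 `|` F `|` F1].

Definition admissible mu Lam := exists F, admissible_facet mu Lam F.

(* The facet F is in fact unique. *)
Definition adm_facet mu Lam : set V := xget set0 [set F | admissible_facet mu Lam F].

(* Some w with lam = w.mu, which is applied to F and to mu + rho + Lam. *)
Definition transporter mu lam : V -> V :=
  xget (@id V) [set w | Waff w /\ lam = wdot w mu].

Definition moved_facet mu Lam lam : set V :=
  transporter mu lam @` adm_facet mu Lam.

Definition facet_group F : set (V -> V) := generated [set g |
  exists a m, [/\ a \in pos_roots, F `<=` hyperplane a (lmul m) &
                  g = aff_refl a (lmul m)]].

Definition moved_orbit mu Lam lam : set V :=
  [set g (transporter mu lam (mu + rho + Lam)) |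
     g in facet_group (moved_facet mu Lam lam)].

End AlcoveGeometry.

(** * The Hecke algebra and its antispherical module *)

(* [hecke] is the Hecke algebra of (Waff, simple_refl) with standard basis [Hb]
   and bar involution [hbar].  [indmod] is the right module
   Z[v,v^-1] (x)_{H_f} H, with [tens a h] for a (x) h, right action [act] and
   bar involution [nbar]; H_f is generated by the H_s with s in Wfin, and acts
   on Z[v,v^-1] by H_s |-> -v.  These data are determined up to a unique
   isomorphism. *)
Record heckeModule (R : realType) (n : nat) (Phi : rootSystem R n) (l : nat) :=
HeckeModule {
  hecke : algType laurent;
  Hb : ('rV[R]_n -> 'rV[R]_n) -> hecke;
  Hb_basis : is_basis (Waff Phi l) Hb;
  Hb_mul : forall x y, Waff Phi l x -> Waff Phi l y ->
    cox_length Phi l (x \o y) = (cox_length Phi l x + cox_length Phi l y)%N ->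
    Hb x * Hb y = Hb (x \o y);
  Hb_quad : forall s, simple_refl Phi l s ->
    Hb s * Hb s = 1 + (vpow (-1) - vpow 1) *: Hb s;
  hbar : hecke -> hecke;
  hbarD : forall h k, hbar (h + k) = hbar h + hbar k;
  hbarM : forall h k, hbar (h * k) = hbar h * hbar k;
  hbarZ : forall c h, hbar (c *: h) = lbar c *: hbar h;
  hbarK : forall h, hbar (hbar h) = h;
  hbar_Hb : forall x y, Waff Phi l x -> Waff Phi l y -> x \o y = id ->
    Hb y * hbar (Hb x) = 1 /\ hbar (Hb x) * Hb y = 1;
  indmod : lmodType laurent;
  tens : laurent -> hecke -> indmod;
  tensDl : forall a b h, tens (a + b) h = tens a h + tens b h;
  tensDr : forall a h k, tens a (h + k) = tens a h + tens a k;
  tensZl : forall c a h, tens (c * a) h = c *: tens a h;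
  tensZr : forall c a h, tens a (c *: h) = c *: tens a h;
  tens_sign : forall a s h, simple_refl Phi l s -> Wfin Phi s ->
    tens a (Hb s * h) = tens (a * - vpow 1) h;
  tens_basis : is_basis (Wf Phi l) (fun x => tens 1 (Hb x));
  act : indmod -> hecke -> indmod;
  actD : forall z z' h, act (z + z') h = act z h + act z' h;
  act_tens : forall a h k, act (tens a h) k = tens a (h * k);
  nbar : indmod -> indmod;
  nbarD : forall z z', nbar (z + z') = nbar z + nbar z';
  nbar_tens : forall a h, nbar (tens a h) = tens (lbar a) (hbar h)
}.

Section Canonical.
Context {R : realType} {n : nat} {Phi : rootSystem R n} {l : nat}.
Context (H : heckeModule Phi l).
Local Notation V := 'rV[R]_n.
Implicit Types (A B : set V) (mu nu lam Lam : V) (x y : V -> V).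

Definition Nb x : indmod H := tens 1 (Hb H x).

Definition is_canonical x (z : indmod H) := nbar z = z /\
  exists c : {malg laurent[V -> V]},
    (forall y, y \in msupp c ->
       [/\ Wf Phi l y, bruhat_lt Phi l y x & in_vZv (mcoeff y c)]) /\
    z = Nb x + \sum_(y <- msupp c) mcoeff y c *: Nb y.

Definition canonical x : indmod H := xget 0 [set z | is_canonical x z].

Definition npoly y x : laurent := mcoeff y (basis_coord (Wf Phi l) Nb (canonical x)).

Definition npoly_alcove B A : laurent :=
  npoly (alcove_elt Phi l B) (alcove_elt Phi l A).

Definition npoly_pt lam mu : laurent :=
  if `[< linked Phi l lam mu >]
  then npoly_alcove (pt_alcove Phi l lam) (pt_alcove Phi l mu) else 0.

(* The module M is the submodule of {malg laurent[V]} spanned by the N_lam with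
   lam dominant. *)
Definition Npt lam : {malg laurent[V]} := mkmalgU lam 1.

(* The sums [\sum_(_ \in _)] below have only finitely many nonzero terms. *)
Definition canonical_pt mu : {malg laurent[V]} :=
  \sum_(lam \in [set lam | dominant Phi lam]) npoly_pt lam mu *: Npt lam.

Definition facet_term mu Lam lam : {malg laurent[V]} :=
  let F' := moved_facet Phi l mu Lam lam in
  if `[< F' `<=` chamber Phi >] then
    \sum_(gam \in [set gam | moved_orbit Phi l mu Lam lam (gam + rho Phi)])
      vpow ((neg_count Phi l F' (facet Phi l (gam + rho Phi)))%:Z -
            (pos_count Phi l F' (facet Phi l (lam + rho Phi)))%:Z) *: Npt gam
  else 0.

(* F_Lam applied to the canonical element at mu. *)
Definition facet_op Lam mu : {malg laurent[V]} :=
  \sum_(lam \in [set lam | linked Phi l lam mu /\ dominant Phi lam])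
    npoly_pt lam mu *: facet_term mu Lam lam.

Definition self_dual (z : {malg laurent[V]}) := exists c : {malg laurent[V]},
  (forall mu, mu \in msupp c -> dominant Phi mu /\ lbar (mcoeff mu c) = mcoeff mu c)
  /\ z = \sum_(mu <- msupp c) mcoeff mu c *: canonical_pt mu.

Definition leading nu (z : {malg laurent[V]}) :=
  [/\ dominant Phi nu, mcoeff nu z = 1 &
      forall lam, lam \in msupp z -> lam = nu \/ pt_lt Phi l lam nu].

Definition min_exponent nu (z : {malg laurent[V]}) (i : int) :=
  (exists2 lam, pt_lt Phi l lam nu & mcoeff i (mcoeff lam z) != 0) /\
  forall lam j, pt_lt Phi l lam nu -> mcoeff j (mcoeff lam z) != 0 -> i <= j.

(* One round of the algorithm, subtracting multiples (by the integers
   [mcoeff i (mcoeff lam z)]) of [c *: canonical_pt lam]. *)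
Definition reduce nu (i : int) (c : laurent) (z : {malg laurent[V]}) :=
  z - \sum_(lam <- msupp z | `[< pt_lt Phi l lam nu >])
        (c *: canonical_pt lam) *~ mcoeff i (mcoeff lam z).

Inductive reduces_to nu : {malg laurent[V]} -> {malg laurent[V]} -> Prop :=
| reduce_done z :
    (forall lam, pt_lt Phi l lam nu -> in_vZv (mcoeff lam z)) ->
    reduces_to nu z z
| reduce_neg z z' i : min_exponent nu z i -> i < 0 ->
    reduces_to nu (reduce nu i (vpow i + vpow (- i)) z) z' -> reduces_to nu z z'
| reduce_zero z z' : min_exponent nu z 0 ->
    reduces_to nu (reduce nu 0 1 z) z' -> reduces_to nu z z'.

(* The default value 0 is taken when z is not of the required form or the
   algorithm does not terminate. *)
Definition positivity (z : {malg laurent[V]}) : {malg laurent[V]} :=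
  xget 0 [set z' | exists nu, [/\ self_dual z, leading nu z & reduces_to nu z z']].

End Canonical.

(* Main.v *)
From HB Require Import structures.
From mathcomp Require Import all_boot all_order all_algebra finmap.
From mathcomp Require Import all_classical all_reals topology normedtype.
From mathcomp Require Import -(notations) monalg.
From mathcomp Require Import zify ring lra.
Require Import Defs.
Import Order.TTheory GRing.Theory Num.Theory numFieldNormedType.Exports.

(** The canonical elements of [M] are those of the antispherical module [N],
    read off at the alcoves [A_+(lam)]. The proof transfers the statement to
    [N], where it becomes a statement about elements that are spherical for a
    finite parabolic subgroup.

    Move [mu + rho], a point of the facet [F] and [mu + Lam + rho] by the affine
    Weyl group to points [p], [q], [r] of the closed fundamental alcove
    ([fundamental], [orbit_closed]). Their stabilizers [W_p], [W_q], [W_r] are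
    generated by the walls through them, and [W_p] and [W_r] are contained in
    [W_q] because [F] lies in the closures of the two facets. Call [z] in [N]
    spherical at [p] when [z C_s = (v + v^-1) z] for all walls [s] through [p],
    where [C_s = H_s + v]. The coefficients of such a [z] along a coset [y W_p]
    at a dominant point [y p] are [v^len(g)] times the one at the highest alcove
    [y] ([sph_coset]), so that [z] amounts to a function on the dominant points
    of the orbit of [p]. The canonical element at the highest alcove of such a
    point is spherical at [p] ([canonicalP], [canonical_sph]); this is why
    points may be used instead of alcoves.

    In these terms [F_Lam] makes the element [m] at [A_+(mu)] spherical at [q]
    and regards the result as spherical at [r]. Indeed let [a = \sum_(g in W_q)
    v^-len(g) H_g], which satisfies [a C_s = (v + v^-1) a], and let [h] be the
    self-dual element [a + hbar a]. Then [m h] is self-dual and spherical at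
    [q]. Its coefficients come from the functionals [tau_y z = \sum_(g in W_q)
    v^len(g) z_(y g)], for [y] the highest alcove at a dominant point: the Hecke
    algebra of [W_q] acts on [tau_y] through a character, so that [tau_y (m h) =
    c tau_y m] with [c] independent of [y]. For an element that is spherical at
    [q], [tau_y] is the Poincare polynomial of [W_q] times the coefficient at
    [y] ([tau_sph]), while [tau_y m] is the Poincare polynomial of [W_p] times a
    power of [v] times the sum over a fibre that defines [F_Lam]
    ([tau_canonical]). Up to normalization the Poincare polynomials are bar
    invariant ([norm_poincare_bar]), so a multiple of [m h] has as its
    coefficients those of [F_Lam] of the canonical element at [mu], times a
    nonzero bar invariant factor ([cf_averaged]). Laurent polynomials form a
    domain, and the coefficients of maximal length of a self-dual element are
    bar invariant; subtracting canonical elements from the top downwards then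
    shows that [F_Lam] of the canonical element is self-dual
    ([self_dual_descent]).

    Since [Lam] is dominant, no hyperplane through [F] has [mu + rho] on its
    positive side or [mu + Lam + rho] on its negative side. Thus [A_+(mu + Lam)]
    is the highest alcove at [F], the other terms lie below it by the lifting
    property of the Bruhat order ([facet_op_le]), and its coefficient is [1]
    ([facet_op_nu]).

    Finally [P], applied to any self-dual element with such a leading term,
    terminates with an element which is self-dual and has all its other
    coefficients in [v Z[v]]; the only such element is the canonical one
    ([positivityE]). *)

Set Implicit Arguments.
Unset Strict Implicit.
Unset Printing Implicit Defensive.

Local Open Scope classical_set_scope.
Local Open Scope ring_scope.

(** * Scalar products and affine roots *)

Section Euclid.
Context {R : realType} {n : nat}.
Local Notation V := 'rV[R]_n.
Implicit Types (x y a b : V) (c r : R).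

Lemma dotC x y : dot x y = dot y x.
Proof. by rewrite /dot; apply: eq_bigr => i _; rewrite mulrC. Qed.

Lemma dotDl x y a : dot (x + y) a = dot x a + dot y a.
Proof. by rewrite /dot -big_split; apply: eq_bigr => i _; rewrite mxE mulrDl. Qed.

Lemma dotZl c x a : dot (c *: x) a = c * dot x a.
Proof. by rewrite /dot mulr_sumr; apply: eq_bigr => i _; rewrite mxE mulrA. Qed.

Lemma dotNl x a : dot (- x) a = - dot x a.
Proof. by rewrite -scaleN1r dotZl mulN1r. Qed.

Lemma dotBl x y a : dot (x - y) a = dot x a - dot y a.
Proof. by rewrite dotDl dotNl. Qed.

Lemma dotDr a x y : dot a (x + y) = dot a x + dot a y.
Proof. by rewrite dotC dotDl !(dotC a). Qed.

Lemma dotZr c a x : dot a (c *: x) = c * dot a x.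
Proof. by rewrite dotC dotZl dotC. Qed.

Lemma dotNr a x : dot a (- x) = - dot a x.
Proof. by rewrite dotC dotNl dotC. Qed.

Lemma dotBr a x y : dot a (x - y) = dot a x - dot a y.
Proof. by rewrite dotDr dotNr. Qed.

Lemma dot0r a : dot a 0 = 0.
Proof. by rewrite -(scale0r 0) dotZr mul0r. Qed.

Lemma dot0l a : dot 0 a = 0.
Proof. by rewrite dotC dot0r. Qed.

Lemma dot_sumr (I : Type) (s : seq I) (F : I -> V) a :
  dot a (\sum_(i <- s) F i) = \sum_(i <- s) dot a (F i).
Proof. by apply: (big_morph (dot a)) => [x y|]; rewrite ?dotDr ?dot0r. Qed.

Lemma dot_ge0 x : 0 <= dot x x.
Proof. by rewrite /dot; apply: sumr_ge0 => i _; rewrite -expr2 sqr_ge0. Qed.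

Lemma dot_eq0 x : (dot x x == 0) = (x == 0).
Proof.
apply/eqP/eqP => [|->]; last by rewrite dot0r.
move=> /eqP; rewrite psumr_eq0; last by move=> i _; rewrite -expr2 sqr_ge0.
move=> /allP x0; apply/rowP => i; rewrite mxE.
by have /x0 := mem_index_enum i; rewrite /= -expr2 sqrf_eq0 => /eqP.
Qed.

Lemma dot_gt0 x : x != 0 -> 0 < dot x x.
Proof. by move=> x0; rewrite lt_neqAle dot_ge0 andbT eq_sym dot_eq0. Qed.

Lemma dot_delta a (i : 'I_n) : dot (delta_mx 0 i) a = a 0 i.
Proof.
rewrite /dot (bigD1 i) //= mxE !eqxx mul1r big1 ?addr0 // => j ji.
by rewrite mxE (negbTE ji) andbF mul0r.
Qed.

Lemma aff_reflK a r : a != 0 -> involutive (aff_refl a r).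
Proof.
move=> a0 x; have d0 : dot a a != 0 by rewrite dot_eq0.
rewrite /aff_refl dotBl dotZl -addrA -opprD -scalerDl.
by rewrite [X in _ - X *: _](_ : _ = 0) ?scale0r ?subr0 //; field.
Qed.

Lemma dot_continuous a : continuous (fun x => dot x a).
Proof.
have dc : forall i : 'I_n, true -> continuous (fun x : V => x 0 i * a 0 i).
  move=> i _ x; apply: (@continuousM R V (fun x : V => x 0 i) (fun=> a 0 i)).
    exact: (@coord_continuous R 1 n 0 i x).
  exact: cst_continuous.
have C := @continuous_big R 'I_n +%R 0 xpredT (@add_continuous R) V (index_enum _) _ dc. exact: C.
Qed.

End Euclid.

Section Functionals.
Context {R : realType} {n : nat} (Phi : rootSystem R n) (l : nat).
Context (l_gt0 : (0 < l)%N).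
Local Notation V := 'rV[R]_n.
Implicit Types (x y a b : V) (f g : V -> R) (m k : int).

Lemma lmul0 : lmul l 0 = 0 :> R.
Proof. by rewrite /lmul mul0r. Qed.

Lemma lmul1 : lmul l 1 = l%:R :> R.
Proof. by rewrite /lmul mul1r. Qed.

Lemma lmulN m : lmul l (- m) = - lmul l m :> R.
Proof. by rewrite /lmul mulrNz mulNr. Qed.

Lemma lmulD m k : lmul l (m + k) = lmul l m + lmul l k :> R.
Proof. by rewrite /lmul intrD mulrDl. Qed.

Lemma lR_gt0 : 0 < l%:R :> R.
Proof. by rewrite ltr0n. Qed.

Lemma ltr_lmul m k : (lmul l m < lmul l k :> R) = (m < k).
Proof. by rewrite /lmul ltr_pM2r ?lR_gt0 // ltr_int. Qed.

Lemma ler_lmul m k : (lmul l m <= lmul l k :> R) = (m <= k).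
Proof. by rewrite /lmul ler_pM2r ?lR_gt0 // ler_int. Qed.

Lemma lmul_inj : injective (@lmul R l).
Proof. by move=> m k /eqP; rewrite eq_le !ler_lmul -eq_le => /eqP. Qed.

Definition ev a m x : R := dot x a - lmul l m.

(** The affine functions that define the hyperplanes of the arrangement, each
    with both signs. Facets, alcoves and lengths are all determined by the signs
    of these functions, on which the affine Weyl group acts by composition. *)
Definition aff_root f := exists a m, a \in roots Phi /\ f = ev a m.

(** The linear part of an affine function: with it, the reflection [rf f]
    depends on the function [f] only, not on a root and an integer that
    represent it. *)
Definition grad f : V := \row_i (f (delta_mx 0 i) - f 0).

Definition rf f x : V := x - (f x * 2 / dot (grad f) (grad f)) *: grad f.

Lemma root_neq0 a : a \in roots Phi -> a != 0.
Proof. by apply: contraTneq => ->; exact: roots_neq0. Qed.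

Lemma aff_root_ev a m : a \in roots Phi -> aff_root (ev a m).
Proof. by move=> ra; exists a, m. Qed.

Lemma grad_ev a m : grad (ev a m) = a.
Proof.
by apply/rowP => i; rewrite mxE /ev dot_delta dot0l sub0r opprK subrK.
Qed.

Lemma rf_ev a m : rf (ev a m) = aff_refl a (lmul l m).
Proof. by apply/funext => x; rewrite /rf grad_ev. Qed.

Lemma ev_inj a b m k : ev a m = ev b k -> a = b /\ m = k.
Proof.
move=> e; have ab : a = b by rewrite -(grad_ev a m) e grad_ev.
split=> //; move: e => /(congr1 (@^~ 0)); rewrite /ev ab => /addrI /oppr_inj.
exact: lmul_inj.
Qed.

Lemma rootN a : a \in roots Phi -> - a \in roots Phi.
Proof.
move=> ra; have := roots_reflect ra ra; rewrite /aff_refl subr0 mulrAC.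
rewrite divff ?dot_eq0 ?root_neq0 // mul1r scaler_nat mulr2n opprD addrA.
by rewrite subrr sub0r.
Qed.

Lemma evN a m x : ev (- a) (- m) x = - ev a m x.
Proof. by rewrite /ev dotNr lmulN opprD. Qed.

Lemma aff_rootN f : aff_root f -> aff_root (fun x => - f x).
Proof.
move=> [a [m [ra ->]]]; exists (- a), (- m); split; first exact: rootN.
by apply/funext => x; rewrite evN.
Qed.

Lemma rfN f : aff_root f -> rf (fun x => - f x) = rf f.
Proof.
move=> [a [m [ra ->]]].
have -> : (fun x => - ev a m x) = ev (- a) (- m).
  by apply/funext => x; rewrite evN.
apply/funext => x; rewrite /rf !grad_ev evN dotNr dotNl opprK.
by rewrite !mulNr scalerN scaleNr opprK.
Qed.

Lemma aff_root_line f x y t : aff_root f ->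
  f (x + t *: (y - x)) = f x + t * (f y - f x).
Proof.
by move=> [a [m [_ ->]]]; rewrite /ev dotDl dotZl dotBl; ring.
Qed.

Lemma aff_root_continuous f : aff_root f -> continuous f.
Proof.
move=> [a [m [_ ->]]] x.
apply: (@continuousB R R V (fun x : V => dot x a) (fun=> lmul l m)).
  exact: dot_continuous.
exact: cst_continuous.
Qed.

Lemma rf_anti f x : aff_root f -> f (rf f x) = - f x.
Proof.
move=> [a [m [ra ->]]]; rewrite rf_ev /aff_refl /ev dotBl dotZl.
have d0 : dot a a != 0 by rewrite dot_eq0 root_neq0.
by field.
Qed.

Lemma rfK f : aff_root f -> involutive (rf f).
Proof. by move=> [a [m [ra ->]]]; rewrite rf_ev; exact/aff_reflK/root_neq0. Qed.

Lemma rf_fix f x : f x = 0 -> rf f x = x.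
Proof. by move=> fx; rewrite /rf fx !mul0r scale0r subr0. Qed.

Lemma refl_dot a b : a \in roots Phi -> b \in roots Phi ->
  dot (aff_refl b 0 a) (aff_refl b 0 a) = dot a a.
Proof.
move=> ra rb; have d0 : dot b b != 0 by rewrite dot_eq0 root_neq0.
by rewrite /aff_refl !(dotBl, dotBr, dotZl, dotZr) (dotC b a); field.
Qed.

(** The reflection changes the level by [k <a, b^vee>], an integer because the
    root system is crystallographic. *)
Lemma ev_refl a b m k : a \in roots Phi -> b \in roots Phi ->
  exists m', ev a m \o aff_refl b (lmul l k) = ev (aff_refl b 0 a) m'.
Proof.
move=> ra rb; have d0 : dot b b != 0 by rewrite dot_eq0 root_neq0.
have /intrP[c cE] := roots_integral rb ra.
exists (m - k * c); apply/funext => x; rewrite /= /ev /aff_refl.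
rewrite dotBl dotZl dotBr dotZr subr0 lmulD lmulN.
have -> : lmul l (k * c) = lmul l k * (2 * dot a b / dot b b).
  by rewrite cE /lmul intrM; ring.
by rewrite (dotC b a); field.
Qed.

Lemma aff_root_refl f b k : aff_root f -> b \in roots Phi ->
  aff_root (f \o aff_refl b (lmul l k)).
Proof.
move=> [a [m [ra ->]]] rb; have [m' ->] := ev_refl m k ra rb.
by apply: aff_root_ev; exact: roots_reflect.
Qed.

Lemma rf_refl f b k : aff_root f -> b \in roots Phi ->
  rf f \o aff_refl b (lmul l k) =
  aff_refl b (lmul l k) \o rf (f \o aff_refl b (lmul l k)).
Proof.
move=> [a [m [ra ->]]] rb; have d0 : dot b b != 0 by rewrite dot_eq0 root_neq0.
apply/funext => x /=; have [m' e] := ev_refl m k ra rb.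
have ex := congr1 (@^~ x) e; rewrite /= in ex.
rewrite e /rf !grad_ev -ex refl_dot //.
set c := ev _ _ _ * _ / _; rewrite {2}/aff_refl.
have -> : dot (x - c *: aff_refl b 0 a) b - lmul l k =
    dot x b - lmul l k + c * dot a b.
  by rewrite /aff_refl !(dotBl, dotZl); field.
rewrite /aff_refl; apply/rowP => i; rewrite !mxE; field.
exact: d0.
Qed.

(** * The group generated by all affine reflections *)

Definition allrefl : set (V -> V) :=
  [set g | exists a k, a \in roots Phi /\ g = aff_refl a (lmul l k)].

(** All the reflections of the arrangement; this is the same group as [Waff],
    since both are generated by the reflections in the walls of the fundamental
    alcove. *)
Definition Wr := generated allrefl.

Lemma aff_root_comp f w : aff_root f -> Wr w -> aff_root (f \o w).
Proof.
move=> ff [k wk]; elim: wk f ff => [//|j g w' [a [m [ra ->]]] _ IH] f ff.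
exact: (IH _ (aff_root_refl m ff ra)).
Qed.

Lemma rf_comp f w : aff_root f -> Wr w -> rf f \o w = w \o rf (f \o w).
Proof.
move=> ff [k wk]; elim: wk f ff => [//|j g w' [a [m [ra ->]]] _ IH] f ff.
have := IH _ (aff_root_refl m ff ra).
set u := aff_refl _ _ => e; have := rf_refl m ff ra; rewrite -/u => e2.
apply/funext => x; have := congr1 (@^~ (w' x)) e2; rewrite /= => ->.
by have := congr1 (@^~ x) e; rewrite /= => ->.
Qed.

End Functionals.

Section Words.
Context {T : Type}.
Implicit Types (S : set (T -> T)) (w : T -> T).

Lemma word_cat S k j w w' : word S k w -> word S j w' ->
  word S (k + j) (w \o w').
Proof.
move=> + ww'; elim=> [//|i g u Sg _ IH]; rewrite addSn.
exact: (word_cons Sg IH).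
Qed.

Lemma word1 S g : S g -> word S 1 g.
Proof. by move=> Sg; exact: (word_cons Sg (word_nil S)). Qed.

Lemma word_case S k w : word S k w -> (k = 0%N /\ w = id) \/
  exists j g u, [/\ k = j.+1, S g, word S j u & w = g \o u].
Proof. by case=> [|j g u Sg wu]; [left|right; exists j, g, u]. Qed.

Lemma gen1 S g : S g -> generated S g.
Proof. by move=> Sg; exists 1%N; exact: word1. Qed.

Lemma gen_id S : generated S id.
Proof. by exists 0%N; constructor. Qed.

Lemma gen_comp S w w' : generated S w -> generated S w' -> generated S (w \o w').
Proof. by move=> [k wk] [j wj]; exists (k + j)%N; exact: word_cat. Qed.

Lemma gen_sub S S' : S `<=` generated S' -> generated S `<=` generated S'.
Proof.
move=> SS' w [k]; elim=> [|i g u Sg _ IH]; first exact: gen_id.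
by apply: gen_comp => //; exact: SS'.
Qed.

Lemma gen_inv S w : (forall g, S g -> involutive g) -> generated S w ->
  exists w', [/\ generated S w', w \o w' = id & w' \o w = id].
Proof.
move=> SK [k]; elim=> [|i g u Sg _ [u' [gu' e1 e2]]].
  by exists id; split => //; exact: gen_id.
exists (u' \o g); split; first by apply: gen_comp => //; exact: gen1.
  apply/funext => x /=; have /= -> := congr1 (@^~ (g x)) e1; exact: SK.
by apply/funext => x /=; rewrite SK //; have /= := congr1 (@^~ x) e2.
Qed.

End Words.

Section ListBounds.
Context {R : realType} {T : eqType}.

Lemma seq_ub (s : seq T) (F : T -> R) :
  exists2 M, 0 < M & forall a, a \in s -> F a <= M.
Proof.
elim: s => [|b s [M M0 IH]]; first by exists 1.
exists (Num.max M (F b)); first by rewrite lt_max M0.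
move=> a; rewrite inE le_max => /orP[/eqP->|/IH ->]; by rewrite ?lexx ?orbT.
Qed.

Lemma seq_lb (s : seq T) (F : T -> R) : (forall a, a \in s -> 0 < F a) ->
  exists2 d, 0 < d & forall a, a \in s -> d <= F a.
Proof.
move=> F0; have [M M0 FM] := seq_ub s (fun a => (F a)^-1).
exists M^-1; first by rewrite invr_gt0.
move=> a sa; rewrite -[F a]invrK lef_pV2 ?FM // posrE ?invr_gt0 ?F0 //.
Qed.

End ListBounds.

Section Base.
Context {R : realType} {n : nat} (Phi : rootSystem R n) (l : nat).
Context (l_gt0 : (0 < l)%N).
Local Notation V := 'rV[R]_n.
Local Notation aff_root := (aff_root Phi l).
Local Notation ev := (ev l).
Local Notation nneg := (nneg_comb (simple Phi)).
Implicit Types (x y a b : V) (f g : V -> R) (m k : int).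

Lemma simple_coord (c : 'I_n -> R) :
  exists x : V, forall i, dot x (simple Phi i) = c i.
Proof.
pose B := \matrix_(i < n) simple Phi i.
have uB : B^T \in unitmx by rewrite unitmx_tr; exact: simple_basis.
exists ((\row_j c j) *m invmx B^T) => i.
have <- : (((\row_j c j) *m invmx B^T) *m B^T) 0 i = c i.
  by rewrite mulmxKV // mxE.
by rewrite mxE; apply: eq_bigr => j _; rewrite !mxE.
Qed.

Lemma nneg_dot_ge0 x b :
  (forall i, 0 <= dot x (simple Phi i)) -> nneg b -> 0 <= dot x b.
Proof.
move=> x0 [c ->]; rewrite dot_sumr; apply: sumr_ge0 => i _.
by rewrite dotZr mulr_ge0.
Qed.

Lemma nneg_dot_gt0 x b : chamber Phi x -> nneg b -> b != 0 -> 0 < dot x b.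
Proof.
move=> xC nb b0; rewrite lt_neqAle nneg_dot_ge0 ?andbT //; last first.
  by move=> i; exact/ltW/xC.
apply: contraNneq b0 => /esym; case: nb => c ->; rewrite dot_sumr => /eqP.
rewrite psumr_eq0; last first.
  by move=> i _; rewrite dotZr mulr_ge0 //; exact/ltW/xC.
move=> /allP c0; apply/eqP; apply: big1 => i _.
have := c0 i (mem_index_enum i); rewrite dotZr mulf_eq0 (gt_eqF (xC i)) orbF.
by move=> /eqP ->; rewrite scale0r.
Qed.

Lemma simple_nneg i : nneg (simple Phi i).
Proof.
exists (fun j => (j == i) : nat); rewrite (bigD1 i) //= eqxx scale1r big1 ?addr0 //.
by move=> j /negbTE ->; rewrite scale0r.
Qed.

Lemma chamber1 : exists x, forall i, dot x (simple Phi i) = 1.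
Proof. exact: (simple_coord (fun=> 1)). Qed.

Lemma theta_neq0 : theta Phi != 0.
Proof. by apply: (root_neq0 (theta_root Phi)). Qed.

(** Otherwise [- theta] would be a positive root, and [theta - (- theta)] could
    not be a nonnegative combination of simple roots. *)
Lemma theta_nneg : nneg (theta Phi).
Proof.
have [//|nt] := simple_base (theta_root Phi).
have [x x1] := chamber1.
have xC : chamber Phi x by move=> i; rewrite x1.
have t0 := nneg_dot_gt0 xC nt.
have := nneg_dot_gt0 xC (theta_highest (rootN (theta_root Phi))).
rewrite opprK dotDr; move: t0; rewrite dotNr oppr_eq0 theta_neq0.
rewrite -mulr2n -scaler_nat scaler_eq0 pnatr_eq0 /= theta_neq0.
by move=> /(_ isT) t0 /(_ isT); lra.
Qed.

Lemma theta_dot_gt0 x : chamber Phi x -> 0 < dot x (theta Phi).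
Proof. by move=> xC; apply: nneg_dot_gt0 theta_nneg theta_neq0. Qed.

Lemma theta_max x a : (forall i, 0 <= dot x (simple Phi i)) ->
  a \in roots Phi -> dot x a <= dot x (theta Phi).
Proof.
by move=> x0 ra; rewrite -subr_ge0 -dotBr; apply/nneg_dot_ge0/theta_highest.
Qed.

Lemma Aplus_nonempty : Aplus Phi l !=set0.
Proof.
have [x x1] := chamber1.
have xC : chamber Phi x by move=> i; rewrite x1.
have T0 := theta_dot_gt0 xC.
exists ((l%:R / (2 * dot x (theta Phi))) *: x); split.
  move=> i; rewrite dotZl x1 mulr1 divr_gt0 ?(lR_gt0 l_gt0) //.
  by rewrite mulr_gt0.
rewrite /neg_side /= dotZl invfM -!mulrA mulVf ?gt_eqF // mulr1.
by have := lR_gt0 (R := R) l_gt0; lra.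
Qed.

(** A reference point of the fundamental alcove: the alcove [w A_+] is
    represented by the point [w base]. *)
Definition base : V := xget 0 (Aplus Phi l).
Local Notation a0 := base.

Lemma base_Aplus : Aplus Phi l a0.
Proof. by apply: xgetPex; exact: Aplus_nonempty. Qed.

Lemma base_chamber : chamber Phi a0.
Proof. by case: base_Aplus. Qed.

Lemma root_cases (P : V -> Prop) :
  (forall a, a \in roots Phi -> nneg a -> P a) ->
  (forall a, a \in roots Phi -> nneg a -> P (- a)) ->
  forall a, a \in roots Phi -> P a.
Proof.
move=> P1 P2 a ra; have [na|na] := simple_base ra; first exact: P1.
by rewrite -[a]opprK; apply: P2 => //; exact: rootN.
Qed.

Lemma Aplus_dot x a : Aplus Phi l x -> a \in roots Phi -> nneg a ->
  0 < dot x a < l%:R.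
Proof.
move=> [xC xt] ra na; rewrite nneg_dot_gt0 ?(root_neq0 ra) //=.
by apply: le_lt_trans xt; apply: theta_max => // i; exact/ltW/xC.
Qed.

Lemma pos_lmulP (r : R) m : 0 < r < l%:R -> (lmul l m < r) = (m <= 0).
Proof.
move=> /andP[r0 rl]; case: (lerP m 0) => m0.
  by apply: le_lt_trans r0; rewrite -(lmul0 l) ler_lmul.
apply/negbTE; rewrite -leNgt; apply: (le_trans (ltW rl)).
by rewrite -lmul1 ler_lmul //; lia.
Qed.

Lemma pos_ltmulP (r : R) m : 0 < r < l%:R -> (r < lmul l m) = (0 < m).
Proof.
move=> r0l; case: (ltgtP r (lmul l m)) => [rm|rm|rm].
- by move: (pos_lmulP m r0l); rewrite ltNge (ltW rm) /= => /esym/negbT; lia.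
- by move: (pos_lmulP m r0l); rewrite rm => /esym; lia.
move: r0l; rewrite rm -{1}(lmul0 l) -lmul1 !ltr_lmul //; lia.
Qed.

Lemma evP a m x : (0 < ev a m x) = (lmul l m < dot x a).
Proof. by rewrite subr_gt0. Qed.

Lemma Aplus_sign x y f : aff_root f -> Aplus Phi l x -> Aplus Phi l y ->
  0 < f x -> 0 < f y.
Proof.
move=> [a [m [ra ->]]] xA yA; rewrite !evP; move: a ra.
apply: root_cases => a ra na.
  by rewrite !pos_lmulP // Aplus_dot.
by rewrite !dotNr !(ltrNr (lmul l m)) -(lmulN _ m) !pos_ltmulP // Aplus_dot.
Qed.

Lemma Aplus_neq0 x f : aff_root f -> Aplus Phi l x -> f x != 0.
Proof.
move=> [a [m [ra ->]]] xA.
suff: forall a m, a \in roots Phi -> nneg a -> ev a m x != 0.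
  move=> H; have [na|na] := simple_base ra; first exact: H.
  by rewrite -oppr_eq0 -evN; apply: H => //; exact: rootN.
move=> {m ra}a m ra na; have := Aplus_dot xA ra na => xl.
case: (ltgtP (lmul l m) (dot x a)) => [h|h|h].
- by rewrite gt_eqF // evP.
- by rewrite lt_eqF // subr_lt0.
have := pos_lmulP m xl; have := pos_ltmulP m xl; rewrite h ltxx; lia.
Qed.

(** The affine roots that are positive on the fundamental alcove and vanish on
    one of its walls: the simple roots, and [l - theta]. *)
Definition wall f := (exists i, f = ev (simple Phi i) 0) \/ f = ev (- theta Phi) (-1).

Lemma wall_fun f : wall f -> aff_root f.
Proof.
move=> [[i ->]|->]; apply: aff_root_ev; first exact: simple_root.
exact/rootN/theta_root.
Qed.

Lemma wall_AplusP x : Aplus Phi l x <-> forall f, wall f -> 0 < f x.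
Proof.
split=> [[xC xt] f [[i ->]|->]|xf].
- by rewrite evP lmul0.
- by rewrite evP lmulN lmul1 dotNr ltrN2.
split; first by move=> i; have := xf _ (or_introl (ex_intro _ i erefl)); rewrite evP lmul0.
by have := xf _ (or_intror erefl); rewrite evP lmulN lmul1 dotNr ltrN2.
Qed.

Lemma wall_gt0 f : wall f -> 0 < f a0.
Proof. by move: f; apply/wall_AplusP; exact: base_Aplus. Qed.

(** The point [x] lies in the closure of the facet of [y] (see
    [closure_cellP]). *)
Definition spec x y := forall f, aff_root f -> 0 < f x -> 0 < f y.

Lemma spec_refl x : spec x x. Proof. by []. Qed.

Lemma spec_trans y x z : spec x y -> spec y z -> spec x z.
Proof. by move=> xy yz f ff /(xy _ ff); exact: yz. Qed.

Lemma spec_ge0 x y f : spec x y -> aff_root f -> 0 <= f y -> 0 <= f x.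
Proof.
move=> xy ff; apply: contraTT; rewrite -!ltNge => fx.
have := xy _ (aff_rootN ff); rewrite !oppr_gt0; exact.
Qed.

Lemma spec_eq0 x y f : spec x y -> aff_root f -> f y = 0 -> f x = 0.
Proof.
move=> xy ff fy; apply/eqP; rewrite eq_le (spec_ge0 xy) ?fy // andbT.
by rewrite -oppr_ge0; apply: (spec_ge0 xy (aff_rootN ff)); rewrite fy oppr0.
Qed.

Lemma spec_act w x y : Wr Phi l w -> spec x y -> spec (w x) (w y).
Proof. by move=> Ww xy f ff; exact: (xy _ (aff_root_comp ff Ww)). Qed.

(** If an affine root were positive at [x] and negative at the base point, it
    would vanish at an interior point of the segment joining them, and this
    point lies in the open fundamental alcove. *)
Lemma closed_alcoveP x : spec x a0 <-> forall f, wall f -> 0 <= f x.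
Proof.
split=> [xa f wf|xf f ff fx].
  exact: (spec_ge0 xa (wall_fun wf) (ltW (wall_gt0 wf))).
have [//|f0] := ltP 0 (f a0).
have {}f0 : f a0 < 0 by rewrite lt_neqAle f0 (Aplus_neq0 ff base_Aplus).
(* The parameter of the zero of [f] on the segment from [x] to the base
   point. *)
pose t := f x / (f x - f a0).
have t0 : 0 < t by rewrite divr_gt0 // subr_gt0 (lt_trans f0).
have yA : Aplus Phi l (x + t *: (a0 - x)).
  apply/wall_AplusP => g wg; rewrite (aff_root_line _ _ _ (wall_fun wg)).
  have t1 : t <= 1 by rewrite ler_pdivrMr ?mul1r; lra.
  by have := xf _ wg; have := wall_gt0 wg; nra.
have := Aplus_neq0 ff yA; rewrite (aff_root_line _ _ _ ff) /t => /eqP; case.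
by field; lra.
Qed.

(** There are finitely many roots, and the levels of each of them are
    discrete. *)
Lemma gap x : exists2 d, 0 < d & forall f, aff_root f -> 0 < f x -> d <= f x.
Proof.
pose m a : int := Num.ceil (dot x a / l%:R) - 1.
have lR := lR_gt0 (R := R) l_gt0.
have mE a k : lmul l k < dot x a -> k <= m a.
  rewrite /m lerBrDr lezD1 /lmul -ltr_pdivlMr // => h.
  rewrite -(ltr_int R); exact: (lt_le_trans h (ceil_ge _)).
have mlt a : lmul l (m a) < dot x a.
  rewrite /lmul /m -ltr_pdivlMr //.
  have := ceil_itv (dot x a / l%:R); rewrite intrD => /andP[]; lra.
have [d d0 dP] := @seq_lb R _ (roots Phi) (fun a => dot x a - lmul l (m a))
  (fun a _ => ltac:(by rewrite subr_gt0)).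
exists d => // _ [a [k [ra ->]]]; rewrite evP => /mE km.
apply: (le_trans (dP _ ra)); rewrite /ev lerB // ler_lmul //.
Qed.

(** A short move does not cross any hyperplane that does not contain the
    point. *)
Lemma ray x d : exists2 e, 0 < e & forall t, 0 < t < e ->
  forall f, aff_root f -> 0 < f x -> 0 < f (x + t *: d).
Proof.
have [g g0 gP] := gap x.
have [M M0 dM] := @seq_ub R _ (roots Phi) (fun a => `|dot d a|).
exists (g / M); first exact: divr_gt0.
move=> t /andP[t0 te] f ff fx; have := gP _ ff fx.
move: ff fx => [a [m [ra ->]]] _ gf.
have -> : ev a m (x + t *: d) = ev a m x + t * dot d a.
  by rewrite /ev dotDl dotZl; ring.
have /ler_normlP[h _] := dM _ ra.
move: te; rewrite ltr_pdivlMr // => te.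
have : t * M < ev a m x by exact: lt_le_trans te gf.
nra.
Qed.

(** Reflecting a point in a wall that separates it from the base point brings it
    closer to the base point, and the squared distance drops by an amount
    bounded below, because all the points of an orbit have the same [gap]. *)
Lemma reach x : exists2 w,
  generated [set s | exists2 f, wall f & s = rf f] w & spec (w x) a0.
Proof.
have [d d0 dP] := gap x; have [e e0 eP] := gap a0.
have [M M0 aM] := @seq_ub R _ (roots Phi) (fun a => dot a a).
set S := [set s | _].
(* The squared distance to the base point. *)
pose D (y : V) := dot (y - a0) (y - a0).
have SW : generated S `<=` Wr Phi l.
  apply: gen_sub => _ [f wf ->]; apply: gen1.
  by have [a [m [ra ->]]] := wall_fun wf; exists a, m; rewrite rf_ev.
have step w f : generated S w -> wall f -> f (w x) < 0 ->
    D (rf f (w x)) <= D (w x) - 4 * d * e / M.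
  move=> Sw wf fx; have ff := wall_fun wf.
  have fd : f (w x) <= - d.
    rewrite lerNr; apply: (dP (fun y => - f (w y))); last by rewrite oppr_gt0.
    exact/aff_rootN/(aff_root_comp ff)/SW.
  have fe := eP _ ff (wall_gt0 wf).
  have [a [m [ra fE]]] := ff; have aa := dot_gt0 (root_neq0 ra).
  (* The reflection moves the point along the root [a], hence the change is
     linear in the values of [f] at both points. *)
  have -> : D (rf f (w x)) = D (w x) + 4 * f (w x) * f a0 / dot a a.
    rewrite /D {1 2}fE rf_ev /aff_refl fE.
    rewrite /ev !(dotBl, dotBr, dotZl, dotZr) (dotC a (w x)) (dotC a a0).
    rewrite (dotC a0 (w x)); field.
    by rewrite gt_eqF.
  rewrite lerD2l -mulNr ler_pdivlMr // mulrAC.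
  rewrite ler_pdivrMr //; have aaM := aM _ ra.
  have de : d * e <= - f (w x) * f a0.
    by apply: ler_pM; rewrite ?(ltW d0) ?(ltW e0) //; lra.
  have : 0 <= (- f (w x) * f a0 - d * e) * M by rewrite mulr_ge0 ?subr_ge0 // ltW.
  have : 0 <= d * e * (M - dot a a) by rewrite mulr_ge0 ?subr_ge0 // ltW // mulr_gt0.
  lra.
pose h := 4 * d * e / M.
have h0 : 0 < h by rewrite divr_gt0 // !mulr_gt0.
(* Induction on the number of steps of size [h] that are left. *)
suff H (k : nat) w : generated S w -> D (w x) < k%:R * h ->
    exists2 w', generated S w' & spec (w' x) a0.
  apply: (H (Num.bound (D x / h)) id); first exact: gen_id.
  by rewrite -ltr_pdivrMr // archi_boundP // divr_ge0 ?dot_ge0 // ltW.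
elim: k w => [|k IH] w Sw; first by rewrite mul0r ltNge dot_ge0.
move=> Dk; have [wx|] := pselect (spec (w x) a0); first by exists w.
move=> /closed_alcoveP /existsNP[f /not_implyP[wf /negP]]; rewrite -ltNge => fx.
apply: (IH (rf f \o w)).
  by apply: gen_comp => //; apply: gen1; exists f.
apply: le_lt_trans (step _ _ Sw wf fx) _.
by move: Dk; rewrite -natr1 mulrDl mul1r /h; lra.
Qed.

(** * A generic point of a hyperplane *)

(** Only multiples of [a] are orthogonal to the whole hyperplane orthogonal to
    [a]; the finitely many remaining roots are made nonzero one after the other,
    by adding a small multiple of the component of the root orthogonal to
    [a]. *)
Lemma generic_dir a : a \in roots Phi -> exists2 u, dot u a = 0 &
  forall b, b \in roots Phi -> b != a -> b != - a -> dot u b != 0.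
Proof.
move=> ra; have aa := dot_gt0 (root_neq0 ra).
suff H (s : seq V) : {subset s <= roots Phi} -> exists2 u, dot u a = 0 &
    forall b, b \in s -> b != a -> b != - a -> dot u b != 0 by exact: H.
elim: s => [|b s IH] sr; first by exists 0; rewrite ?dot0l.
have [|u ua uP] := IH; first by move=> c cs; apply: sr; rewrite inE cs orbT.
have rb : b \in roots Phi by apply: sr; rewrite mem_head.
have [ub|ub] := eqVneq (dot u b) 0; last first.
  by exists u => // c; rewrite inE => /orP[/eqP -> //|]; exact: uP.
(* [b'] is orthogonal to [a], and not to [b] unless [b] is a multiple of [a]. *)
pose b' := b - (dot b a / dot a a) *: a.
have b'a : dot b' a = 0 by rewrite dotBl dotZl divfK ?subrr // gt_eqF.
have [b'0|b'0] := eqVneq b' 0.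
  exists u => // c; rewrite inE => /orP[/eqP -> | ]; last exact: uP.
  have bE := subr0_eq b'0.
  have : (dot b a / dot a a) *: a \in roots Phi by rewrite -bE.
  move=> /(roots_reduced ra)[] h; rewrite h in bE.
    by rewrite bE scale1r eqxx.
  by rewrite bE scaleN1r eqxx.
have b'b : dot b' b = dot b' b'.
  by rewrite [in RHS]/b' dotBr dotZr b'a mulr0 subr0.
have [d d0 dP] := @seq_lb R _ [seq c <- s | dot u c != 0]
  (fun c => `|dot u c|) (fun c => ltac:(by rewrite mem_filter normr_gt0 => /andP[])).
have [M M0 MP] := @seq_ub R _ s (fun c => `|dot b' c|).
(* Small enough to leave the values at the roots of [s] nonzero. *)
pose e := d / (M + M); have e0 : 0 < e by rewrite divr_gt0 // addr_gt0.
exists (u + e *: b'); first by rewrite dotDl dotZl ua b'a mulr0 addr0.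
move=> c; rewrite inE dotDl dotZl => /orP[/eqP-> _ _|cs ca cNa].
  by rewrite ub add0r mulf_neq0 ?gt_eqF // b'b dot_gt0.
have uc := uP _ cs ca cNa.
have dc : d <= `|dot u c| by apply: dP; rewrite mem_filter uc.
rewrite addr_eq0; apply: contraTneq dc => ->.
rewrite normrN normrM (gtr0_norm e0) -ltNge.
have hM := MP _ cs; have eM : e * (M + M) = d by rewrite divfK //; lra.
have : 0 <= e * (M - `|dot b' c|) by rewrite mulr_ge0 ?(ltW e0) ?subr_ge0.
have := mulr_gt0 e0 M0; lra.
Qed.

(** Start from any point of the hyperplane and move a little in the direction
    given by [generic_dir]. *)
Lemma generic_point f : aff_root f -> exists2 x, f x = 0 &
  forall g, aff_root g -> g x = 0 -> g = f \/ g = (fun y => - f y).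
Proof.
move=> [a [m [ra ->]]]; have aa := dot_gt0 (root_neq0 ra).
pose x0 := (lmul l m / dot a a) *: a.
have x0a : ev a m x0 = 0 by rewrite /ev dotZl divfK ?subrr // gt_eqF.
have [u ua uP] := generic_dir ra; have [e e0 eP] := ray x0 u.
have te : 0 < e / 2 < e by lra.
have evD b k t : ev b k (x0 + t *: u) = ev b k x0 + t * dot u b.
  by rewrite /ev dotDl (dotZl t); ring.
exists (x0 + (e / 2) *: u).
  by rewrite evD ua mulr0 addr0.
have key g : aff_root g -> g (x0 + (e / 2) *: u) = 0 -> g x0 = 0.
  move=> gf g0; apply/eqP; rewrite eq_le !leNgt; apply/andP; split.
    by apply/negP => /(eP _ te _ gf); rewrite g0 ltxx.
  apply/negP; rewrite -oppr_gt0 => /(eP _ te _ (aff_rootN gf)).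
  by rewrite g0 oppr0 ltxx.
move=> g gf g0; have := key _ gf g0; case: gf g0 => b [k [rb ->]] g0 gx0.
have ub : dot u b = 0.
  move: g0; rewrite evD gx0 => h1.
  have : e / 2 * dot u b = 0 by lra.
  by move/eqP; rewrite mulf_eq0 gt_eqF ?divr_gt0 //= => /eqP.
have [ba|ba] := eqVneq b a.
  left; congr ev => //; apply: (lmul_inj (R := R) l_gt0).
  by move: gx0 x0a; rewrite ba /ev; lra.
have [bNa|bNa] := eqVneq b (- a); last by have := uP _ rb ba bNa; rewrite ub eqxx.
right; have -> : k = - m.
  apply: (lmul_inj (R := R) l_gt0).
  by move: gx0 x0a; rewrite bNa /ev dotNr lmulN; lra.
by apply/funext => y; rewrite bNa evN.
Qed.

(** * The walls of the fundamental alcove *)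

(** Each wall of the fundamental alcove contains a point of the closed alcove on
    no other hyperplane. For a simple root this is a small multiple of the sum
    of the other fundamental coweights, for [theta] a multiple of the sum of all
    of them. *)
Lemma wall_point f : wall f -> exists x, [/\ spec x a0, f x = 0 &
  forall g, aff_root g -> 0 < g a0 -> g x = 0 -> g = f].
Proof.
have lR := lR_gt0 (R := R) l_gt0.
have base_pos a m : a \in roots Phi -> nneg a -> 0 < ev a m a0 -> m <= 0.
  by move=> ra na; rewrite evP pos_lmulP // (Aplus_dot base_Aplus).
have base_neg a m : a \in roots Phi -> nneg a -> 0 < ev (- a) m a0 -> m <= -1.
  move=> ra na; rewrite evP dotNr ltrNr -lmulN pos_ltmulP ?(Aplus_dot base_Aplus) //.
  lia.
move=> wf; have ff := wall_fun wf; move: wf => [[i fE]|fE].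
  have [x xE] := simple_coord (fun j => if j == i then 0 else 1).
  have x0 j : 0 <= dot x (simple Phi j) by rewrite xE; case: ifP.
  have T0 := nneg_dot_ge0 x0 theta_nneg.
  pose c := l%:R / (2 * (dot x (theta Phi) + 1)).
  have c0 : 0 < c by rewrite divr_gt0 // mulr_gt0 //; lra.
  have cT : c * dot x (theta Phi) < l%:R.
    rewrite /c mulrAC ltr_pdivrMr; last by lra.
    by rewrite ltr_pM2l //; lra.
  have fx : f (c *: x) = 0 by rewrite fE /ev dotZl xE eqxx mulr0 lmul0 subr0.
  exists (c *: x); split=> //.
    apply/closed_alcoveP => g [[j ->]|->]; rewrite /ev dotZl ?lmul0 ?subr0.
      by rewrite mulr_ge0 // ltW.
    by rewrite dotNr lmulN lmul1; lra.
  move=> _ [b [m [rb ->]]] b0 bx.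
  have [nb|] := simple_base rb.
    have m0 := base_pos _ _ rb nb b0.
    have xb := nneg_dot_ge0 x0 nb.
    have cb : c * dot x b = lmul l m by move: bx; rewrite /ev dotZl; lra.
    have m00 : m = 0.
      apply: le_anti; rewrite m0 /= -(ler_lmul (R := R) l_gt0) lmul0 -cb.
      by rewrite mulr_ge0 // ltW.
    move: cb; rewrite m00 lmul0 => /eqP; rewrite mulf_eq0 gt_eqF //= => /eqP xb0.
    suff -> : b = simple Phi i by rewrite fE.
    case: nb => e bE; move: xb0; rewrite {1}bE dot_sumr => /eqP.
    rewrite psumr_eq0 => [/allP e0|j _]; last by rewrite dotZr mulr_ge0.
    have {}bE : b = (e i)%:R *: simple Phi i.
      rewrite bE (bigD1 i) //= big1 ?addr0 // => j ji.
      have := e0 j (mem_index_enum j); rewrite dotZr xE (negbTE ji) mulr1.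
      by move=> /eqP ->; rewrite scale0r.
    rewrite bE; move: rb; rewrite bE.
    move=> /(roots_reduced (simple_root Phi i)).
    case=> ei; first by rewrite ei scale1r.
    by exfalso; have := ler0n R (e i); rewrite ei; lra.
  rewrite -[b]opprK opprK => nb; set b' := - b in nb *.
  have rb' : b' \in roots Phi by exact: rootN.
  rewrite -[b]opprK -/b' in b0 bx.
  have mN := base_neg _ _ rb' nb b0.
  move: bx; rewrite /ev dotNr dotZl => bx.
  have : lmul l m <= lmul l (-1) :> R by rewrite ler_lmul.
  rewrite lmulN lmul1 => h.
  by exfalso; have := theta_max x0 rb'; rewrite -(ler_pM2l c0); lra.
have [x x1] := chamber1.
have xC : chamber Phi x by move=> i; rewrite x1.
have x0 j : 0 <= dot x (simple Phi j) by rewrite x1.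
have T0 := theta_dot_gt0 xC; pose c := l%:R / dot x (theta Phi).
have c0 : 0 < c by rewrite divr_gt0.
have cT : c * dot x (theta Phi) = l%:R by rewrite divfK // gt_eqF.
have fx : f (c *: x) = 0 by rewrite fE /ev dotZl dotNr lmulN lmul1; lra.
exists (c *: x); split=> //.
  apply/closed_alcoveP => g [[j ->]|->]; rewrite /ev dotZl ?lmul0 ?subr0.
    by rewrite mulr_ge0 // ltW.
  by rewrite dotNr lmulN lmul1; lra.
move=> _ [b [m [rb ->]]] b0 bx.
have [nb|] := simple_base rb.
  have m0 := base_pos _ _ rb nb b0.
  have xb := nneg_dot_gt0 xC nb (root_neq0 rb).
  have : lmul l m <= lmul l 0 :> R by rewrite ler_lmul.
  rewrite lmul0 => h; exfalso; have := mulr_gt0 c0 xb.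
  by move: bx; rewrite /ev dotZl; lra.
rewrite -[b]opprK opprK => nb; set b' := - b in nb *.
have rb' : b' \in roots Phi by exact: rootN.
rewrite -[b]opprK -/b' in b0 bx *.
have mN := base_neg _ _ rb' nb b0.
move: bx; rewrite /ev dotNr dotZl => bx.
have mm := theta_max x0 rb'.
have : lmul l m <= lmul l (-1) :> R by rewrite ler_lmul.
rewrite lmulN lmul1 => h.
have m1 : m = -1.
  apply: (lmul_inj (R := R) l_gt0); rewrite lmulN lmul1.
  have := mm; rewrite -(ler_pM2l c0); lra.
rewrite fE m1; congr (ev (- _) _); apply/esym/eqP.
rewrite -subr_eq0; apply: contraT => tb.
have := nneg_dot_gt0 xC (theta_highest rb') tb.
rewrite dotBr -(ltr_pM2l c0) mulr0 mulrBr.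
have : lmul l m = - l%:R :> R by rewrite m1 lmulN lmul1.
lra.
Qed.

End Base.

(** * Facets, the affine Weyl group and the Bruhat order *)

Section Topology.
Context {R : realType} {n : nat} (Phi : rootSystem R n) (l : nat).
Context (l_gt0 : (0 < l)%N).
Local Notation V := 'rV[R]_n.
Local Notation aff_root := (aff_root Phi l).
Local Notation wall := (wall Phi l).
Local Notation spec := (spec Phi l).
Local Notation a0 := (base Phi l).
Implicit Types (x y a b : V) (f g : V -> R) (m k : int).

(** The facet of [y] (see [facetE]). *)
Definition cell y : set V := [set z | spec z y /\ spec y z].

Lemma closure_ge0 (A : set V) f x : continuous f -> (forall y, A y -> 0 <= f y) ->
  closure A x -> 0 <= f x.
Proof.
move=> fc fA Ax; rewrite leNgt; apply/negP => fx.
have [y [Ay /=]] := Ax _ (cvgr_lt _ (fc x) _ fx).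
by rewrite ltNge fA.
Qed.

(** An affine root that is positive at [y] is nonnegative at [x], hence positive
    in between. *)
Lemma cell_segment x y t : spec x y -> 0 < t <= 1 -> cell y (x + t *: (y - x)).
Proof.
move=> xy /andP[t0 t1]; split=> f ff; rewrite (aff_root_line _ _ _ ff); last first.
  move=> fy; have := spec_ge0 xy ff (ltW fy); nra.
move=> h; case: (ltP 0 (f y)) => // fy.
have : f x <= 0.
  rewrite -oppr_ge0; apply: (spec_ge0 xy (aff_rootN ff)); lra.
nra.
Qed.

Lemma closure_cellP y x : closure (cell y) x <-> spec x y.
Proof.
split=> [xy f ff fx|xy B Bx].
  rewrite ltNge; apply/negP => fy; move: fx; apply/negP; rewrite -leNgt -oppr_ge0.
  apply: (closure_ge0 (f := fun z => - f z) _ _ xy).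
    exact: (aff_root_continuous (aff_rootN ff)).
  move=> z [zy _]; apply: (spec_ge0 zy (aff_rootN ff)); lra.
have /nbhs_ballP[e /= e0 eB] := Bx.
have [M M0 MP] := @seq_ub R _ (index_enum 'I_n) (fun i => `|(y - x) 0 i|).
pose t := Num.min (e / (2 * M)) 1.
have t0 : 0 < t by rewrite lt_min ltr01 andbT divr_gt0 // mulr_gt0.
exists (x + t *: (y - x)); split.
  by apply: cell_segment => //; rewrite t0 /t ge_min lexx orbT.
apply: eB; split=> // i j; rewrite !ord1 /ball /= !mxE opprD addNKr normrN normrM gtr0_norm //.
have te : t * M <= e / 2.
  have : t <= e / (2 * M) by rewrite /t ge_min lexx.
  by rewrite ler_pdivlMr ?mulr_gt0 //; lra.
have := MP j (mem_index_enum j); rewrite !mxE => h.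
have := ler_wpM2l (ltW t0) h; lra.
Qed.

Lemma cell_refl x : cell x x. Proof. by split. Qed.

Lemma cell_eq x y : cell y x -> cell x = cell y.
Proof.
move=> [xy yx]; apply/seteqP; split=> z [h1 h2]; split.
- exact: spec_trans xy.
- exact: spec_trans h2.
- exact: spec_trans yx.
- exact: spec_trans h2.
Qed.

Lemma cell_base : cell a0 = Aplus Phi l.
Proof.
apply/seteqP; split=> x; last first.
  move=> xA; split=> f ff; have aA := base_Aplus Phi l_gt0; exact: Aplus_sign ff _ _.
move=> [_ ax]; apply/wall_AplusP => f wf.
by apply: ax; [exact: wall_fun|exact: wall_gt0].
Qed.

Lemma closure_Aplus x : closure (Aplus Phi l) x <-> spec x a0.
Proof. by rewrite -cell_base; exact: closure_cellP. Qed.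

Lemma closure_chamber x : closure (chamber Phi) x ->
  forall i, 0 <= dot x (simple Phi i).
Proof.
move=> xC i; apply: (closure_ge0 (f := fun y => dot y (simple Phi i)) _ _ xC) => [|y yC].
  exact: dot_continuous.
exact/ltW/yC.
Qed.

Lemma pos_rootsP a : a \in pos_roots Phi <->
  a \in roots Phi /\ nneg_comb (simple Phi) a.
Proof.
rewrite mem_filter; split=> [/andP[/asboolP]|[ra na]] //.
by rewrite ra andbT; apply/asboolP.
Qed.

Lemma pos_root_root a : a \in pos_roots Phi -> a \in roots Phi.
Proof. by move=> /pos_rootsP[]. Qed.

Lemma pos_roots_dot x a : chamber Phi x -> a \in pos_roots Phi -> 0 < dot x a.
Proof.
move=> xC /pos_rootsP[ra na]; apply: nneg_dot_gt0 => //; exact: root_neq0 ra.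
Qed.

Lemma root_pos a : a \in roots Phi -> a \in pos_roots Phi \/ - a \in pos_roots Phi.
Proof.
by move=> ra; case: (simple_base ra) => na; [left|right]; apply/pos_rootsP;
  split=> //; exact: rootN.
Qed.

Lemma pos_rootN a : a \in pos_roots Phi -> - a \in pos_roots Phi -> False.
Proof.
move=> /(pos_roots_dot (base_chamber Phi l_gt0)) h.
by move=> /(pos_roots_dot (base_chamber Phi l_gt0)); rewrite dotNr; lra.
Qed.

(** Every hyperplane that meets the closed fundamental alcove in a point on no
    other hyperplane is one of the expected walls: otherwise this point would
    lie in the open alcove. Conversely [wall_point] provides the points that the
    definition of a wall asks for. *)
Lemma simple_reflP s : simple_refl Phi l s <-> exists2 f, wall f & s = rf f.
Proof.
split=> [[a [m [[pa [x /closure_Aplus xa xE]] ->]]]|[f wf ->]] {s}.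
  have xam := (xE a m pa).2 (conj erefl erefl).
  have [f [wf fx]] : exists f, wall f /\ f x = 0.
    apply/not_existsP => H.
    have xA : Aplus Phi l x.
      apply/wall_AplusP => f wf.
      rewrite lt_neqAle ((closed_alcoveP Phi l_gt0 x).1 xa) // andbT eq_sym.
      by apply/eqP => fx; apply: (H f).
    have := Aplus_neq0 l_gt0 (aff_root_ev l m (pos_root_root pa)) xA.
    by rewrite /ev xam subrr eqxx.
  exists f => //.
  have [b [k [pb [fE fx']]]] : exists b k, [/\ b \in pos_roots Phi,
      rf f = aff_refl b (lmul l k) & hyperplane b (lmul l k) x].
    case: wf fx => [[i ->]|->] fx.
      exists (simple Phi i), 0; split; last by apply/eqP; rewrite -subr_eq0; apply/eqP.
        by apply/pos_rootsP; split; [exact: simple_root|exact: simple_nneg].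
      by rewrite rf_ev.
    exists (theta Phi), 1; split.
    - by apply/pos_rootsP; split; [exact: theta_root|exact: theta_nneg].
    - have -> : ev l (- theta Phi) (-1) = (fun y => - ev l (theta Phi) 1 y).
        by apply/funext => y; rewrite evN.
      by rewrite (rfN (aff_root_ev _ _ (theta_root Phi))) rf_ev.
    - move: fx; rewrite evN => /eqP; rewrite oppr_eq0 subr_eq0 => /eqP; exact.
  by rewrite fE; have [-> ->] := (xE _ _ pb).1 fx'.
have [x [xa fx fu]] := wall_point l_gt0 wf.
have [a [m [pa fE [s sE]]]] : exists a m, [/\ a \in pos_roots Phi,
    rf f = aff_refl a (lmul l m) & exists s : bool, f = fun y => (-1) ^+ s * ev l a m y].
  case: wf => [[i ->]|->].
    exists (simple Phi i), 0; split.
    - by apply/pos_rootsP; split; [exact: simple_root|exact: simple_nneg].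
    - by rewrite rf_ev.
    - by exists false; apply/funext => y; rewrite mul1r.
  exists (theta Phi), 1; have e : ev l (- theta Phi) (-1) = (fun y => - ev l (theta Phi) 1 y).
    by apply/funext => y; rewrite evN.
  split.
  - by apply/pos_rootsP; split; [exact: theta_root|exact: theta_nneg].
  - by rewrite e (rfN (aff_root_ev _ _ (theta_root Phi))) rf_ev.
  - by exists true; rewrite e; apply/funext => y; rewrite expr1 mulN1r.
have evx : ev l a m x = 0.
  by move: fx; rewrite sE => /eqP; rewrite mulf_eq0 signr_eq0 => /eqP.
exists a, m; split=> //; split=> //; exists x; first exact/closure_Aplus.
move=> b k pb; split=> [bx|[-> ->]]; last first.
  by apply/eqP; rewrite -subr_eq0; apply/eqP.
have bkx : ev l b k x = 0 by rewrite /ev bx subrr.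
have bf := aff_root_ev l k (pos_root_root pb).
have af := aff_root_ev l m (pos_root_root pa).
have f0 := wall_gt0 l_gt0 wf.
(* Since [x] is on no other hyperplane, both functions are [f] up to sign. *)
have pm (h : V -> R) : aff_root h -> h x = 0 -> h = f \/ (fun y => - h y) = f.
  move=> hf hx; case: (ltgtP 0 (h a0)) => h0.
  - by left; exact: fu.
  - by right; apply: fu; [exact: aff_rootN|rewrite oppr_gt0|rewrite hx oppr0].
  - by have := Aplus_neq0 l_gt0 hf (base_Aplus Phi l_gt0); rewrite -h0 eqxx.
have nev c j : (fun y => - ev l c j y) = ev l (- c) (- j) :> (V -> R).
  by apply/funext => y; rewrite evN.
have [h1|h1] := pm _ bf bkx; have [h2|h2] := pm _ af evx.
- by have := h1; rewrite -h2 => /(ev_inj l_gt0).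
- by move: h1; rewrite -h2 nev => /(ev_inj l_gt0)[h _]; case: (pos_rootN pa); rewrite -h.
- by move: h1; rewrite -h2 nev => /(ev_inj l_gt0)[h _]; case: (pos_rootN pb); rewrite h.
- by move: h1; rewrite -h2 !nev => /(ev_inj l_gt0)[/oppr_inj -> /oppr_inj ->].
Qed.

Lemma Waff_Wr : Waff Phi l `<=` Wr Phi l.
Proof.
apply: gen_sub => w [|->].
  apply: gen_sub => g [a ra ->]; apply: gen1; exists a, 0.
  by rewrite lmul0.
by apply: gen1; exists (theta Phi), 1; rewrite lmul1; split=> //; exact: theta_root.
Qed.

Lemma simple_Waff : generated (simple_refl Phi l) `<=` Waff Phi l.
Proof.
apply: gen_sub => s /simple_reflP[f [[i ->]|->] ->]; apply: gen1.
  left; apply: gen1; exists (simple Phi i); first exact: simple_root.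
  by rewrite rf_ev lmul0.
right; have -> : ev l (- theta Phi) (-1) = (fun y => - ev l (theta Phi) 1 y).
  by apply/funext => y; rewrite evN.
by rewrite (rfN (aff_root_ev _ _ (theta_root Phi))) rf_ev lmul1.
Qed.

Lemma aff_root_pos f : aff_root f -> 0 < f a0 \/ 0 < - f a0.
Proof.
move=> ff; have := Aplus_neq0 l_gt0 ff (base_Aplus Phi l_gt0).
by rewrite neq_lt oppr_gt0 => /orP[]; [right|left].
Qed.

(** Some element of the group generated by the walls moves a generic point of a
    given hyperplane into the closed fundamental alcove, where this point can
    only lie on a wall; hence the reflection is conjugate to the reflection in
    that wall. *)
Lemma Wr_simple : Wr Phi l `<=` generated (simple_refl Phi l).
Proof.
apply: gen_sub => _ [a [m [ra ->]]]; rewrite -rf_ev.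
have ff := aff_root_ev l m ra; move: (ev l a m) ff => f ff {a m ra}.
have [x fx xu] := generic_point l_gt0 ff.
have [w Sw wx] := reach Phi l_gt0 x.
have SE : [set s | exists2 g, wall g & s = rf g] = simple_refl Phi l.
  by apply/seteqP; split=> s /simple_reflP.
rewrite {}SE in Sw.
have Ww : Wr Phi l w by apply/Waff_Wr/simple_Waff.
have SK (g : V -> V) : simple_refl Phi l g -> involutive g.
  by move=> /simple_reflP[h wh ->]; exact: (rfK (wall_fun wh)).
have [w' [Sw' ww' w'w]] := gen_inv SK Sw.
have [g [wg gx]] : exists g, wall g /\ g (w x) = 0.
  apply/not_existsP => H.
  have xA : Aplus Phi l (w x).
    apply/wall_AplusP => g wg.
    rewrite lt_neqAle ((closed_alcoveP Phi l_gt0 _).1 wx) // andbT eq_sym.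
    by apply/eqP => gx; apply: (H g).
  have fw' := aff_root_comp ff (Waff_Wr (simple_Waff Sw')).
  have := Aplus_neq0 l_gt0 fw' xA; rewrite /=.
  by have /= -> := congr1 (@^~ x) w'w; rewrite fx eqxx.
have gf := wall_fun wg.
have rE : rf (g \o w) = rf f.
  by have [->|->] := xu _ (aff_root_comp gf Ww) gx => //; exact: (rfN ff).
have := rf_comp gf Ww; rewrite rE => e.
have -> : rf f = w' \o rf g \o w.
  apply/funext => y /=; have /= -> := congr1 (@^~ y) e.
  by have /= -> := congr1 (@^~ (rf f y)) w'w.
by do 2?apply: gen_comp => //; apply: gen1; apply/simple_reflP; exists g.
Qed.

End Topology.

Section Coxeter.
Context {R : realType} {n : nat} (Phi : rootSystem R n) (l : nat).
Context (l_gt0 : (0 < l)%N).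
Local Notation V := 'rV[R]_n.
Local Notation aff_root := (aff_root Phi l).
Local Notation wall := (wall Phi l).
Local Notation spec := (spec Phi l).
Local Notation a0 := (base Phi l).
Local Notation W := (Waff Phi l).
Local Notation S := (simple_refl Phi l).
Local Notation len := (cox_length Phi l).
Implicit Types (x y z w : V -> V) (p q : V) (f g h : V -> R) (j k : nat).

Lemma simple_rf f : wall f -> S (rf f).
Proof. by move=> wf; apply/(simple_reflP Phi l_gt0); exists f. Qed.

Lemma Waff_gen w : W w -> generated S w.
Proof. by move=> /Waff_Wr/(Wr_simple l_gt0). Qed.

Lemma Waff_id : W id.
Proof. exact: gen_id. Qed.

Lemma Waff_comp w w' : W w -> W w' -> W (w \o w').
Proof. exact: gen_comp. Qed.

Lemma Waff_rf f : aff_root f -> W (rf f).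
Proof.
move=> [a [m [ra ->]]]; rewrite rf_ev; apply: (simple_Waff l_gt0).
by apply: (Wr_simple l_gt0); apply: gen1; exists a, m.
Qed.

Lemma Waff_inv w : W w -> exists w', [/\ W w', w \o w' = id & w' \o w = id].
Proof.
move=> /Waff_gen Sw.
have SK (g : V -> V) : S g -> involutive g.
  by move=> /(simple_reflP Phi l_gt0)[h wh ->]; exact: (rfK (wall_fun wh)).
have [w' [Sw' e1 e2]] := gen_inv SK Sw.
by exists w'; split=> //; exact: (simple_Waff l_gt0).
Qed.

Lemma Waff_inj w : W w -> injective w.
Proof. move=> /Waff_inv[w' [_ _ e]] p q /(congr1 w').
by have /= -> := congr1 (@^~ p) e; have /= -> := congr1 (@^~ q) e. Qed.

Lemma aff_root_W f w : aff_root f -> W w -> aff_root (f \o w).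
Proof. by move=> ff /Waff_Wr; exact: aff_root_comp. Qed.

Lemma rf_W f w : aff_root f -> W w -> rf f \o w = w \o rf (f \o w).
Proof. by move=> ff /Waff_Wr; exact: rf_comp. Qed.

Lemma spec_W w p q : W w -> spec p q -> spec (w p) (w q).
Proof. by move=> /Waff_Wr; exact: spec_act. Qed.

Lemma rf_comp_id f : aff_root f -> rf f \o rf f = id.
Proof. by move=> ff; apply/funext => p /=; rewrite (rfK ff). Qed.

Lemma Wbase_neq0 f w : aff_root f -> W w -> f (w a0) != 0.
Proof.
by move=> ff Ww; exact: (Aplus_neq0 l_gt0 (aff_root_W ff Ww) (base_Aplus Phi l_gt0)).
Qed.

Lemma lenP w : W w -> word S (len w) w /\ forall j, word S j w -> (len w <= j)%N.
Proof.
move=> /Waff_gen Sw.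
have ex : exists k, `[< word S k w >] by case: Sw => k wk; exists k; exact/asboolP.
have [k wk kmin] := ex_minnP ex.
have : exists k, word S k w /\ forall j, word S j w -> (k <= j)%N.
  by exists k; split; [exact/asboolP|move=> j wj; apply: kmin; exact/asboolP].
by move=> /(xgetPex 0%N).
Qed.

Lemma len_min w k : word S k w -> (len w <= k)%N.
Proof.
move=> wk; have Ww : W w by apply: (simple_Waff l_gt0); exists k.
exact: (lenP Ww).2.
Qed.

(** A wall of the fundamental alcove is the only hyperplane that separates the
    alcove from its mirror image. *)
Lemma wall_sep f g : wall f -> aff_root g -> 0 < g a0 -> g (rf f a0) < 0 -> g = f.
Proof.
move=> wf gf g0 gr; have ff := wall_fun wf.
have [p [pa fp pu]] := wall_point l_gt0 wf.
apply: pu => //; apply/eqP; rewrite eq_le (spec_ge0 pa gf (ltW g0)) andbT.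
have gf' := aff_rootN (aff_root_W gf (Waff_rf ff)).
by have := spec_ge0 pa gf'; rewrite /= (rf_fix fp) !oppr_ge0; apply; exact: ltW.
Qed.

Lemma lt0_Wbase f w : aff_root f -> W w -> ~ (0 < f (w a0)) -> f (w a0) < 0.
Proof.
by move=> ff Ww /negP; rewrite -leNgt lt_neqAle => ->; rewrite andbT; exact: (Wbase_neq0 ff Ww).
Qed.

(** The exchange condition: along a gallery from the fundamental alcove to [w
    A_+] the hyperplane of [f] is crossed at some step, and reflecting the rest
    of the gallery there makes this step superfluous. *)
Lemma exchange k w f : word S k w -> aff_root f -> 0 < f a0 -> f (w a0) < 0 ->
  exists2 j, (j < k)%N & word S j (rf f \o w).
Proof.
move=> wk; elim: wk f => [f _ f0|{}k _ {}w /(simple_reflP Phi l_gt0)[g wg ->] wk IH f ff f0 /= fw].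
  by move=> /(lt_trans f0); rewrite ltxx.
have gf := wall_fun wg; have Wg := Waff_rf gf.
have [fg|] := pselect (0 < f (rf g a0)); last first.
  move=> /(lt0_Wbase ff Wg) /(wall_sep wg ff f0) ->.
  exists k => //.
  have -> : rf g \o (rf g \o w) = w by apply/funext => p /=; rewrite (rfK gf).
  exact: wk.
have [j jk wj] := IH _ (aff_root_W ff Wg) fg fw.
exists j.+1 => //.
have -> : rf f \o (rf g \o w) = rf g \o (rf (f \o rf g) \o w).
  by have := rf_W ff Wg => e; apply/funext => p; exact: (congr1 (@^~ (w p)) e).
exact: word_cons (simple_rf wg) wj.
Qed.

Lemma len_refl_lt w f : W w -> aff_root f -> 0 < f a0 -> f (w a0) < 0 ->
  (len (rf f \o w) < len w)%N.
Proof.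
move=> Ww ff f0 fw; have [j jk wj] := exchange (lenP Ww).1 ff f0 fw.
exact: leq_ltn_trans (len_min wj) jk.
Qed.

Lemma len_refl_gt w f : W w -> aff_root f -> 0 < f a0 -> 0 < f (w a0) ->
  (len w < len (rf f \o w))%N.
Proof.
move=> Ww ff f0 fw; have Wr := Waff_comp (Waff_rf ff) Ww.
have := len_refl_lt Wr ff f0; rewrite /= (rf_anti _ ff) oppr_lt0 => /(_ fw).
suff -> : rf f \o (rf f \o w) = w by [].
by apply/funext => p /=; rewrite (rfK ff).
Qed.

Lemma descent w : W w -> w <> id -> exists2 f, wall f & f (w a0) < 0.
Proof.
move=> Ww wid; have [/word_case[[_ //]|[j [s [u [E Ss wu wE]]]]] _] := lenP Ww.
have [f wf sE] := (simple_reflP Phi l_gt0 _).1 Ss; exists f => //.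
have ff := wall_fun wf.
apply: (lt0_Wbase ff Ww) => fw.
have := len_refl_gt Ww ff (wall_gt0 l_gt0 wf) fw; rewrite E.
have -> : rf f \o w = u by apply/funext => p; rewrite wE sE /= (rfK ff).
by move=> /leq_trans/(_ (len_min wu)); rewrite ltnNge leqnSn.
Qed.

(** The reflections in the walls through [p]; for [p] in the closed fundamental
    alcove they generate its stabilizer (see [fundamental]). *)
Definition stab_refl p : set (V -> V) :=
  [set s | exists f, [/\ wall f, f p = 0 & s = rf f]].

Lemma stab_gen p w : generated (stab_refl p) w -> W w /\ w p = p.
Proof.
move=> [k]; elim=> [|j _ {}w [f [wf fp ->]] _ [Ww wp]]; first by split=> //; exact: Waff_id.
split; first exact/Waff_comp/Ww/Waff_rf/wall_fun.
by rewrite /= wp rf_fix.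
Qed.

(** A descent of [w] separates the base point from its image, so that it
    vanishes at [w p], which lies in the closures of both alcoves; the
    corresponding reflection fixes [w p] and can be removed from [w]. *)
Lemma fundamental p w : W w -> spec p a0 -> spec (w p) a0 ->
  w p = p /\ generated (stab_refl p) w.
Proof.
move=> + pa; have [k] := ubnP (len w); elim: k w => // k IH w lk Ww wpa.
have [->|wid] := pselect (w = id); first by split=> //; exact: gen_id.
have [f wf fw] := descent Ww wid; have ff := wall_fun wf.
have f0 := wall_gt0 l_gt0 wf.
have fwp : f (w p) = 0.
  apply/eqP; rewrite eq_le (spec_ge0 wpa ff (ltW f0)) andbT -oppr_ge0.
  apply: (spec_ge0 pa (aff_rootN (aff_root_W ff Ww))); by rewrite oppr_ge0 ltW.
have lt := len_refl_lt Ww ff f0 fw.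
have [||] := IH (rf f \o w) (leq_trans lt lk); first exact/Waff_comp/Ww/Waff_rf.
  by rewrite /= rf_fix.
rewrite /= rf_fix // => wp gw; split=> //.
have -> : w = rf f \o (rf f \o w) by apply/funext => q /=; rewrite (rfK ff).
by apply: gen_comp => //; apply: gen1; exists f; split=> //; rewrite -{1}wp.
Qed.

(** The affine Weyl group acts freely on the alcoves. *)
Lemma regular_inj x y : W x -> W y -> spec (x a0) (y a0) -> x = y.
Proof.
move=> Wx Wy xy; have [y' [Wy' yy' y'y]] := Waff_inv Wy.
have := spec_W Wy' xy; have /= -> := congr1 (@^~ a0) y'y => h.
have [_ [k wk]] := fundamental (Waff_comp Wy' Wx) (spec_refl (Phi := Phi) (l := l) (x := a0)) h.
have e : y' \o x = id.
  have [[]//|[j [s [u [_ [f [wf f0 _]]]]]]] := word_case wk.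
  by have := wall_gt0 l_gt0 wf; rewrite f0 ltxx.
apply/funext => p; have /= := congr1 (@^~ (x p)) yy'.
by have /= -> := congr1 (@^~ p) e.
Qed.

(** * Right multiplication by a simple reflection *)

(** Right multiplication by the reflection in [f] is left multiplication by the
    reflection in the image of [f]. *)
Lemma rf_right x f : W x -> aff_root f ->
  exists g, [/\ aff_root g, g \o x = f & x \o rf f = rf g \o x].
Proof.
move=> Wx ff; have [x' [Wx' xx' x'x]] := Waff_inv Wx.
have gf : aff_root (f \o x') by exact: aff_root_W.
have e : f \o x' \o x = f by apply/funext => p /=; have /= -> := congr1 (@^~ p) x'x.
by exists (f \o x'); split=> //; rewrite (rf_W gf Wx) e.
Qed.

Lemma len_right_cases x f : W x -> wall f ->
  (len (x \o rf f) < len x \/ len x < len (x \o rf f))%N.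
Proof.
move=> Wx wf; have ff := wall_fun wf; have [g [gf gx e]] := rf_right Wx ff.
have f0 := wall_gt0 l_gt0 wf; rewrite -gx /= in f0; rewrite e.
have [g0|g0] := aff_root_pos l_gt0 gf; first by right; exact: len_refl_gt.
left; rewrite -(rfN gf); apply: len_refl_lt => //; first exact: aff_rootN.
by rewrite oppr_lt0.
Qed.

Lemma len_comp x y : W x -> W y -> (len (x \o y) <= len x + len y)%N.
Proof. by move=> /lenP[xw _] /lenP[yw _]; exact/len_min/word_cat. Qed.

Lemma len_wall f : wall f -> len (rf f) = 1%N.
Proof.
move=> wf; have ff := wall_fun wf; apply/eqP; rewrite eqn_leq.
rewrite (len_min (word1 (simple_rf wf))) lt0n; apply/negP => /eqP l0.
have [/word_case[[_ e]|[j [s [u [e _ _ _]]]]] _] := lenP (Waff_rf ff).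
  have := rf_anti a0 ff; rewrite e; have := wall_gt0 l_gt0 wf; lra.
by rewrite l0 in e.
Qed.

Lemma compA_rf x f : aff_root f -> x \o rf f \o rf f = x.
Proof. by move=> ff; apply/funext => p /=; rewrite (rfK ff). Qed.

Lemma Waff_rfr x f : W x -> aff_root f -> W (x \o rf f).
Proof. by move=> Wx ff; exact/Waff_comp/Waff_rf. Qed.

Lemma len_up x f : W x -> wall f -> (len x < len (x \o rf f))%N ->
  len (x \o rf f) = (len x).+1.
Proof.
move=> Wx wf lt; apply/eqP; rewrite eqn_leq lt andbT.
by have := len_comp Wx (Waff_rf (wall_fun wf)); rewrite (len_wall wf) addn1.
Qed.

Lemma len_down x f : W x -> wall f -> (len (x \o rf f) < len x)%N ->
  len x = (len (x \o rf f)).+1.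
Proof.
move=> Wx wf lt; have ff := wall_fun wf; rewrite -{1}[x](compA_rf x ff).
by apply: len_up => //; [exact: Waff_rfr|rewrite compA_rf].
Qed.

(** * Bruhat order *)

Local Notation "x <=b y" := (bruhat_le Phi l x y) (at level 70).

Lemma cox_reflectionP t : cox_reflection Phi l t ->
  exists f, [/\ aff_root f, 0 < f a0 & t = rf f].
Proof.
move=> [w [w' [s [Ww Ww' e /(simple_reflP Phi l_gt0)[h wh ->] ->]]]].
have hf := wall_fun wh; have gf := aff_root_W hf Ww'.
have e' : w' \o w = id.
  apply/funext => p; apply: (Waff_inj Ww) => /=.
  by have := congr1 (@^~ (w p)) e.
have tE : w \o rf h \o w' = rf (h \o w').
  have := rf_W gf Ww.
  have -> : h \o w' \o w = h by apply/funext => p /=; have /= -> := congr1 (@^~ p) e'.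
  move=> E; apply/funext => p; have /= <- := congr1 (@^~ (w' p)) E.
  by have /= -> := congr1 (@^~ p) e.
rewrite tE; have [g0|g0] := aff_root_pos l_gt0 gf; first by exists (h \o w').
by exists (fun q => - (h \o w') q); split=> //; [exact: aff_rootN|rewrite (rfN gf)].
Qed.

Lemma Waff_cox t : cox_reflection Phi l t -> W t.
Proof. by move=> /cox_reflectionP[f [ff _ ->]]; exact: Waff_rf. Qed.

Lemma cox_right x f : W x -> wall f ->
  exists2 t, cox_reflection Phi l t & t \o x = x \o rf f.
Proof.
move=> Wx wf; have [x' [Wx' xx' x'x]] := Waff_inv Wx.
exists (x \o rf f \o x').
  by exists x, x', (rf f); split=> //; exact: simple_rf.
by apply/funext => p /=; have /= -> := congr1 (@^~ p) x'x.
Qed.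

Lemma bruhat_W x y : W x -> x <=b y -> W y.
Proof.
by move=> Wx; elim=> [//|y' t _ Wy /Waff_cox Wt _]; exact: Waff_comp.
Qed.

Lemma bruhat_trans y x z : x <=b y -> y <=b z -> x <=b z.
Proof. by move=> xy; elim=> [//|z' t _ xz ct lt]; exact: bruhat_step. Qed.

Lemma bruhat_len x y : x <=b y -> x = y \/ (len x < len y)%N.
Proof.
elim=> [|y' t _ [->|lt1] _ lt2]; [by left|by right|right].
exact: ltn_trans lt2.
Qed.

Lemma bruhat_len_le x y : x <=b y -> (len x <= len y)%N.
Proof. by move=> /bruhat_len[-> //|/ltnW]. Qed.

Lemma bruhat_up x f : W x -> wall f -> (len x < len (x \o rf f))%N ->
  x <=b (x \o rf f).
Proof.
move=> Wx wf; have [t ct <-] := cox_right Wx wf.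
by apply: bruhat_step => //; exact: bruhat_refl.
Qed.

Lemma bruhat_down x f : W x -> wall f -> (len (x \o rf f) < len x)%N ->
  (x \o rf f) <=b x.
Proof.
move=> Wx wf lt; have ff := wall_fun wf; rewrite -{2}[x](compA_rf x ff).
by apply: bruhat_up => //; [exact: Waff_rfr|rewrite compA_rf].
Qed.

(** The lifting property. For a step from [z] up to [t z], either [t] still
    moves [z s] up, or the hyperplane of [t] separates the alcoves of [z] and [z
    s], and then [t z = z s]. *)
Lemma bruhat_lift x y f : W x -> wall f -> x <=b y ->
  (x \o rf f) <=b y \/ (x \o rf f) <=b (y \o rf f).
Proof.
move=> Wx wf; have ff := wall_fun wf.
elim=> [|z t xz [IH|IH] ct lt]; first by right; exact: bruhat_refl.
  by left; exact: bruhat_step lt.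
have Wz := bruhat_W Wx xz.
have [g [gf g0 tE]] := cox_reflectionP ct.
have gz : 0 < g (z a0).
  have [//|/(lt0_Wbase gf Wz) gz] := pselect (0 < g (z a0)).
  by have := len_refl_lt Wz gf g0 gz; rewrite -tE ltnNge ltnW.
have Wzs := Waff_rfr Wz ff.
have [gzs|/(lt0_Wbase gf Wzs) gzs] := pselect (0 < g ((z \o rf f) a0)).
  by right; apply: (bruhat_step IH ct); rewrite tE; exact: len_refl_gt.
left; have gE := wall_sep wf (aff_root_W gf Wz) gz gzs.
by have := rf_W gf Wz; rewrite gE -tE => ->.
Qed.

Lemma bruhat_lift_down x y f : W x -> W y -> wall f -> x <=b y ->
  (len (y \o rf f) < len y)%N -> (x \o rf f) <=b y.
Proof.
move=> Wx Wy wf xy lt; have [//|h] := bruhat_lift Wx wf xy.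
exact/(bruhat_trans h)/bruhat_down.
Qed.

(** * Minimal coset representatives are the alcoves in the dominant chamber *)

Lemma chamberP p : chamber Phi p <-> forall i, 0 < ev l (simple Phi i) 0 p.
Proof. by split=> pC i; have := pC i; rewrite /ev lmul0 subr0. Qed.

Lemma simple_wall i : wall (ev l (simple Phi i) 0).
Proof. by left; exists i. Qed.

Lemma chamber_spec p q : spec p q -> chamber Phi p -> chamber Phi q.
Proof.
move=> pq /chamberP pC; apply/chamberP => i; apply: pq => //.
exact/wall_fun/simple_wall.
Qed.

Lemma Wfin_simple i : Wfin Phi (rf (ev l (simple Phi i) 0)).
Proof.
by apply: gen1; exists (simple Phi i); [exact: simple_root|rewrite rf_ev lmul0].
Qed.

Lemma Wfin_Waff w : Wfin Phi w -> W w.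
Proof. by move=> Fw; apply: gen1; left. Qed.

Lemma Wfin0 w : Wfin Phi w -> w 0 = 0.
Proof.
move=> [k]; elim=> [//|j _ {}w [a ra ->] _ /= ->].
by rewrite /aff_refl dot0l subr0 !mul0r scale0r subr0.
Qed.

(** The finite Weyl group acts freely on the chambers: a descent of [w] is an
    affine root that vanishes at the origin, hence a simple root, whose signs at
    the two points of the chamber disagree. *)
Lemma Wfin_chamber w p : Wfin Phi w -> chamber Phi p -> chamber Phi (w p) -> w = id.
Proof.
move=> Fw pC wpC; have Ww := Wfin_Waff Fw.
have [//|wid] := pselect (w = id).
have [f wf fw] := descent Ww wid; have ff := wall_fun wf.
(* The origin is fixed by [w] and lies in the closed alcove, so that [f]
   vanishes there. *)
have oa : spec 0 a0.
  apply/(closed_alcoveP Phi l_gt0) => g [[i ->]|->]; rewrite /ev dot0l ?lmul0 ?subr0 //.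
  by rewrite lmulN lmul1 opprK add0r ler0n.
have f0 : f 0 = 0.
  apply/eqP; rewrite eq_le (spec_ge0 oa ff (ltW (wall_gt0 l_gt0 wf))) andbT -oppr_ge0.
  have := spec_ge0 oa (aff_rootN (aff_root_W ff Ww)); rewrite /= (Wfin0 Fw); apply.
  by rewrite oppr_ge0 ltW.
have [i fE] : exists i, f = ev l (simple Phi i) 0.
  case: wf f0 => [//|->]; rewrite /ev dot0l lmulN lmul1 opprK add0r => /eqP.
  by rewrite pnatr_eq0; case: (l) l_gt0.
have fwp : 0 < f (w p) by rewrite fE; exact: (chamberP _).1.
have [b [m [rb bE]]] := aff_root_W ff Ww.
have m0 : m = 0.
  have := congr1 (@^~ 0) bE; rewrite /= (Wfin0 Fw) f0 /ev dot0l sub0r.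
  by move=> /esym/eqP; rewrite oppr_eq0 -(lmul0 l) => /eqP/(lmul_inj l_gt0).
have := congr1 (@^~ p) bE; have := congr1 (@^~ a0) bE.
rewrite /= m0 /ev lmul0 !subr0 => ba bp; rewrite ba in fw; rewrite bp in fwp.
exfalso; case: (root_pos rb) => pb.
  by have := pos_roots_dot (base_chamber Phi l_gt0) pb; lra.
by have := pos_roots_dot pC pb; rewrite dotNr; lra.
Qed.

Lemma not_chamber x : W x -> ~ chamber Phi (x a0) ->
  exists i, ev l (simple Phi i) 0 (x a0) < 0.
Proof.
move=> Wx /chamberP/existsNP[i h]; exists i.
exact: (lt0_Wbase (wall_fun (simple_wall i)) Wx h).
Qed.

(** The minimal representatives of the cosets [W x] are the alcoves in the
    dominant chamber: outside the chamber, the reflection in a simple root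
    shortens the element. *)
Lemma WfP x : Wf Phi l x <-> W x /\ chamber Phi (x a0).
Proof.
split=> [[Wx xmin]|[Wx xC]]; split=> //.
  apply: contrapT => /(not_chamber Wx)[i h]; have wf := simple_wall i.
  have := len_refl_lt Wx (wall_fun wf) (wall_gt0 l_gt0 wf) h.
  by rewrite ltnNge xmin //; exact: Wfin_simple.
move=> w; have [k] := ubnP (len (w \o x)); elim: k w => // k IH w lk Fw.
have Wwx := Waff_comp (Wfin_Waff Fw) Wx.
have [wxC|/(not_chamber Wwx)[i h]] := pselect (chamber Phi ((w \o x) a0)).
  by rewrite (Wfin_chamber Fw xC wxC).
have wf := simple_wall i.
have lt := len_refl_lt Wwx (wall_fun wf) (wall_gt0 l_gt0 wf) h.
apply: leq_trans (ltnW lt); apply: (IH (rf _ \o w)).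
  exact: leq_trans lt lk.
by apply: gen_comp => //; exact: Wfin_simple.
Qed.

Lemma Wf_id : Wf Phi l id.
Proof. by apply/WfP; split; [exact: Waff_id|exact: base_chamber]. Qed.

Lemma Wf_W x : Wf Phi l x -> W x.
Proof. by move=> []. Qed.

(** If right multiplication by [s] leads out of the dominant chamber, the
    hyperplane crossed is that of a simple root, so the effect is that of a left
    multiplication by a reflection of the finite Weyl group. *)
Lemma Wf_out x f : Wf Phi l x -> wall f -> ~ Wf Phi l (x \o rf f) ->
  exists i, x \o rf f = rf (ev l (simple Phi i) 0) \o x /\
    (len x < len (x \o rf f))%N.
Proof.
move=> /WfP[Wx xC] wf nx; have ff := wall_fun wf; have Wxs := Waff_rfr Wx ff.
have [|i h] := @not_chamber (x \o rf f) Wxs; first by move=> h; apply/nx/WfP.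
have gf := wall_fun (simple_wall i).
have gx : 0 < ev l (simple Phi i) 0 (x a0) by exact: (chamberP _).1.
have gE := wall_sep wf (aff_root_W gf Wx) gx h.
exists i; have e := rf_W gf Wx; rewrite gE in e; rewrite -e; split=> //.
by apply: len_refl_gt => //; exact/wall_gt0/simple_wall.
Qed.

Lemma Wf_down x f : Wf Phi l x -> wall f -> (len (x \o rf f) < len x)%N ->
  Wf Phi l (x \o rf f).
Proof.
move=> fx wf lt; apply: contrapT => /(Wf_out fx wf)[i [_]].
by rewrite ltnNge ltnW.
Qed.

End Coxeter.

(** * The highest alcove at a point *)

Section Counting.
Context {T : eqType}.
Implicit Types (s : seq T) (P Q : pred T).

Lemma count_add P Q1 Q2 s :
  (forall a, a \in s -> (P a : nat) = (Q1 a + Q2 a)%N) ->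
  count P s = (count Q1 s + count Q2 s)%N.
Proof.
elim: s => //= b s IH H; rewrite H ?mem_head // IH; first by lia.
by move=> a sa; apply: H; rewrite inE sa orbT.
Qed.

Lemma count_diff1 P Q s b : uniq s -> b \in s -> P b -> ~~ Q b ->
  (forall a, a \in s -> a != b -> P a = Q a) -> count P s = (count Q s).+1.
Proof.
move=> us sb Pb Qb PQ; rewrite (@count_add _ Q (pred1 b)) ?count_uniq_mem ?sb ?addn1 //.
move=> a sa /=; have [->|ab] := eqVneq a b; first by rewrite Pb (negbTE Qb).
by rewrite PQ // addn0.
Qed.

End Counting.

Section Points.
Context {R : realType} {n : nat} (Phi : rootSystem R n) (l : nat).
Context (l_gt0 : (0 < l)%N).
Local Notation V := 'rV[R]_n.
Local Notation aff_root := (aff_root Phi l).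
Local Notation wall := (wall Phi l).
Local Notation spec := (spec Phi l).
Local Notation a0 := (base Phi l).
Local Notation W := (Waff Phi l).
Local Notation S := (simple_refl Phi l).
Local Notation len := (cox_length Phi l).
Local Notation stab p := (generated (stab_refl Phi l p)).
Implicit Types (x y z w g : V -> V) (p q : V) (f h : V -> R) (j : nat) (m k : int).

Lemma pos_fun (P : (V -> R) -> Prop) :
  (forall a m, a \in pos_roots Phi -> P (ev l a m)) ->
  (forall a m, a \in pos_roots Phi -> P (fun q => - ev l a m q)) ->
  forall f, aff_root f -> P f.
Proof.
move=> P1 P2 f [a [m [ra ->]]]; case: (root_pos ra) => pa; first exact: P1.
have -> : ev l a m = (fun q => - ev l (- a) (- m) q).
  by apply/funext => q; rewrite evN opprK.
exact: P2.
Qed.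

(** By [reach] the point moves into the closed fundamental alcove; being on no
    hyperplane, it lands in the open one. *)
Lemma regular_alcove p : (forall f, aff_root f -> f p != 0) ->
  exists y, [/\ W y, spec p (y a0) & spec (y a0) p].
Proof.
move=> pr; have [w Sw wp] := reach Phi l_gt0 p.
have Ww : W w.
  apply: (simple_Waff l_gt0); apply: gen_sub Sw => s [f wf ->].
  exact/gen1/simple_rf.
have [y [Wy wy yw]] := Waff_inv l_gt0 Ww.
have py : spec p (y a0).
  by have := spec_W Wy wp; have /= -> := congr1 (@^~ p) yw.
exists y; split=> // f ff fy; rewrite lt_neqAle eq_sym pr //=.
rewrite leNgt; apply/negP => fp.
have := py _ (aff_rootN ff); rewrite !oppr_gt0 => /(_ fp); lra.
Qed.

(** For small [t] the point [p + t d] is on no hyperplane, and it keeps the side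
    of [p] for the hyperplanes that avoid [p]. *)
Lemma perturb p d : (forall f, aff_root f -> f p = 0 -> f (p + d) != 0) ->
  exists y, [/\ W y, spec p (y a0) &
    forall f, aff_root f -> f p = 0 -> 0 < f (p + d) -> 0 < f (y a0)].
Proof.
move=> pd; have [e e0 eP] := ray Phi l_gt0 p d.
have te : 0 < e / 2 < e by lra.
have line f : aff_root f -> f (p + (e / 2) *: d) = f p + e / 2 * (f (p + d) - f p).
  by move=> ff; rewrite -(aff_root_line _ _ _ ff) addrAC subrr add0r.
have [|y [Wy py yp]] := @regular_alcove (p + (e / 2) *: d).
  move=> f ff; case: (ltgtP 0 (f p)) => fp.
  - by rewrite gt_eqF // eP.
  - rewrite -oppr_eq0 gt_eqF //; apply: (eP _ te _ (aff_rootN ff)).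
    by rewrite oppr_gt0.
  - by rewrite line // -fp add0r subr0 mulf_neq0 ?pd ?gt_eqF //; lra.
exists y; split=> //.
  by apply: spec_trans py => f ff; exact: eP.
move=> f ff fp fd; apply: py => //; rewrite line // fp add0r subr0.
by rewrite mulr_gt0 //; lra.
Qed.

(** The alcove [y A_+] is [A_+(F)] for the facet [F] of [p] (see
    [alcove_plusE]). *)
Definition is_top p y := [/\ W y, spec p (y a0) &
  forall a m, a \in pos_roots Phi -> ev l a m p = 0 -> 0 < ev l a m (y a0)].

(** Perturb [p] in a dominant direction. *)
Lemma top_exists p : exists y, is_top p y.
Proof.
have evp a m : ev l a m p = 0 -> ev l a m (p + a0) = dot a0 a.
  by rewrite /ev dotDl; lra.
have [|y [Wy py yP]] := @perturb p a0.
  apply: pos_fun => a m pa.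
    move=> /evp ->; rewrite gt_eqF //; exact: pos_roots_dot (base_chamber _ l_gt0) pa.
  move=> /eqP; rewrite oppr_eq0 => /eqP/evp ->; rewrite oppr_eq0 gt_eqF //.
  exact: pos_roots_dot (base_chamber _ l_gt0) pa.
exists y; split=> // a m pa ap; apply: yP => //; first exact/aff_root_ev/pos_root_root.
by rewrite evp //; exact: pos_roots_dot (base_chamber _ l_gt0) pa.
Qed.

Lemma is_top_uniq p y z : is_top p y -> is_top p z -> y = z.
Proof.
move=> [Wy py yP] [Wz pz zP]; apply: (regular_inj l_gt0 Wy Wz).
have key f : aff_root f -> f p != 0 -> 0 < f (y a0) -> 0 < f (z a0).
  move=> ff fp fy; case: (ltgtP 0 (f p)) => h; first exact: pz.
    have := py _ (aff_rootN ff); rewrite !oppr_gt0 => /(_ h); lra.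
  by rewrite -h eqxx in fp.
move=> f ff; have [fp|fp] := eqVneq (f p) 0; last exact: key.
move: f ff fp; apply: pos_fun => a m pa; first by move=> ap _; exact: zP.
by move=> /eqP; rewrite oppr_eq0 => /eqP ap; rewrite oppr_gt0; have := yP _ _ pa ap; lra.
Qed.

Definition top p : V -> V := xget (@id V) [set y | is_top p y].

Lemma topP p : is_top p (top p).
Proof. exact: (xgetPex (@id V) (top_exists p)). Qed.

Lemma top_W p : W (top p). Proof. by have [] := topP p. Qed.

Lemma top_spec p : spec p (top p a0). Proof. by have [] := topP p. Qed.

Lemma top_Wf p : chamber Phi p -> Wf Phi l (top p).
Proof.
move=> pC; apply/(WfP Phi l_gt0); split; first exact: top_W.
exact: (chamber_spec (@top_spec p)).
Qed.

(** Each closed alcove contains only one point of an orbit. *)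
Lemma orbit_closed x y p : W x -> W y -> spec p a0 -> spec (x p) (y a0) -> y p = x p.
Proof.
move=> Wx Wy pa xy; have [y' [Wy' yy' y'y]] := Waff_inv l_gt0 Wy.
have := spec_W Wy' xy; have /= -> := congr1 (@^~ a0) y'y => h.
have [/= e _] := fundamental l_gt0 (Waff_comp Wy' Wx) pa h.
by rewrite -{1}e; have /= -> := congr1 (@^~ (x p)) yy'.
Qed.

Lemma top_act x p : W x -> spec p a0 -> top (x p) p = x p.
Proof. by move=> Wx pa; apply: orbit_closed => //; [exact: top_W|exact: top_spec]. Qed.

(** The quotient of the two elements fixes [p], so that [fundamental] applies to
    it. *)
Lemma coset x y p : W x -> W y -> spec p a0 -> x p = y p ->
  exists2 g, stab p g & y = x \o g.
Proof.
move=> Wx Wy pa e; have [x' [Wx' xx' x'x]] := Waff_inv l_gt0 Wx.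
have h : (x' \o y) p = p by rewrite /= -e; have /= -> := congr1 (@^~ p) x'x.
have [|_ sg] := fundamental l_gt0 (Waff_comp Wx' Wy) pa; first by rewrite h.
exists (x' \o y) => //; apply/funext => q /=.
by have /= -> := congr1 (@^~ (y q)) xx'.
Qed.

Lemma spec_orbit x p : W x -> spec p a0 -> spec (x p) (x a0).
Proof. by move=> Wx pa; exact: spec_W. Qed.

Lemma stab_W p g : stab p g -> W g. Proof. by move=> /(stab_gen l_gt0)[]. Qed.

Lemma stab_fix p g : stab p g -> g p = p. Proof. by move=> /(stab_gen l_gt0)[]. Qed.

Lemma stab_sub p q : spec p q -> stab q `<=` stab p.
Proof.
move=> pq; apply: gen_sub => s [f [wf fq ->]]; apply: gen1; exists f; split=> //.
exact: (spec_eq0 pq (wall_fun wf)).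
Qed.

(** Words are extended on the left in their definition; cosets call for an
    extension on the right. *)
Lemma gen_ind_r (U : set (V -> V)) (P : (V -> V) -> Prop) : P id ->
  (forall w g, generated U w -> P w -> U g -> P (w \o g)) ->
  forall w, generated U w -> P w.
Proof.
move=> P0 PS w gw.
suff H : forall u, generated U u -> P u -> P (u \o w) by exact: (H id (gen_id _) P0).
case: gw => k; elim=> [//|j g {}w Ug _ IH] u gu Pu.
by apply: (IH (u \o g)); [apply: gen_comp => //; exact: gen1|exact: PS].
Qed.

(** * Counting hyperplanes *)

Definition hyp_at p (a : V) : bool := `[< exists m, dot p a = lmul l m >].

Definition neg_at p q (a : V) : bool :=
  `[< exists m, dot p a = lmul l m /\ dot q a < lmul l m >].

Definition pos_at p q (a : V) : bool :=
  `[< exists m, dot p a = lmul l m /\ lmul l m < dot q a >].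

(** The number of hyperplanes through [p]; [negc p q] and [posc p q] count those
    that have [q] on their negative and positive side. Each direction
    contributes at most one hyperplane, so that positive roots may be counted
    instead. *)
Definition hypc p : nat := count (hyp_at p) (pos_roots Phi).

Definition negc p q : nat := count (neg_at p q) (pos_roots Phi).

Definition posc p q : nat := count (pos_at p q) (pos_roots Phi).

Lemma ev_eq0 (a : V) m p : (ev l a m p = 0) <-> dot p a = lmul l m.
Proof. by split; rewrite /ev => h; lra. Qed.

Lemma ev_lt0 (a : V) m p : (ev l a m p < 0) = (dot p a < lmul l m).
Proof. by rewrite /ev subr_lt0. Qed.

Lemma neg_atE p q a m : dot p a = lmul l m -> neg_at p q a = (ev l a m q < 0).
Proof.
rewrite ev_lt0 => pm; apply/asboolP/idP => [[k [pk]]|h]; last by exists m.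
by rewrite -pk -pm.
Qed.

Lemma pos_atE p q a m : dot p a = lmul l m -> pos_at p q a = (0 < ev l a m q).
Proof.
rewrite evP => pm; apply/asboolP/idP => [[k [pk]]|h]; last by exists m.
by rewrite -pk -pm.
Qed.

Lemma at_false p q a : ~~ hyp_at p a -> neg_at p q a = false /\ pos_at p q a = false.
Proof.
by move=> /asboolPn h; split; apply/asboolP => -[m [pm _]]; apply: h; exists m.
Qed.

(** If [p] is in the closure of the facet of [q], the hyperplanes through [q]
    are those among the hyperplanes through [p] that have [q] on neither
    side. *)
Lemma hyp_split p q : spec p q -> hypc p = (hypc q + (negc p q + posc p q))%N.
Proof.
move=> pq; rewrite /hypc (@count_add _ _ (hyp_at q) (predU (neg_at p q) (pos_at p q))).
  have e0 : count (predI (neg_at p q) (pos_at p q)) (pos_roots Phi) = 0%N.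
    apply/eqP; rewrite eqn0Ngt -has_count; apply/hasPn => a _ /=.
    apply/negP => /andP[/asboolP[m [pm h1]]].
    by rewrite (pos_atE _ pm) evP => h2; lra.
  by congr addn; rewrite -count_predUI e0 addn0.
move=> a pa; have ff m : aff_root (ev l a m) by exact/aff_root_ev/pos_root_root.
have [/asboolP[m pm]|np] := boolP (hyp_at p a); last first.
  have [/= -> ->] := at_false q np; rewrite addn0.
  apply/esym/eqP; rewrite eqb0; apply: contra np => /asboolP[m qm].
  apply/asboolP; exists m; apply/ev_eq0/(spec_eq0 pq (ff m)); exact/ev_eq0.
rewrite /= (neg_atE _ pm) (pos_atE _ pm) .
have [/asboolP[k qk]|nq] := boolP (hyp_at q a).
  have pk : dot p a = lmul l k by apply/ev_eq0/(spec_eq0 pq (ff k))/ev_eq0.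
  have -> : m = k by apply: (lmul_inj (R := R) l_gt0); rewrite -pm -pk.
  by rewrite (iffRL (ev_eq0 _ _ _) qk) ltxx.
case: (ltgtP (ev l a m q) 0) => // h.
by case/asboolPn: nq; exists m; exact/ev_eq0.
Qed.

(** A hyperplane through [p] with [r] on its negative side either contains [q]
    or has [q] on its negative side as well. *)
Lemma neg_split p q r : spec p q -> spec q r -> negc p r = (negc q r + negc p q)%N.
Proof.
move=> pq qr; apply: count_add => a pa.
have ff m : aff_root (ev l a m) by exact/aff_root_ev/pos_root_root.
have [/asboolP[m pm]|np] := boolP (hyp_at p a); last first.
  have [-> _] := at_false q np; have [-> _] := at_false r np.
  have nq : ~~ hyp_at q a.
    apply: contra np => /asboolP[m qm].
    by apply/asboolP; exists m; apply/ev_eq0/(spec_eq0 pq (ff m)); exact/ev_eq0.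
  by have [-> _] := at_false r nq.
rewrite !(neg_atE _ pm).
have [/asboolP[k qk]|nq] := boolP (hyp_at q a).
  have pk : dot p a = lmul l k by apply/ev_eq0/(spec_eq0 pq (ff k))/ev_eq0.
  have -> : m = k by apply: (lmul_inj (R := R) l_gt0); rewrite -pm -pk.
  by rewrite (neg_atE _ qk) (iffRL (ev_eq0 _ _ _) qk) ltxx addn0.
have [-> _] := at_false r nq; rewrite add0n; congr nat_of_bool.
have qr' := qr _ (aff_rootN (ff m)).
case: (ltgtP (ev l a m q) 0) => h.
- by apply/idP; rewrite -oppr_gt0 qr' // oppr_gt0.
- by have := qr _ (ff m) h; case: ltgtP.
- by case/asboolPn: nq; exists m; exact/ev_eq0.
Qed.

Lemma hyp_regular p r : (forall f, aff_root f -> f p = 0 -> f r != 0) ->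
  hypc p = (negc p r + posc p r)%N.
Proof.
move=> pr; apply: count_add => a pa.
have [/asboolP[m pm]|np] := boolP (hyp_at p a); last first.
  by have [-> ->] := at_false r np.
rewrite (neg_atE _ pm) (pos_atE _ pm).
have := pr _ (aff_root_ev l m (pos_root_root pa)); rewrite (iffRL (ev_eq0 _ _ _) pm).
by move=> /(_ erefl); case: ltgtP.
Qed.

(** * How the counts change along a coset of a stabilizer *)

Lemma pos_roots_uniq : uniq (pos_roots Phi).
Proof. exact/filter_uniq/roots_uniq. Qed.

(** Only the hyperplane that is crossed changes side, by [wall_sep]. *)
Lemma step x f p b m : W x -> wall f -> f p = 0 -> b \in pos_roots Phi ->
  ev l b m \o x = f ->
  negc (x p) ((x \o rf f) a0) = (negc (x p) (x a0)).+1 /\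
  posc (x p) (x a0) = (posc (x p) ((x \o rf f) a0)).+1.
Proof.
move=> Wx wf fp pb bE; have ff := wall_fun wf.
have xpb : dot (x p) b = lmul l m.
  by apply/ev_eq0; have := congr1 (@^~ p) bE; rewrite /= fp.
have bx : 0 < ev l b m (x a0).
  by have /= -> := congr1 (@^~ a0) bE; exact: wall_gt0.
have bxs : ev l b m ((x \o rf f) a0) < 0.
  have /= -> := congr1 (@^~ (rf f a0)) bE.
  by rewrite (rf_anti _ ff) oppr_lt0 wall_gt0.
have other h : aff_root h -> 0 < h (x a0) -> h <> ev l b m -> 0 < h ((x \o rf f) a0).
  move=> hf h0 hb; apply: contrapT => hs; apply: hb.
  have := lt0_Wbase l_gt0 hf (Waff_rfr l_gt0 Wx ff) hs => {}hs.
  have := wall_sep l_gt0 wf (aff_root_W hf Wx) h0 hs; rewrite -bE => e.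
  have [x' [_ xx' _]] := Waff_inv l_gt0 Wx.
  by apply/funext => q; have := congr1 (@^~ (x' q)) e; have /= -> := congr1 (@^~ q) xx'.
have same a k : a \in pos_roots Phi -> a != b ->
    (0 < ev l a k ((x \o rf f) a0)) = (0 < ev l a k (x a0)).
  move=> pa ab; have af := aff_root_ev l k (pos_root_root pa).
  apply/idP/idP => h; last first.
    apply: other => //; move=> /(ev_inj l_gt0)[e _]; by rewrite e eqxx in ab.
  apply: contrapT => /(lt0_Wbase l_gt0 af Wx) h'.
  suff : 0 < - ev l a k ((x \o rf f) a0) by lra.
  apply: (other _ (aff_rootN af)); first by rewrite oppr_gt0.
  move=> e; apply: (pos_rootN l_gt0 pb); have : ev l b m = ev l (- a) (- k).
    by rewrite -e; apply/funext => q; rewrite evN.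
  by move=> /(ev_inj l_gt0)[-> _]; rewrite opprK.
have neq a k : aff_root (ev l a k) -> ev l a k ((x \o rf f) a0) != 0 /\ ev l a k (x a0) != 0.
  by move=> af; split; apply: (Wbase_neq0 l_gt0 af) => //; exact: Waff_rfr.
split; apply: (count_diff1 pos_roots_uniq pb).
- by rewrite (neg_atE _ xpb).
- by rewrite (neg_atE _ xpb) -leNgt ltW.
- move=> a pa ab; have [/asboolP[k ak]|np] := boolP (hyp_at (x p) a); last first.
    by have [-> _] := at_false (x a0) np; have [-> _] := at_false ((x \o rf f) a0) np.
  rewrite !(neg_atE _ ak) !lt_neqAle.
  have [-> ->] := neq a k (aff_root_ev l k (pos_root_root pa)).
  by rewrite !leNgt same.
- by rewrite (pos_atE _ xpb).
- by rewrite (pos_atE _ xpb) -leNgt ltW.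
- move=> a pa ab; have [/asboolP[k ak]|np] := boolP (hyp_at (x p) a); last first.
    by have [_ ->] := at_false (x a0) np; have [_ ->] := at_false ((x \o rf f) a0) np.
  by rewrite !(pos_atE _ ak) same.
Qed.

Lemma step_cases x f : W x -> wall f -> exists b m, b \in pos_roots Phi /\
  (ev l b m \o x = f \/ ev l b m \o (x \o rf f) = f).
Proof.
move=> Wx wf; have ff := wall_fun wf.
have [h [hf hx _]] := rf_right l_gt0 Wx ff.
case: hf hx => a [m [ra ->]] hx.
case: (root_pos ra) => pa; first by exists a, m; split=> //; left.
exists (- a), (- m); split=> //; right; apply/funext => q /=.
by rewrite evN; have /= -> := congr1 (@^~ (rf f q)) hx; rewrite (rf_anti _ ff) opprK.
Qed.

(** The fundamental alcove is on the negative side of all the hyperplanes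
    through a dominant point, so a step that decreases the length crosses such a
    hyperplane from its positive to its negative side. *)
Lemma len_negc_step x f p : W x -> wall f -> f p = 0 -> chamber Phi (x p) ->
  (len (x \o rf f) < len x)%N ->
  negc (x p) ((x \o rf f) a0) = (negc (x p) (x a0)).+1.
Proof.
move=> Wx wf fp xpC lt; have ff := wall_fun wf.
have [b [m [pb [bE|bE]]]] := step_cases Wx wf; first by have [] := step Wx wf fp pb bE.
have Wxs := Waff_rfr l_gt0 Wx ff.
exfalso; move: lt; apply/negP; rewrite -leqNgt; apply: ltnW.
have bf := aff_root_ev l m (pos_root_root pb).
have e : rf (ev l b m) \o (x \o rf f) = x.
  by rewrite (rf_W bf Wxs) bE (compA_rf x ff).
rewrite -{1}e -(rfN bf); apply: (len_refl_lt l_gt0 Wxs (aff_rootN bf)).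
  have bp : ev l b m (x p) = 0.
    by have := congr1 (@^~ p) bE; rewrite /= (rf_fix fp) fp.
  have := pos_roots_dot xpC pb; rewrite (iffLR (ev_eq0 _ _ _) bp).
  rewrite -{1}(lmul0 l) ltr_lmul // => m0; rewrite oppr_gt0 ev_lt0.
  have /pos_rootsP[rb nb] := pb.
  by rewrite (pos_ltmulP l_gt0) // (Aplus_dot (base_Aplus Phi l_gt0)).
have /= -> := congr1 (@^~ a0) bE; rewrite oppr_lt0; exact: wall_gt0.
Qed.

(** Seen from the highest alcove at a point, the hyperplanes crossed on the way
    to another alcove at this point are those that have the latter on their
    negative side. *)
Lemma negc_top p y (k : V -> V) : spec p a0 -> is_top (y p) y -> stab p k ->
  negc (y p) ((y \o k) a0) = len k.
Proof.
move=> pa [Wy _ yP]; move: k; apply: gen_ind_r.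
  have -> : len id = 0%N.
    by apply/eqP; rewrite -leqn0; apply: (len_min l_gt0); exact: word_nil.
  apply/eqP; rewrite eqn0Ngt -has_count; apply/hasPn => a pa'; apply/negP.
  move=> /asboolP[m [am]]; rewrite -ev_lt0 /= => h.
  by have := yP a m pa' (iffRL (ev_eq0 _ _ _) am); lra.
move=> k _ sk IH [f [wf fp ->]].
have [Wk kp] := stab_gen l_gt0 sk; have ff := wall_fun wf.
have Wyk := Waff_comp Wy Wk; have Wks := Waff_rfr l_gt0 Wk ff.
have ykp : (y \o k) p = y p by rewrite /= kp.
have [b [m [pb [bE|bE]]]] := step_cases Wyk wf.
  have [+ _] := step Wyk wf fp pb bE; rewrite ykp IH => ->; apply/esym.
  have bf := aff_root_W (aff_root_ev l m (pos_root_root pb)) Wy.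
  have bE' : (ev l b m \o y) \o k = f by [].
  have byp : ev l b m (y p) = 0.
    by have := congr1 (@^~ p) bE; rewrite /= kp fp.
  apply: (len_up l_gt0 Wk wf).
  have := rf_W bf Wk; rewrite bE' => <-; apply: (len_refl_gt l_gt0) => //.
    exact: yP.
  by have /= -> := congr1 (@^~ a0) bE; exact: wall_gt0.
have Wyks := Waff_rfr l_gt0 Wyk ff.
have [+ _] := step Wyks wf fp pb bE.
rewrite (compA_rf (y \o k) ff) /= (rf_fix fp) kp IH => e.
have bf := aff_root_W (aff_root_ev l m (pos_root_root pb)) Wy.
have byp : ev l b m (y p) = 0.
  by have := congr1 (@^~ p) bE; rewrite /= (rf_fix fp) kp fp.
have bE' : (ev l b m \o y) \o (k \o rf f) = f by [].
have lt : (len (k \o rf f) < len k)%N.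
  have E := rf_W bf Wks; rewrite bE' (compA_rf k ff) in E.
  rewrite -{2}E; apply: (len_refl_gt l_gt0) => //; first exact: yP.
  by have /= -> := congr1 (@^~ a0) bE; exact: wall_gt0.
have := len_down l_gt0 Wk wf lt; rewrite e => -[] //.
Qed.

(** The alcove at [p] opposite to the fundamental one, in the direction of the
    reflection of the base point through [p]. *)
Lemma stab_opposite p : spec p a0 -> exists2 w, stab p w &
  forall f, aff_root f -> f p = 0 -> 0 < f a0 -> f (w a0) < 0.
Proof.
move=> pa.
have fE f : aff_root f -> f p = 0 -> f (p + (p - a0)) = - f a0.
  move=> ff fp; have := aff_root_line a0 p 2 ff.
  rewrite fp (_ : a0 + _ = p + (p - a0)) => [->|]; first by lra.
  by rewrite scaler_nat mulr2n addrA (addrC a0) subrK.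
have [|w [Ww pw wP]] := @perturb p (p - a0).
  by move=> f ff fp; rewrite fE // oppr_eq0; exact: (Wbase_neq0 l_gt0 ff (Waff_id _ _)).
have [g sg e] := coset (Waff_id Phi l) Ww pa (esym (orbit_closed (Waff_id Phi l) Ww pa pw)).
exists w => [|f ff fp f0]; first by rewrite e.
have := wP _ (aff_rootN ff); rewrite fp oppr0 fE // opprK oppr_gt0.
by move=> /(_ erefl f0).
Qed.

(** The longest element [w] of the stabilizer sends the base point to the other
    side of every hyperplane through [p], so its length is the number of these
    hyperplanes, and [k] and [k w] are separated by all of them. *)
Lemma stab_longest p : spec p a0 -> exists w, [/\ stab p w,
  forall y, is_top (y p) y -> hypc (y p) = len w &
  forall k : V -> V, stab p k -> (len (k \o w) + len k = len w)%N].
Proof.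
move=> pa; have [w sw wP] := stab_opposite pa; have Ww := stab_W sw.
have opp h : aff_root h -> h p = 0 -> (h (w a0) < 0) = (0 < h a0).
  move=> hf hp; case: (aff_root_pos l_gt0 hf) => h0; first by rewrite h0 wP.
  have := wP _ (aff_rootN hf); rewrite hp oppr0 => /(_ erefl h0) h1.
  apply/idP/idP; lra.
have hypE y : is_top (y p) y -> hypc (y p) = len w.
  move=> yt; rewrite -(negc_top pa yt sw); apply: eq_in_count => a pa'.
  case: yt => Wy _ yP; have [/asboolP[m am]|na] := boolP (hyp_at (y p) a); last first.
    by have [-> _] := at_false ((y \o w) a0) na.
  have hf := aff_root_W (aff_root_ev l m (pos_root_root pa')) Wy.
  have e0 := (iffRL (ev_eq0 _ _ _) am).
  rewrite (neg_atE _ am); have := opp _ hf e0; rewrite /= => ->.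
  by rewrite yP.
exists w; split=> // k sk; have Wk := stab_W sk.
have pE : top p p = p by exact: (top_act (Waff_id Phi l) pa).
have yt : is_top (top p p) (top p) by rewrite pE; exact: topP.
rewrite -(hypE _ yt) -(negc_top pa yt sk) -(negc_top pa yt (gen_comp sk sw)) addnC.
rewrite (@hyp_regular _ ((top p \o k) a0)); last first.
  by move=> f ff _; apply: (Wbase_neq0 l_gt0 ff); exact/Waff_comp/Wk/top_W.
congr addn; apply: eq_in_count => a pa'.
have [/asboolP[m am]|na] := boolP (hyp_at (top p p) a); last first.
  by have [-> _] := at_false ((top p \o (k \o w)) a0) na;
    have [_ ->] := at_false ((top p \o k) a0) na.
have hf := aff_root_W (aff_root_ev l m (pos_root_root pa')) (Waff_comp (top_W p) Wk).
have e0 := (iffRL (ev_eq0 _ _ _) am).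
rewrite (neg_atE _ am) (pos_atE _ am); have := opp _ hf; rewrite /= => -> //.
by rewrite (stab_fix sk).
Qed.

(** An element of the stabilizer is determined by the sides of the hyperplanes
    through [p] on which its alcove lies. *)
Lemma stab_finite p : spec p a0 -> finite_set (stab p).
Proof.
(* [F] records the signs, and [G] recovers the element from them. *)
move=> pa; pose T := (size (pos_roots Phi)).-tuple bool.
pose F (g : V -> V) : T := [tuple of map (neg_at p (g a0)) (in_tuple (pos_roots Phi))].
pose G (t : T) : V -> V := xget (@id V) [set g | stab p g /\ F g = t].
apply: (@sub_finite_set _ _ (G @` setT)); last exact/finite_image/finite_finset.
move=> g sg; exists (F g) => //.
have [sG FG] : [set h | stab p h /\ F h = F g] (G (F g)).
  by apply: (xgetPex (@id V)); exists g.
have FE (g1 g2 : V -> V) : stab p g1 -> stab p g2 -> F g1 = F g2 ->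
    spec (g1 a0) (g2 a0).
  move=> s1 s2 /(congr1 val)/= /eq_in_map e12 f ff f1.
  have W1 := stab_W s1; have W2 := stab_W s2.
  have p1 : spec p (g1 a0) by rewrite -{1}(stab_fix s1); exact: spec_W.
  have p2 : spec p (g2 a0) by rewrite -{1}(stab_fix s2); exact: spec_W.
  have [fp|fp] := eqVneq (f p) 0; last first.
    case: (ltgtP 0 (f p)) => h; [exact: p2| |by rewrite -h eqxx in fp].
    by have := p1 _ (aff_rootN ff); rewrite !oppr_gt0 => /(_ h); lra.
  have key a m : a \in pos_roots Phi -> ev l a m p = 0 ->
      (ev l a m (g1 a0) < 0) = (ev l a m (g2 a0) < 0).
    by move=> pa' /ev_eq0 am; rewrite -!(neg_atE _ am) e12.
  have ne a m : a \in pos_roots Phi -> ev l a m (g2 a0) != 0.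
    by move=> pa'; apply: (Wbase_neq0 l_gt0 (aff_root_ev l m (pos_root_root pa')) W2).
  move: f ff fp f1; apply: pos_fun => a m pa'.
    move=> fp f1; have := key a m pa' fp; have := ne a m pa'.
    by rewrite (ltNge (ev _ _ _ (g1 a0))) (ltW f1) /=; case: ltgtP.
  move=> /eqP; rewrite oppr_eq0 => /eqP fp; rewrite !oppr_gt0.
  by rewrite key.
by apply: (regular_inj l_gt0); [exact: stab_W sG|exact: stab_W sg|exact: FE].
Qed.

Lemma chamber_coset p x y : W x -> W y -> spec p a0 -> x p = y p ->
  chamber Phi (x p) -> Wf Phi l y.
Proof.
move=> Wx Wy pa e xpC; apply/(WfP Phi l_gt0); split=> //.
by apply: (chamber_spec _ xpC); rewrite e; exact: spec_orbit.
Qed.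

End Points.

(** * Laurent polynomials *)

Section Laurent.
Implicit Types (f g : laurent) (i j k m : int).

Lemma laurentP f g : (forall i, mcoeff i f = mcoeff i g) -> f = g.
Proof. by move=> h; apply/malgP => i; exact: h. Qed.

Lemma mcoeff_sum (K : choiceType) (G : zmodType) (I : Type) (s : seq I) (P : pred I)
    (F : I -> {malg G[K]}) (k : K) :
  mcoeff k (\sum_(i <- s | P i) F i) = \sum_(i <- s | P i) mcoeff k (F i).
Proof. exact: raddf_sum. Qed.

Lemma mcoeffMz (K : choiceType) (G : zmodType) (k : K) (f : {malg G[K]}) (z : int) :
  mcoeff k (f *~ z) = mcoeff k f *~ z.
Proof. exact: raddfMz. Qed.

Lemma mcoeff_pick (K : choiceType) (G : zmodType) (f : {malg G[K]}) (k : K) :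
  \sum_(i <- msupp f) (mcoeff i f *+ (i == k)) = mcoeff k f.
Proof.
rewrite [in RHS](monalgE f) mcoeff_sum.
by apply: eq_bigr => i _; rewrite mcoeffU.
Qed.

Lemma mcoeff_lbar i f : mcoeff i (lbar f) = mcoeff (- i) f.
Proof.
rewrite /lbar mcoeff_sum -(mcoeff_pick f (- i)).
by apply: eq_bigr => j _; rewrite mcoeffU eqr_oppLR.
Qed.

Lemma lbarD f g : lbar (f + g) = lbar f + lbar g.
Proof. by apply: laurentP => i; rewrite mcoeffD !mcoeff_lbar mcoeffD. Qed.

Lemma lbarN f : lbar (- f) = - lbar f.
Proof. by apply: laurentP => i; rewrite mcoeffN !mcoeff_lbar mcoeffN. Qed.

Lemma lbar0 : lbar 0 = 0.
Proof. by apply: laurentP => i; rewrite mcoeff_lbar !mcoeff0. Qed.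

Lemma lbar_sum (I : Type) (s : seq I) (P : pred I) (F : I -> laurent) :
  lbar (\sum_(i <- s | P i) F i) = \sum_(i <- s | P i) lbar (F i).
Proof. exact: (big_morph lbar lbarD lbar0). Qed.

Definition lmono i (c : int) : laurent := mkmalgU i c.

Lemma mcoeff_lmono i c k : mcoeff k (lmono i c) = c *+ (i == k).
Proof. exact: mcoeffU. Qed.

Lemma lbarU i c : lbar (lmono i c) = lmono (- i) c.
Proof.
apply: laurentP => j; rewrite mcoeff_lbar !mcoeff_lmono.
by rewrite eqr_oppLR.
Qed.

Lemma vpow_bar i : lbar (vpow i) = vpow (- i).
Proof. exact: lbarU. Qed.

Lemma mulUU i j (a b : int) :
  lmono i a * lmono j b = lmono (i + j) (a * b).
Proof. exact: laurent_mulU. Qed.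

Lemma vpowD i j : vpow (i + j) = vpow i * vpow j.
Proof. by rewrite -[vpow i]/(lmono i 1) -[vpow j]/(lmono j 1) mulUU mulr1. Qed.

Lemma vpow0 : vpow 0 = 1. Proof. by []. Qed.

Lemma mcoeff_vpow i k : mcoeff k (vpow i) = (i == k)%:R.
Proof. by rewrite /vpow mcoeffU. Qed.

Lemma laurentE f : f = \sum_(i <- msupp f) lmono i (mcoeff i f).
Proof. exact: monalgE. Qed.

Lemma laurent_ind (P : laurent -> Prop) : P 0 ->
  (forall i c g, P g -> P (lmono i c + g)) -> forall f, P f.
Proof.
move=> P0 PD f; rewrite (laurentE f).
by elim: (X in \sum_(i <- X) _) => [|i s IH]; rewrite ?big_nil ?big_cons //; exact: PD.
Qed.

Lemma lbarM f g : lbar (f * g) = lbar f * lbar g.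
Proof.
elim/laurent_ind: f => [|i c f IH]; first by rewrite mul0r lbar0 mul0r.
rewrite mulrDl !lbarD mulrDl IH; congr (_ + _).
elim/laurent_ind: g {f IH} => [|j d g IH]; first by rewrite mulr0 lbar0 mulr0.
by rewrite mulrDr !lbarD mulrDr IH mulUU !lbarU mulUU opprD.
Qed.

Lemma lbar1 : lbar 1 = 1.
Proof. by rewrite -vpow0 vpow_bar oppr0. Qed.

Lemma mcoeffM_vpow i k f : mcoeff k (vpow i * f) = mcoeff (k - i) f.
Proof.
rewrite [in LHS](laurentE f) mulr_sumr mcoeff_sum -(mcoeff_pick f (k - i)).
apply: eq_bigr => j _; rewrite -[vpow i]/(lmono i 1) mulUU mul1r mcoeff_lmono.
by rewrite addrC -subr_eq opprK eq_sym -subr_eq eq_sym.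
Qed.

Lemma mcoeff_mulE k f g : mcoeff k (f * g) =
  \sum_(i <- msupp f) mcoeff i f * mcoeff (k - i) g.
Proof.
rewrite {1}(laurentE f) mulr_suml mcoeff_sum; apply: eq_bigr => i _.
have -> : lmono i (mcoeff i f) = vpow i *~ mcoeff i f.
  by apply: laurentP => j; rewrite mcoeffMz mcoeff_vpow mcoeff_lmono;
    case: eqP; rewrite ?mul0rz ?intz.
by rewrite mulrzAl mcoeffMz mcoeffM_vpow -mulrzr mulrC intz.
Qed.

Lemma mcoeff_nz i f : (i \in msupp f) = (mcoeff i f != 0).
Proof. by rewrite mcoeff_neq0. Qed.

(** Divisibility by [v^k] in [v^k Z[v]]; [low 1] is membership in [v Z[v]]. *)
Definition low k f := forall i, mcoeff i f != 0 -> k <= i.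

Lemma low0 k : low k 0. Proof. by move=> i; rewrite mcoeff0 eqxx. Qed.

Lemma lowW k j f : j <= k -> low k f -> low j f.
Proof. by move=> jk fk i /fk; apply: le_trans. Qed.

Lemma lowD k f g : low k f -> low k g -> low k (f + g).
Proof.
move=> fk gk i; rewrite mcoeffD; case: (eqVneq (mcoeff i f) 0) => [->|/fk //].
by rewrite add0r => /gk.
Qed.

Lemma lowN k f : low k f -> low k (- f).
Proof. by move=> fk i; rewrite mcoeffN oppr_eq0; exact: fk. Qed.

Lemma lowMz k f (z : int) : low k f -> low k (f *~ z).
Proof.
by move=> fk i; rewrite mcoeffMz; case: (eqVneq (mcoeff i f) 0) => [->|/fk //];
  rewrite mul0rz eqxx.
Qed.

Lemma low_sum k (I : Type) (s : seq I) (P : pred I) (F : I -> laurent) :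
  (forall x, P x -> low k (F x)) -> low k (\sum_(x <- s | P x) F x).
Proof. by move=> h; apply: big_ind => //; [exact: low0|exact: lowD]. Qed.

Lemma low_vpow k i f : low k f -> low (k + i) (vpow i * f).
Proof. by move=> fk j; rewrite mcoeffM_vpow => /fk; lia. Qed.

Lemma low_1 : low 0 1.
Proof. by move=> i; rewrite -vpow0 mcoeff_vpow; have [<-|] := eqVneq 0 i. Qed.

Lemma low_sub0 f : low 0 f -> low 1 (f - 1 *~ mcoeff 0 f).
Proof.
move=> f0 i; rewrite mcoeffB mcoeffMz -vpow0 mcoeff_vpow.
have [<-|i0] := eqVneq 0 i; first by rewrite intz subrr eqxx.
by rewrite mul0rz subr0 => /f0; lia.
Qed.

Lemma low_mul k j f g : low k f -> low j g -> low (k + j) (f * g).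
Proof.
move=> fk gj i; rewrite mcoeff_mulE => h.
case: (pselect (exists2 m, mcoeff m f != 0 & mcoeff (i - m) g != 0)).
  by move=> [m /fk ? /gj]; lia.
move=> H; case/eqP: h; rewrite big1_seq // => m /=; rewrite mcoeff_nz => fm.
by apply/eqP; rewrite mulf_eq0 (negbTE fm) /=; apply: contrapT => /negP gm; apply: H; exists m.
Qed.

Lemma vZvE f : in_vZv f <-> low 1 f.
Proof. by split=> h i /h; lia. Qed.

(** A bar invariant polynomial has as many terms of negative as of positive
    exponent. *)
Lemma low1_bar f : low 1 f -> lbar f = f -> f = 0.
Proof.
move=> f1 fb; apply: laurentP => i; rewrite mcoeff0; apply/eqP.
have [//|h] := eqVneq (mcoeff i f) 0.
have i0 := f1 _ h; move: h; rewrite -fb mcoeff_lbar => /f1; lia.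
Qed.

Lemma max_exponent f : f != 0 -> exists2 i, mcoeff i f != 0 &
  forall j, mcoeff j f != 0 -> j <= i.
Proof.
move=> f0; have : exists i, i \in msupp f.
  apply: contrapT => h; move/eqP: f0; apply; apply: laurentP => i.
  rewrite mcoeff0; apply: mcoeff_outdom; apply/negP => fi; apply: h; by exists i.
suff H (s : seq int) : (exists i, i \in s) -> exists2 i, i \in s & forall j, j \in s -> j <= i.
  move=> /H[i fi iP]; exists i; first by rewrite -mcoeff_nz.
  by move=> j; rewrite -mcoeff_nz; exact: iP.
elim: s => [[i]//|a s IH _]; have [/IH[i si iP]|h] := pselect (exists i, i \in s).
  exists (Order.max a i); first by rewrite /Order.max inE; case: ifP; rewrite ?si ?eqxx ?orbT.
  by move=> j; rewrite inE le_max => /orP[/eqP ->|/iP ->]; rewrite ?lexx ?orbT.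
exists a; rewrite ?mem_head // => j; rewrite inE => /orP[/eqP -> //|sj].
by case: h; exists j.
Qed.

(** The product of the terms of largest exponent cannot cancel. *)
Lemma laurent_mulf_eq0 f g : f * g = 0 -> f != 0 -> g = 0.
Proof.
move=> fg f0; apply/eqP; apply: contrapT => /negP g0.
have [i fi iP] := max_exponent f0; have [j gj jP] := max_exponent g0.
have := congr1 (mcoeff (i + j)) fg; rewrite mcoeff0 mcoeff_mulE.
rewrite (bigD1_seq i) ?fset_uniq ?mcoeff_nz //= addrAC subrr add0r big1 ?addr0.
  by move/eqP; rewrite mulf_eq0 (negbTE fi) (negbTE gj).
move=> k ki; have [->|fk] := eqVneq (mcoeff k f) 0; first by rewrite mul0r.
have [->|gk] := eqVneq (mcoeff (i + j - k) g) 0; first by rewrite mulr0.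
by have := iP _ fk; have := jP _ gk; move: ki => /eqP; lia.
Qed.

Lemma laurent_cancel c f g : c != 0 -> c * f = c * g -> f = g.
Proof.
move=> c0 h; apply/eqP; rewrite -subr_eq0; apply/eqP.
by apply: (laurent_mulf_eq0 _ c0); rewrite mulrBr h subrr.
Qed.

(** The coefficients are nonnegative. *)
Lemma vpow_sum_neq0 (I : eqType) (s : seq I) (k : I -> int) (x : I) :
  x \in s -> \sum_(i <- s) vpow (k i) != 0.
Proof.
move=> sx; apply/eqP => /(congr1 (mcoeff (k x))); rewrite mcoeff0 mcoeff_sum.
under eq_bigr do rewrite mcoeff_vpow.
move/eqP; rewrite psumr_eq0 => [/allP/(_ _ sx)|i _]; last exact: ler0n.
by rewrite eqxx.
Qed.

End Laurent.

(** * The antispherical module *)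

Section Basis.
Context (I : choiceType) (M : lmodType laurent) (D : set I) (b : I -> M).
Hypothesis bD : is_basis D b.
Implicit Types (c d : {malg laurent[I]}) (z : M).

(** Used both for bases and for the family of canonical elements of the module
    of points. *)
Definition comb c : M := \sum_(i <- msupp c) mcoeff i c *: b i.

Lemma comb_w (X : {fset I}) c : (msupp c `<=` X)%fset ->
  comb c = \sum_(i <- X) mcoeff i c *: b i.
Proof.
move=> cX; rewrite /comb (big_fset_incl _ cX) // => i _ /mcoeff_outdom ->.
by rewrite scale0r.
Qed.

Lemma combD c d : comb (c + d) = comb c + comb d.
Proof.
rewrite (comb_w (msuppD_le c d)) (comb_w (fsubsetUl _ (msupp d))).
rewrite (comb_w (fsubsetUr (msupp c) _)) -big_split /=.
by apply: eq_bigr => i _; rewrite mcoeffD scalerDl.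
Qed.

Lemma combZ a c : comb (a *: c) = a *: comb c.
Proof.
rewrite (comb_w (msuppZ_le a c)) scaler_sumr; apply: eq_bigr => i _.
by rewrite mcoeffZ scalerA.
Qed.

Lemma combU i : comb (mkmalgU i 1) = b i.
Proof. by rewrite (comb_w msuppU_le) big_seq_fset1 mcoeffUU scale1r. Qed.

Local Notation cf i z := (mcoeff i (basis_coord D b z)).

Lemma coordP z : (forall i, i \in msupp (basis_coord D b z) -> D i) /\
  z = comb (basis_coord D b z).
Proof.
have [c [cP _]] := bD z.
suff : [set c | (forall i, i \in msupp c -> D i) /\ z = comb c] (basis_coord D b z) by [].
by apply: xgetPex; exists c.
Qed.

Lemma coord_comb c : (forall i, i \in msupp c -> D i) ->
  basis_coord D b (comb c) = c.
Proof.
move=> cD; have [c' [_ cu]] := bD (comb c).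
by rewrite -(cu _ (coordP (comb c))) (cu c (conj cD erefl)).
Qed.

Lemma cf_out i z : ~ D i -> cf i z = 0.
Proof. by move=> nD; apply: mcoeff_outdom; apply/negP => /(coordP z).1. Qed.

Lemma cfD i z z' : cf i (z + z') = cf i z + cf i z'.
Proof.
have [s1 e1] := coordP z; have [s2 e2] := coordP z'.
rewrite {1}e1 {1}e2 -combD coord_comb ?mcoeffD // => j.
by move=> /(fsubsetP (msuppD_le _ _)); rewrite inE => /orP[/s1|/s2].
Qed.

Lemma cfZ i a z : cf i (a *: z) = a * cf i z.
Proof.
have [s1 e1] := coordP z; rewrite {1}e1 -combZ coord_comb ?mcoeffZ // => j.
by move=> /(fsubsetP (msuppZ_le _ _)) /s1.
Qed.

Lemma cf_basis i j : D j -> cf i (b j) = (j == i)%:R.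
Proof.
move=> Dj; rewrite -combU coord_comb ?mcoeffU // => k.
by move=> /(fsubsetP msuppU_le); rewrite inE => /eqP ->.
Qed.

Lemma cf0 i : cf i 0 = 0.
Proof. by rewrite -(scale0r 0) cfZ mul0r. Qed.

Lemma cfN i z : cf i (- z) = - cf i z.
Proof. by rewrite -scaleN1r cfZ mulN1r. Qed.

Lemma cfB i z z' : cf i (z - z') = cf i z - cf i z'.
Proof. by rewrite cfD cfN. Qed.

Lemma cf_sum i (J : Type) (s : seq J) (P : pred J) (F : J -> M) :
  cf i (\sum_(j <- s | P j) F j) = \sum_(j <- s | P j) cf i (F j).
Proof. exact: (big_morph (fun z => cf i z) (cfD i) (cf0 i)). Qed.

Lemma cfMz i z (k : int) : cf i (z *~ k) = cf i z *~ k.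
Proof. by rewrite -scaler_int cfZ mulrzl. Qed.

Lemma cf_ext z z' : (forall i, cf i z = cf i z') -> z = z'.
Proof.
by move=> e; rewrite (coordP z).2 (coordP z').2; congr comb; apply/malgP.
Qed.

Lemma basis_ind (P : M -> Prop) : P 0 ->
  (forall z z', P z -> P z' -> P (z + z')) ->
  (forall a i, D i -> P (a *: b i)) -> forall z, P z.
Proof.
move=> P0 PD PZ z; have [s ->] := coordP z; rewrite /comb big_seq.
apply: big_ind => // i /s; exact: PZ.
Qed.

End Basis.

Lemma seq_max (T : eqType) (s : seq T) (F : T -> nat) : s != [::] ->
  exists2 x, x \in s & forall y, y \in s -> (F y <= F x)%N.
Proof.
elim: s => // a s IH _; have [->|/IH[x sx xP]] := eqVneq s [::].
  by exists a; rewrite ?mem_head // => y; rewrite inE => /eqP ->.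
case: (leqP (F x) (F a)) => h; [exists a|exists x]; rewrite ?mem_head ?inE ?sx ?orbT //.
  by move=> y /orP[/eqP -> //|/xP /leq_trans]; apply.
by move=> y /orP[/eqP ->|/xP //]; exact: ltnW.
Qed.

Section Module.
Context {R : realType} {n : nat} {Phi : rootSystem R n} {l : nat}.
Context (l_gt0 : (0 < l)%N) (H : heckeModule Phi l).
Local Notation V := 'rV[R]_n.
Local Notation aff_root := (aff_root Phi l).
Local Notation wall := (wall Phi l).
Local Notation spec := (spec Phi l).
Local Notation a0 := (base Phi l).
Local Notation W := (Waff Phi l).
Local Notation Wf := (Wf Phi l).
Local Notation len := (cox_length Phi l).
Local Notation N := (indmod H).
Local Notation v := (vpow 1).
Local Notation v' := (vpow (-1)).
Implicit Types (x y w : V -> V) (f : V -> R) (z : N) (a c : laurent) (h : hecke H).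

Definition cf x z : laurent := mcoeff x (basis_coord Wf (@Nb _ _ _ _ H) z).

Lemma vv' : v * v' = 1. Proof. by rewrite -vpowD subrr. Qed.

Lemma N_basis : is_basis Wf (@Nb _ _ _ _ H).
Proof. exact: tens_basis. Qed.

Lemma tensE a x : tens (a : laurent) (Hb H x) = a *: Nb H x :> N.
Proof. by rewrite /Nb -tensZl mulr1. Qed.

Lemma N_ind (P : N -> Prop) : P 0 -> (forall z z', P z -> P z' -> P (z + z')) ->
  (forall a h, P (tens a h)) -> forall z, P z.
Proof.
move=> P0 PD PT; apply: (basis_ind N_basis P0 PD) => a x _.
by rewrite -tensE.
Qed.

Lemma act0 h : act (0 : N) h = 0.
Proof. by apply: (@addIr _ (act (0 : N) h)); rewrite -actD !add0r. Qed.

Lemma nbar0 : nbar (0 : N) = 0.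
Proof. by apply: (@addIr _ (nbar (0 : N))); rewrite -nbarD !add0r. Qed.

Lemma actZ a z h : act (a *: z) h = a *: act z h.
Proof.
elim/N_ind: z => [|z z' IH IH'|c k]; first by rewrite scaler0 act0 scaler0.
  by rewrite scalerDr !actD IH IH' scalerDr.
by rewrite -tensZl !act_tens tensZl.
Qed.

Lemma act_addr z h k : act z (h + k) = act z h + act z k.
Proof.
elim/N_ind: z => [|z z' IH IH'|c g]; first by rewrite !act0 addr0.
  by rewrite !actD IH IH' addrACA.
by rewrite !act_tens mulrDr tensDr.
Qed.

Lemma act_scaler z a h : act z (a *: h) = a *: act z h.
Proof.
elim/N_ind: z => [|z z' IH IH'|c g]; first by rewrite !act0 scaler0.
  by rewrite !actD IH IH' scalerDr.
by rewrite !act_tens -scalerAr tensZr.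
Qed.

Lemma act0r z : act z 0 = 0.
Proof. by rewrite -(scale0r 0) act_scaler scale0r. Qed.

Lemma act_sumr (J : Type) (s : seq J) (P : pred J) (F : J -> hecke H) z :
  act z (\sum_(j <- s | P j) F j) = \sum_(j <- s | P j) act z (F j).
Proof. by apply: (big_morph (act z)) => [h k|]; rewrite ?act_addr ?act0r. Qed.

Lemma actM z h k : act (act z h) k = act z (h * k).
Proof.
elim/N_ind: z => [|z z' IH IH'|c g]; first by rewrite !act0.
  by rewrite !actD IH IH'.
by rewrite !act_tens mulrA.
Qed.

Lemma act1 z : act z 1 = z.
Proof.
elim/N_ind: z => [|z z' IH IH'|c g]; first by rewrite !act0.
  by rewrite !actD IH IH'.
by rewrite !act_tens mulr1.
Qed.

Lemma nbar_act z h : nbar (act z h) = act (nbar z) (hbar h).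
Proof.
elim/N_ind: z => [|z z' IH IH'|c g]; first by rewrite act0 nbar0 act0.
  by rewrite actD !nbarD actD IH IH'.
by rewrite act_tens !nbar_tens hbarM act_tens.
Qed.

Lemma nbarZ a z : nbar (a *: z) = lbar a *: nbar z.
Proof.
elim/N_ind: z => [|z z' IH IH'|c g]; first by rewrite scaler0 nbar0 scaler0.
  by rewrite scalerDr !nbarD IH IH' scalerDr.
by rewrite -tensZl !nbar_tens lbarM tensZl.
Qed.

Lemma nbarN z : nbar (- z) = - nbar z.
Proof. by rewrite -scaleN1r nbarZ lbarN lbar1 scaleN1r. Qed.

Lemma nbarMz z (k : int) : nbar (z *~ k) = nbar z *~ k.
Proof.
have pos (m : nat) : nbar (z *+ m) = nbar z *+ m.
  by elim: m => [|m IH]; rewrite ?nbar0 // !mulrS nbarD IH.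
by case: k => m; rewrite ?NegzE ?mulrNz -?pmulrn ?nbarN pos.
Qed.

Lemma nbar_sum (J : Type) (s : seq J) (P : pred J) (F : J -> N) :
  nbar (\sum_(j <- s | P j) F j) = \sum_(j <- s | P j) nbar (F j).
Proof. by apply: (big_morph (@nbar _ _ _ _ H)) => [z z'|]; rewrite ?nbarD ?nbar0. Qed.

Lemma len_id : len id = 0%N.
Proof. by apply/eqP; rewrite -leqn0; apply: (len_min l_gt0); exact: word_nil. Qed.

Lemma Hb_id : Hb H id = 1.
Proof.
have WI := Waff_id Phi l.
have [e _] := hbar_Hb H WI WI (erefl _).
have := Hb_mul H WI WI; rewrite /= !len_id addn0 => /(_ erefl) ee.
by rewrite -[LHS]mulr1 -e mulrA ee.
Qed.

Lemma hbar1 : hbar (1 : hecke H) = 1.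
Proof.
have WI := Waff_id Phi l; have [] := hbar_Hb H WI WI (erefl _).
by rewrite Hb_id mul1r.
Qed.

(** The Kazhdan-Lusztig generator [C_s], self-dual by [hbar_Cs]. *)
Definition Cs f : hecke H := Hb H (rf f) + v *: 1.

Lemma Hs_quad f : wall f -> Hb H (rf f) * Hb H (rf f) = 1 + (v' - v) *: Hb H (rf f).
Proof. by move=> wf; apply: Hb_quad; exact: simple_rf. Qed.

Lemma hbar_Hs f : wall f -> hbar (Hb H (rf f)) = Hb H (rf f) - (v' - v) *: 1.
Proof.
move=> wf; have ff := wall_fun wf; have Ws := Waff_rf l_gt0 ff.
have [e _] := hbar_Hb H Ws Ws (rf_comp_id ff).
have BA : (Hb H (rf f) - (v' - v) *: 1) * Hb H (rf f) = 1.
  by rewrite mulrBl Hs_quad // -scalerAl mul1r addrK.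
by rewrite -[LHS]mul1r -{1}BA -mulrA e mulr1.
Qed.

Lemma hbar_Cs f : wall f -> hbar (Cs f) = Cs f.
Proof.
move=> wf; rewrite /Cs hbarD hbarZ hbar1 hbar_Hs // vpow_bar.
by rewrite scalerBl opprB -addrA subrK.
Qed.

Definition act_Cs f z : N := act z (Cs f).

Lemma act_CsE f z : act_Cs f z = act z (Hb H (rf f)) + v *: z.
Proof. by rewrite /act_Cs /Cs act_addr act_scaler act1. Qed.

Lemma act_Cs_D f z z' : act_Cs f (z + z') = act_Cs f z + act_Cs f z'.
Proof. exact: actD. Qed.

Lemma act_Cs_Z f a z : act_Cs f (a *: z) = a *: act_Cs f z.
Proof. exact: actZ. Qed.

Lemma act_Cs_bar f z : wall f -> nbar z = z -> nbar (act_Cs f z) = act_Cs f z.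
Proof. by move=> wf e; rewrite /act_Cs nbar_act e hbar_Cs. Qed.

Lemma zmod_quad (A : zmodType) (e p q c : A) : e + (p - q) + q + c = c + (p + e).
Proof. by rewrite (addrA e) subrK (addrC e) [LHS]addrC. Qed.

Lemma CsCs f : wall f -> Cs f * Cs f = (v + v') *: Cs f.
Proof.
move=> wf; rewrite /Cs mulrDl mulrDr Hs_quad // -scalerAl mul1r -scalerAr mulr1.
rewrite scalerBl scalerDl !scalerDr !scalerA (mulrC v') vv' scale1r.
exact: zmod_quad.
Qed.

(** Outside of the chamber, [x s = t x] for a reflection [t] of the finite Weyl
    group, on which the sign representation takes the value [- v]. *)
Lemma act_out x f : Wf x -> wall f -> ~ Wf (x \o rf f) ->
  act (Nb H x) (Hb H (rf f)) = - v *: Nb H x.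
Proof.
move=> fx wf nx; have ff := wall_fun wf; have Wx := Wf_W fx.
have [i [e lt]] := Wf_out l_gt0 fx wf nx.
have ws := simple_wall Phi l i; have Ws := Waff_rf l_gt0 (wall_fun ws).
rewrite /Nb act_tens (Hb_mul H Wx (Waff_rf l_gt0 ff)); last first.
  by rewrite (len_wall l_gt0 wf) addn1; apply: len_up.
rewrite e -(Hb_mul H Ws Wx); last first.
  by rewrite -e (len_up l_gt0 Wx wf lt) (len_wall l_gt0 ws) add1n.
rewrite (tens_sign _ _ (simple_rf l_gt0 ws) (Wfin_simple Phi l i)) mul1r.
by rewrite tensE.
Qed.

Lemma act_up x f : Wf x -> wall f -> (len x < len (x \o rf f))%N ->
  act (Nb H x) (Hb H (rf f)) = Nb H (x \o rf f).
Proof.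
move=> fx wf lt; have ff := wall_fun wf; have Wx := Wf_W fx.
rewrite /Nb act_tens (Hb_mul H Wx (Waff_rf l_gt0 ff)) //.
by rewrite (len_wall l_gt0 wf) addn1; apply: len_up.
Qed.

Lemma act_down x f : Wf x -> wall f -> (len (x \o rf f) < len x)%N ->
  act (Nb H x) (Hb H (rf f)) = Nb H (x \o rf f) + (v' - v) *: Nb H x.
Proof.
move=> fx wf lt; have ff := wall_fun wf; have Wx := Wf_W fx.
have fxs := Wf_down l_gt0 fx wf lt.
have e : act (Nb H (x \o rf f)) (Hb H (rf f)) = Nb H x.
  by rewrite act_up ?(compA_rf x ff).
by rewrite -{1}e actM Hs_quad // act_addr act1 act_scaler e.
Qed.

Lemma act_Cs_out x f : Wf x -> wall f -> ~ Wf (x \o rf f) -> act_Cs f (Nb H x) = 0.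
Proof. by move=> fx wf nx; rewrite act_CsE act_out // scaleNr addNr. Qed.

Lemma act_Cs_up x f : Wf x -> wall f -> (len x < len (x \o rf f))%N ->
  act_Cs f (Nb H x) = Nb H (x \o rf f) + v *: Nb H x.
Proof. by move=> fx wf lt; rewrite act_CsE act_up. Qed.

Lemma act_Cs_down x f : Wf x -> wall f -> (len (x \o rf f) < len x)%N ->
  act_Cs f (Nb H x) = Nb H (x \o rf f) + v' *: Nb H x.
Proof. by move=> fx wf lt; rewrite act_CsE act_down // -addrA -scalerDl subrK. Qed.

(** The coefficient of [N_x] in [N_x C_s], according to the direction of the
    step. *)
Definition step_coef x f : laurent := if (len (x \o rf f) < len x)%N then v' else v.

Lemma act_Cs_in x f : Wf x -> wall f -> Wf (x \o rf f) ->
  act_Cs f (Nb H x) = Nb H (x \o rf f) + step_coef x f *: Nb H x.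
Proof.
move=> fx wf fxs; rewrite /step_coef; case: ifP => lt; first exact: act_Cs_down.
by apply: act_Cs_up => //; have [|//] := len_right_cases l_gt0 (Wf_W fx) wf; rewrite lt.
Qed.

Lemma cfN_D x z z' : cf x (z + z') = cf x z + cf x z'.
Proof. exact: (cfD N_basis). Qed.

Lemma cfN_Z x a z : cf x (a *: z) = a * cf x z.
Proof. exact: (cfZ N_basis). Qed.

Lemma cfN_B x z z' : cf x (z - z') = cf x z - cf x z'.
Proof. exact: (cfB N_basis). Qed.

Lemma cfN_Mz x z (k : int) : cf x (z *~ k) = cf x z *~ k.
Proof. exact: (cfMz N_basis). Qed.

Lemma cfN_sum x (J : Type) (s : seq J) (P : pred J) (F : J -> N) :
  cf x (\sum_(j <- s | P j) F j) = \sum_(j <- s | P j) cf x (F j).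
Proof. exact: (cf_sum N_basis). Qed.

Lemma cfN_0 x : cf x 0 = 0.
Proof. exact: (cf0 N_basis). Qed.

Lemma cf_Nb x y : Wf y -> cf x (Nb H y) = (y == x)%:R.
Proof. exact: (cf_basis N_basis). Qed.

Lemma cf_nf x z : ~ Wf x -> cf x z = 0.
Proof. exact: (cf_out N_basis). Qed.

(** The coefficient at [x] of [z C_s] involves only the coefficients of [z] at
    [x] and [x s]. *)
Lemma cf_act_Cs x f z : Wf x -> wall f -> Wf (x \o rf f) ->
  cf x (act_Cs f z) = cf (x \o rf f) z + step_coef x f * cf x z.
Proof.
move=> fx wf fxs; have ff := wall_fun wf.
elim/(basis_ind N_basis): z => [|z z' IH IH'|a y fy].
- by rewrite /act_Cs act0 !cfN_0 mulr0 addr0.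
- by rewrite act_Cs_D !cfN_D IH IH' mulrDr addrACA.
rewrite act_Cs_Z !cfN_Z mulrCA -mulrDr; congr (_ * _).
have sw : (y == x \o rf f) = (y \o rf f == x).
  apply/eqP/eqP => [->|<-]; first exact: (compA_rf x ff).
  by rewrite (compA_rf y ff).
rewrite !cf_Nb // sw; have [fys|nys] := pselect (Wf (y \o rf f)).
  rewrite (act_Cs_in fy wf fys) cfN_D cfN_Z (cf_Nb _ fys) (cf_Nb _ fy).
  by have [->|_] := eqVneq y x; rewrite ?mulr0.
rewrite act_Cs_out // cfN_0; case: eqVneq => [e|_]; first by case: nys; rewrite e.
by case: eqVneq => [e|_]; [case: nys; rewrite e|rewrite mulr0 addr0].
Qed.

Lemma cf_act_Cs_out x f z : Wf x -> wall f -> ~ Wf (x \o rf f) -> cf x (act_Cs f z) = 0.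
Proof.
move=> fx wf nxs; have ff := wall_fun wf.
elim/(basis_ind N_basis): z => [|z z' IH IH'|a y fy].
- by rewrite /act_Cs act0 cfN_0.
- by rewrite act_Cs_D cfN_D IH IH' addr0.
rewrite act_Cs_Z cfN_Z; have [fys|nys] := pselect (Wf (y \o rf f)); last first.
  by rewrite act_Cs_out // cfN_0 mulr0.
rewrite act_Cs_in // cfN_D cfN_Z !cf_Nb //; case: eqVneq => [e|_].
  by case: nxs; rewrite -e (compA_rf y ff).
by case: eqVneq => [e|_]; [case: nxs; rewrite -e|rewrite mulr0 add0r mulr0].
Qed.

(** * Elements invariant under a simple reflection *)

(** Eigenvectors of [C_s]. For the eigenvalue [v + v^-1] they are the elements
    [z' C_s] up to scalars, since [C_s^2 = (v + v^-1) C_s]. *)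
Definition spherical f z := act_Cs f z = (v + v') *: z.

Lemma vv'_neq0 : v + v' != 0.
Proof.
have := @vpow_sum_neq0 _ [:: 1; -1] id 1; rewrite mem_head => /(_ isT).
by rewrite big_cons big_seq1.
Qed.

Lemma sph_out x f z : Wf x -> wall f -> ~ Wf (x \o rf f) -> spherical f z -> cf x z = 0.
Proof.
move=> fx wf nxs; rewrite /spherical => e; have := cf_act_Cs_out z fx wf nxs.
by rewrite e cfN_Z => /laurent_mulf_eq0; apply; exact: vv'_neq0.
Qed.

(** Compare the coefficients at [x] of both sides. *)
Lemma sph_down x f z : Wf x -> wall f -> spherical f z -> (len (x \o rf f) < len x)%N ->
  cf (x \o rf f) z = v * cf x z.
Proof.
move=> fx wf e lt; have fxs := Wf_down l_gt0 fx wf lt.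
have := cf_act_Cs z fx wf fxs; rewrite e cfN_Z /step_coef lt mulrDl => /addIr.
by move=> ->.
Qed.

Lemma sph_act_Cs f z : wall f -> spherical f (act_Cs f z).
Proof. by move=> wf; rewrite /spherical /act_Cs actM CsCs // act_scaler. Qed.

Lemma sphD f z z' : spherical f z -> spherical f z' -> spherical f (z + z').
Proof. by rewrite /spherical act_Cs_D scalerDr => -> ->. Qed.

Lemma sphZ f a z : spherical f z -> spherical f (a *: z).
Proof. by rewrite /spherical act_Cs_Z scalerA mulrC -scalerA => ->. Qed.

Lemma sphMz f z (k : int) : spherical f z -> spherical f (z *~ k).
Proof. by rewrite -scaler_int; exact: sphZ. Qed.

Lemma sph0 f : spherical f 0.
Proof. by rewrite /spherical /act_Cs act0 scaler0. Qed.

(** * Triangularity of the bar involution *)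

Lemma right_descent x : W x -> x <> id ->
  exists2 f, wall f & (len (x \o rf f) < len x)%N.
Proof.
move=> Wx xid; have [x' [Wx' xx' x'x]] := Waff_inv l_gt0 Wx.
have x'id : x' <> id by move=> e; apply: xid; rewrite -xx' e.
have [f wf fx'] := descent l_gt0 Wx' x'id; exists f => //.
have ff := wall_fun wf; have gf := aff_root_W ff Wx'.
have e : (f \o x') \o x = f.
  by apply/funext => p /=; have /= -> := congr1 (@^~ p) x'x.
have E := rf_W gf Wx; rewrite e in E; rewrite -E -(rfN gf).
apply: (len_refl_lt l_gt0 Wx (aff_rootN gf)); first by rewrite oppr_gt0.
have /= -> := congr1 (@^~ a0) e; rewrite oppr_lt0; exact: wall_gt0.
Qed.

Lemma nbar_Nid : nbar (Nb H id) = Nb H id.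
Proof. by rewrite /Nb nbar_tens lbar1 Hb_id hbar1. Qed.

Lemma cf_act_Cs_neq0 x f z : wall f -> cf x (act_Cs f z) != 0 ->
  Wf x /\ (cf x z != 0 \/ cf (x \o rf f) z != 0).
Proof.
move=> wf; have [fx|nx] := pselect (Wf x); last by rewrite cf_nf ?eqxx.
have [fxs|nxs] := pselect (Wf (x \o rf f)); last by rewrite cf_act_Cs_out ?eqxx.
rewrite cf_act_Cs // => h; split=> //; have [e|] := eqVneq (cf x z) 0; last by left.
by right; apply: contra_neq h => ->; rewrite e mulr0 addr0.
Qed.

Lemma zmod_bar (A : zmodType) (c d p q r : A) :
  (c + d) - (p + q) - (c - r) = d - q + (r - p).
Proof.
rewrite opprB -[c + d + _]addrA [LHS]addrC [LHS]addrA subrK opprD addrCA -[RHS]addrA.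
by congr (_ + _); rewrite addrA addrC.
Qed.

(** Triangularity of the bar involution with respect to the length, by induction
    along a reduced expression: [N_x = N_(x s) C_s - v N_(x s)] and [C_s] is
    self-dual. *)
Lemma bar_tri x : Wf x ->
  forall y, cf y (nbar (Nb H x) - Nb H x) != 0 -> (len y < len x)%N.
Proof.
have [k] := ubnP (len x); elim: k x => // k IH x lk fx y.
have [->|xid] := pselect (x = id); first by rewrite nbar_Nid subrr cfN_0 eqxx.
have [f wf lt] := right_descent (Wf_W fx) xid; have ff := wall_fun wf.
have fxs := Wf_down l_gt0 fx wf lt.
have xss : x \o rf f \o rf f = x by exact: (compA_rf x ff).
set x1 := x \o rf f in lt fxs xss *.
have xE : Nb H x = act_Cs f (Nb H x1) - v *: Nb H x1.
  by rewrite act_Cs_up ?xss // addrK.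
pose d := nbar (Nb H x1) - Nb H x1.
have dP u : cf u d != 0 -> (len u < len x1)%N.
  by apply: IH => //; exact: leq_trans lt _.
have dE : nbar (Nb H x1) = Nb H x1 + d by rewrite addrC subrK.
have -> : nbar (Nb H x) - Nb H x = act_Cs f d - v' *: d + (v - v') *: Nb H x1.
  rewrite xE nbarD nbarN nbarZ vpow_bar {1}/act_Cs nbar_act hbar_Cs // -/(act_Cs f _) dE.
  by rewrite act_Cs_D scalerDr scalerBl; exact: zmod_bar.
have l1 u : cf u d != 0 -> (len u < len x)%N by move=> /dP/ltn_trans; apply.
rewrite !cfN_D => h.
have [e1|/l1 //] := eqVneq (cf y d) 0.
have [e2|/(cf_act_Cs_neq0 wf)[_ [/l1 //|/dP h2]]] := eqVneq (cf y (act_Cs f d)) 0; last first.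
  have [fy|ny] := pselect (Wf y); last first.
    by move: h; rewrite !cf_nf // !addr0 eqxx.
  have := len_comp l_gt0 (Waff_rfr l_gt0 (Wf_W fy) ff) (Waff_rf l_gt0 ff).
  by rewrite (compA_rf y ff) (len_wall l_gt0 wf); lia.
move: h; rewrite e2 -scaleNr !cfN_Z e1 mulr0 !add0r cf_Nb //.
by have [<- //|_] := eqVneq x1 y; rewrite mulr0 eqxx.
Qed.

Definition suppN z : {fset (V -> V)} := msupp (basis_coord Wf (@Nb _ _ _ _ H) z).

Lemma suppNP x z : x \in suppN z = (cf x z != 0).
Proof. by rewrite mcoeff_neq0. Qed.

Lemma N_expand z : z = \sum_(y <- suppN z) cf y z *: Nb H y.
Proof. exact: (coordP N_basis z).2. Qed.

Lemma suppN_Wf z x : x \in suppN z -> Wf x.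
Proof. exact: (coordP N_basis z).1. Qed.

(** The coefficients of maximal length of a self-dual element are self-dual, by
    [bar_tri]. *)
Lemma self_dual_top z x : nbar z = z ->
  (forall y, cf y z != 0 -> (len y <= len x)%N) -> lbar (cf x z) = cf x z.
Proof.
move=> zb zx; have [fx|nx] := pselect (Wf x); last by rewrite cf_nf ?lbar0.
rewrite -[in RHS]zb [in RHS](N_expand z) nbar_sum cfN_sum.
have -> : \sum_(y <- suppN z) cf x (nbar (cf y z *: Nb H y)) =
    \sum_(y <- suppN z) lbar (cf y z) * (y == x)%:R.
  apply: eq_big_seq => y sy; rewrite nbarZ cfN_Z; congr (_ * _).
  have fy := suppN_Wf sy; apply/eqP; rewrite -(cf_Nb _ fy) -subr_eq0.
  have -> : cf x (nbar (Nb H y)) - cf x (Nb H y) = cf x (nbar (Nb H y) - Nb H y).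
    by rewrite cfN_B.
  apply: contraTT sy => /(bar_tri fy) lt; rewrite suppNP negbK.
  by apply: contraTT lt => /zx; rewrite -leqNgt.
have [sx|nsx] := boolP (x \in suppN z).
  rewrite (bigD1_seq x) ?fset_uniq //= eqxx mulr1 big1 ?addr0 // => y /negbTE ->.
  by rewrite mulr0.
have -> : cf x z = 0 by apply/eqP; rewrite -[_ == _]negbK -suppNP.
rewrite lbar0 big1_seq // => y /= sy; have [yx|_] := eqVneq y x; last by rewrite mulr0.
by rewrite -yx sy in nsx.
Qed.

(** A coefficient of maximal length would be a bar invariant element of [v
    Z[v]]. *)
Lemma self_dual_zero z : nbar z = z -> (forall y, in_vZv (cf y z)) -> z = 0.
Proof.
move=> zb zv; apply: (cf_ext N_basis) => u; rewrite (cf0 N_basis) -/(cf u z).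
have [s0|/(seq_max (fun x => len x))[x sx xP]] := eqVneq (suppN z : seq _) [::].
  have : u \notin (suppN z : seq _) by rewrite s0.
  by rewrite suppNP negbK => /eqP.
have := sx; rewrite suppNP => /eqP[].
apply: low1_bar; first exact/vZvE/zv.
by apply: self_dual_top => // y; rewrite -suppNP; exact: xP.
Qed.

(** * The canonical basis *)

(** The properties that define the canonical element, in terms of
    coefficients. *)
Definition canonical_spec x z := [/\ nbar z = z, cf x z = 1 &
  forall y, y != x -> cf y z != 0 -> bruhat_lt Phi l y x /\ in_vZv (cf y z)].

Lemma canonical_spec_uniq x z z' : canonical_spec x z -> canonical_spec x z' -> z = z'.
Proof.
move=> [b1 x1 y1] [b2 x2 y2]; apply/eqP; rewrite -subr_eq0; apply/eqP.
apply: self_dual_zero; first by rewrite nbarD nbarN b1 b2.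
move=> y; rewrite cfN_B; apply/vZvE.
have [->|yx] := eqVneq y x; first by rewrite x1 x2 subrr; exact: low0.
apply: lowD; last apply: lowN.
  have [->|h] := eqVneq (cf y z) 0; first exact: low0.
  by apply/vZvE; case: (y1 _ yx h).
have [->|h] := eqVneq (cf y z') 0; first exact: low0.
by apply/vZvE; case: (y2 _ yx h).
Qed.

(** The right descents of [x] are the walls for which the canonical element at
    [x] is spherical. *)
Definition down_spherical x z := forall f, wall f -> (len (x \o rf f) < len x)%N -> spherical f z.

Lemma blt_len y x : bruhat_lt Phi l y x -> (len y < len x)%N.
Proof. by move=> [/bruhat_len[]]. Qed.

Lemma ble_lt_trans y x w : bruhat_le Phi l y x -> bruhat_lt Phi l x w ->
  bruhat_lt Phi l y w.
Proof.
move=> yx xw; have lt := blt_len xw; split; first exact: (bruhat_trans yx xw.1).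
by move=> e; move: lt; rewrite -e ltnNge (bruhat_len_le yx).
Qed.

(** The inductive construction of canonical elements. If [x s < x], the element
    [N_(x s) C_s], formed with the canonical element at [x s], is self-dual with
    leading coefficient [1], and its other coefficients lie in [Z[v]]. The
    integer multiples of smaller canonical elements that remove the constant
    terms occur only at alcoves [y] with [y s < y], whose canonical elements are
    spherical for [s] by induction. *)
Lemma canonical_step x f : Wf x -> wall f -> (len (x \o rf f) < len x)%N ->
  (forall y, Wf y -> (len y < len x)%N -> exists z, canonical_spec y z /\ down_spherical y z) ->
  exists z, canonical_spec x z /\ spherical f z.
Proof.
move=> fx wf lt IH; have ff := wall_fun wf; have Wx := Wf_W fx.
have fxs := Wf_down l_gt0 fx wf lt; have Wxs := Wf_W fxs.
have xss : x \o rf f \o rf f = x by exact: (compA_rf x ff).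
pose Z y : N := xget 0 [set z | canonical_spec y z /\ down_spherical y z].
have ZP y : Wf y -> (len y < len x)%N -> canonical_spec y (Z y) /\ down_spherical y (Z y).
  by move=> fy ly; have := xgetPex 0 (IH _ fy ly).
have [[b1 c1 l1] _] := ZP _ fxs lt.
set z0 := Z (x \o rf f) in b1 c1 l1.
pose z1 := act_Cs f z0.
have xsle := bruhat_down l_gt0 Wx wf lt.
have xslt : bruhat_lt Phi l (x \o rf f) x.
  by split=> // e; move: lt; rewrite e ltnn.
have z0P y : cf y z0 != 0 -> bruhat_le Phi l y (x \o rf f).
  have [-> _|yx /(l1 _ yx)[[]//]] := eqVneq y (x \o rf f); exact: bruhat_refl.
have z0x : cf x z0 = 0.
  apply/eqP; apply: contraT => /z0P/bruhat_len_le.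
  by rewrite leqNgt lt.
have z1x : cf x z1 = 1.
  by rewrite /z1 cf_act_Cs // c1 z0x mulr0 addr0.
(* The lifting property bounds the support. A factor [v^-1] only occurs at [y]
   with [y s < y], where the coefficient of [z0] is in [v Z[v]] since [y] is not
   [x s]. *)
have z1P y : y != x -> cf y z1 != 0 -> [/\ bruhat_lt Phi l y x, low 0 (cf y z1) &
    mcoeff 0 (cf y z1) != 0 -> (len (y \o rf f) < len y)%N].
  move=> yx h; have [fy h'] := cf_act_Cs_neq0 wf h; have Wy := Wf_W fy.
  have le : bruhat_le Phi l y x.
    case: h' => /z0P h'; first exact: (bruhat_trans h').
    have Wys := Waff_rfr l_gt0 Wy ff; rewrite -[y](compA_rf y ff).
    by apply: (bruhat_lift_down l_gt0 Wys Wx wf (bruhat_trans h' xsle) lt).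
  have fys : Wf (y \o rf f).
    by apply: contrapT => nys; move: h; rewrite cf_act_Cs_out ?eqxx.
  have ysx : y \o rf f != x \o rf f.
    apply: contraNneq yx => e; rewrite -[y](compA_rf y ff) e.
    by rewrite xss.
  have low_ys : low 1 (cf (y \o rf f) z0).
    have [->|h1] := eqVneq (cf (y \o rf f) z0) 0; first exact: low0.
    by apply/vZvE; case: (l1 _ ysx h1).
  have low_y : low 0 (cf y z0).
    have [->|yxs] := eqVneq y (x \o rf f); first by rewrite c1; exact: low_1.
    have [->|h1] := eqVneq (cf y z0) 0; first exact: low0.
    by apply: (@lowW 1) => //; apply/vZvE; case: (l1 _ yxs h1).
  have ltx : bruhat_lt Phi l y x by split=> // /eqP; rewrite (negbTE yx).
  rewrite /z1 cf_act_Cs // /step_coef; case: ifP => lty; split=> //.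
    apply: lowD; first exact: (lowW _ low_ys).
    have [->|h1] := eqVneq (cf y z0) 0; first by rewrite mulr0; exact: low0.
    have [yxs|yxs] := eqVneq y (x \o rf f).
      by move: lty; rewrite yxs xss ltnNge ltnW.
    by apply: (@low_vpow 1 (-1)); apply/vZvE; case: (l1 _ yxs h1).
  - apply: (@lowW 1) => //; apply: lowD => //.
    exact: (@low_vpow 0 1).
  - have lo : low 1 (cf (y \o rf f) z0 + v * cf y z0).
      by apply: lowD => //; exact: (@low_vpow 0 1).
    by move=> /lo.
(* The constant terms to be removed. *)
pose e y : int := mcoeff 0 (cf y z1).
pose s := [seq y <- suppN z1 | y != x].
have sP y : y \in s -> [/\ y != x, bruhat_lt Phi l y x, low 0 (cf y z1),
    e y != 0 -> (len (y \o rf f) < len y)%N & canonical_spec y (Z y) /\ down_spherical y (Z y)].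
  rewrite mem_filter suppNP => /andP[yx h]; have [lt1 lo dn] := z1P _ yx h.
  split=> //; apply: ZP; last exact: blt_len.
  by apply: contrapT => ny; move: h; rewrite cf_nf ?eqxx.
pose z := z1 - \sum_(y <- s) Z y *~ e y.
have cfz u : cf u z = cf u z1 - \sum_(y <- s) cf u (Z y) *~ e y.
  rewrite cfN_B cfN_sum; congr (_ - _); apply: eq_bigr => y _; exact: cfN_Mz.
have ZxP y u : y \in s -> cf u (Z y) != 0 -> bruhat_lt Phi l u x.
  move=> /sP[_ lt1 _ _ [[_ _ yl] _]] h.
  have [->|uy] := eqVneq u y; first exact: lt1.
  have [[uy' _] _] := yl _ uy h; exact: (ble_lt_trans uy' lt1).
have Zlow y u : y \in s -> u != y -> low 1 (cf u (Z y) *~ e y).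
  move=> /sP[_ lt1 _ _ [[_ _ yl] _]] uy; apply: lowMz.
  have [->|h] := eqVneq (cf u (Z y)) 0; first exact: low0.
  by apply/vZvE; case: (yl _ uy h).
exists z; split; first split.
- rewrite nbarD nbarN act_Cs_bar // nbar_sum; congr (_ - _).
  by apply: eq_big_seq => y /sP[_ _ _ _ [[yb _ _] _]]; rewrite nbarMz yb.
- rewrite cfz z1x big1_seq ?subr0 // => y /= sy.
  have [->|h] := eqVneq (cf x (Z y)) 0; first by rewrite mul0rz.
  by have [_] := ZxP _ _ sy h.
- move=> u ux h; split.
    have [e0|h1] := eqVneq (cf u z1) 0; last by case: (z1P _ ux h1).
    apply: contrapT => nlt; move: h; rewrite cfz e0 big1_seq ?subrr ?eqxx // => y /= sy.
    have [->|h2] := eqVneq (cf u (Z y)) 0; first by rewrite mul0rz.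
    by case: nlt; exact: ZxP h2.
  apply/vZvE; rewrite cfz; have [us|nus] := boolP (u \in s).
    have [_ _ lou _ [[_ cu _] _]] := sP _ us.
    rewrite (bigD1_seq u) ?filter_uniq ?fset_uniq //= cu opprD addrA.
    apply: lowD; first exact: low_sub0.
    apply: lowN; rewrite big_seq_cond; apply: low_sum => y /andP[sy yu].
    by apply: Zlow => //; rewrite eq_sym.
  have -> : cf u z1 = 0.
    apply/eqP; rewrite -[_ == _]negbK -suppNP; apply: contra nus.
    by rewrite mem_filter ux.
  rewrite add0r; apply: lowN; rewrite big_seq; apply: low_sum => y sy.
  by apply: Zlow => //; apply: contraNneq nus => ->.
- apply: sphD; first exact: sph_act_Cs.
  rewrite -scaleN1r; apply: sphZ; rewrite big_seq; apply: big_ind.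
  + exact: sph0.
  + by move=> *; exact: sphD.
  + move=> y /sP[_ _ _ dn [_ ds]]; have [->|h] := eqVneq (e y) 0.
      by rewrite mulr0z; exact: sph0.
    by apply: sphMz; apply: ds => //; exact: dn.
Qed.

(** The elements constructed from the various descents of [x] coincide by
    uniqueness, so that the canonical element is spherical for all of them. *)
Lemma canonical_exists x : Wf x -> exists z, canonical_spec x z /\ down_spherical x z.
Proof.
have [k] := ubnP (len x); elim: k x => // k IH x lk fx.
have IH' y : Wf y -> (len y < len x)%N -> exists z, canonical_spec y z /\ down_spherical y z.
  by move=> fy ly; apply: IH => //; exact: leq_trans ly lk.
have [->|xid] := pselect (x = id).
  exists (Nb H id); split.
    split; first exact: nbar_Nid.
      by rewrite cf_Nb ?eqxx //; exact: Wf_id.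
    move=> y yid; rewrite cf_Nb; last exact: Wf_id.
    by rewrite (eq_sym (id : V -> V)) (negbTE yid) eqxx.
  by move=> f _; rewrite len_id.
have [f wf lt] := right_descent (Wf_W fx) xid.
have [z [zx _]] := canonical_step fx wf lt IH'.
exists z; split=> // g wg ltg; have [z' [zx' sg]] := canonical_step fx wg ltg IH'.
by rewrite (canonical_spec_uniq zx zx').
Qed.

Lemma cf_lead x u (c : {malg laurent[V -> V]}) : Wf x ->
  (forall y, y \in msupp c -> Wf y) ->
  cf u (Nb H x + \sum_(y <- msupp c) mcoeff y c *: Nb H y) =
  (x == u)%:R + mcoeff u c.
Proof.
move=> fx cW; rewrite cfN_D cf_Nb // cfN_sum -(mcoeff_pick c u); congr (_ + _).
by apply: eq_big_seq => y /cW fy; rewrite cfN_Z cf_Nb // mulr_natr.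
Qed.

Lemma is_canonicalP x z : Wf x -> is_canonical x z <-> canonical_spec x z.
Proof.
move=> fx; split=> [[zb [c [cP zE]]]|[zb zx zl]].
  have cW y : y \in msupp c -> Wf y by move=> /cP[].
  have zc u : cf u z = (x == u)%:R + mcoeff u c by rewrite zE cf_lead.
  split=> // [|y yx]; rewrite zc.
    rewrite eqxx mcoeff_outdom ?addr0 //.
    by apply/negP => /cP[_ [_]].
  by rewrite [x == y]eq_sym (negbTE yx) add0r mcoeff_neq0 => /cP[].
split=> //; pose c : {malg laurent[V -> V]} :=
  basis_coord Wf (@Nb _ _ _ _ H) z - mkmalgU x 1.
have cE u : mcoeff u c = cf u z - (x == u)%:R.
  by rewrite /c mcoeffB mcoeffU.
have cP y : y \in msupp c -> y != x /\ cf y z != 0.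
  rewrite -mcoeff_neq0 cE; have [->|yx] := eqVneq y x.
    by rewrite zx /= subrr eqxx.
  by rewrite subr0.
exists c; split=> [y /cP[yx h]|].
  have [ylt yv] := zl _ yx h.
  split=> //; last by rewrite cE [x == y]eq_sym (negbTE yx) subr0.
  by apply: contrapT => ny; move: h; rewrite cf_nf ?eqxx.
apply: (cf_ext N_basis) => u; rewrite -/(cf u z) -/(cf u _) cf_lead //.
  by rewrite cE addrC subrK.
move=> y /cP[_ h]; by apply: contrapT => ny; move: h; rewrite cf_nf ?eqxx.
Qed.

Lemma canonicalP x : Wf x -> canonical_spec x (canonical H x) /\ down_spherical x (canonical H x).
Proof.
move=> fx; have [z [zx zs]] := canonical_exists fx.
have cx : canonical_spec x (canonical H x).
  apply/(is_canonicalP _ fx).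
  suff : [set z' | is_canonical x z'] (canonical H x) by [].
  by apply: xgetPex; exists z; apply/(is_canonicalP _ fx).
by rewrite (canonical_spec_uniq cx zx).
Qed.

End Module.

(** * Facets and alcoves in terms of affine roots *)

Section Cells.
Context {R : realType} {n : nat} (Phi : rootSystem R n) (l : nat).
Context (l_gt0 : (0 < l)%N).
Local Notation V := 'rV[R]_n.
Local Notation aff_root := (aff_root Phi l).
Local Notation wall := (wall Phi l).
Local Notation spec := (spec Phi l).
Local Notation cell := (cell Phi l).
Local Notation a0 := (base Phi l).
Local Notation W := (Waff Phi l).
Local Notation Wf := (Wf Phi l).
Local Notation top := (top Phi l).
Local Notation pos_roots := (pos_roots Phi).
Implicit Types (x y z w : V -> V) (p q r : V) (f : V -> R) (m k : int) (F A : set V).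

Lemma facet_spec (b : V -> bool) (mm : V -> int) p q :
  (forall a, a \in pos_roots -> if b a then dot p a = lmul l (mm a)
    else lmul l (mm a) < dot p a < lmul l (mm a + 1)) ->
  (forall a, a \in pos_roots -> if b a then dot q a = lmul l (mm a)
    else lmul l (mm a) < dot q a < lmul l (mm a + 1)) -> spec p q.
Proof.
move=> hp hq; apply: pos_fun => a k pa.
  rewrite !evP; have := hp _ pa; have := hq _ pa; case: ifP => _ => [-> -> //|].
  move=> /andP[h1 h2] /andP[h3 h4] h; apply: le_lt_trans h1.
  rewrite ler_lmul //; have : lmul l k < lmul l (mm a + 1) :> R by exact: lt_trans h4.
  by rewrite ltr_lmul //; lia.
rewrite !oppr_gt0 !ev_lt0; have := hp _ pa; have := hq _ pa; case: ifP => _ => [-> -> //|].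
move=> /andP[h1 h2] /andP[h3 h4] h; apply: (lt_le_trans h2).
rewrite ler_lmul //; have : lmul l (mm a) < lmul l k :> R by exact: lt_trans h.
by rewrite ltr_lmul //; lia.
Qed.

(** A facet is determined by the signs of the affine roots at any of its
    points. *)
Lemma facet_cell F p : is_facet Phi l F -> F p -> F = cell p.
Proof.
move=> [_ [b [mm ->]]] Fp; apply/seteqP; split=> q.
  by move=> Fq; split; apply: (facet_spec (b := b) (mm := mm)).
move=> [qp pq] a pa; have fa m := aff_root_ev l m (pos_root_root pa).
have := Fp a pa; case: ifP => _.
  by move=> /ev_eq0/(spec_eq0 qp (fa _))/ev_eq0.
rewrite -!evP -ev_lt0 => /andP[/(pq _ (fa _)) -> /=].
by rewrite -oppr_gt0 => /(pq _ (aff_rootN (fa _))); rewrite oppr_gt0 ev_lt0.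
Qed.

Lemma cell_facet p : is_facet Phi l (cell p).
Proof.
split; first by exists p; exact: cell_refl.
pose b a := hyp_at l p a; pose mm a : int := Num.floor (dot p a / l%:R).
have lR := lR_gt0 (R := R) l_gt0.
exists b, mm; set G := [set x | _].
have Gp : G p.
  move=> a pa; rewrite /b /mm; case: ifP => [/asboolP[m am]|nh].
    by rewrite am /lmul mulfK ?gt_eqF // intrKfloor.
  have := floor_itv (dot p a / l%:R); rewrite ler_pdivlMr // ltr_pdivrMr //.
  rewrite /lmul => /andP[h1 ->]; rewrite andbT lt_neqAle h1 andbT.
  apply: contraFneq nh => e; apply/asboolP; exists (Num.floor (dot p a / l%:R)).
  by rewrite /lmul e.
apply/esym/facet_cell => //; split; first by exists p.
by exists b, mm.
Qed.

Lemma facetE p : facet Phi l p = cell p.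
Proof.
apply: xget_unique; first by split; [exact: cell_facet|exact: cell_refl].
by move=> F [FF Fp]; exact: facet_cell.
Qed.

Lemma neg_countE p q : neg_count Phi l (facet Phi l p) (facet Phi l q) = negc Phi l p q.
Proof.
rewrite !facetE; apply: eq_in_count => a pa; apply: asbool_equiv_eq.
have fa m := aff_root_ev l m (pos_root_root pa).
split=> -[m [h1 h2]]; exists m; split.
- exact: h1 (cell_refl Phi l p).
- exact: h2 (cell_refl Phi l q).
- by move=> z [zp _]; apply/ev_eq0/(spec_eq0 zp (fa m))/ev_eq0.
- move=> z [_ qz]; rewrite /neg_side /= -ev_lt0 -oppr_gt0.
  by apply: (qz _ (aff_rootN (fa m))); rewrite oppr_gt0 ev_lt0.
Qed.

Lemma pos_countE p q : pos_count Phi l (facet Phi l p) (facet Phi l q) = posc Phi l p q.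
Proof.
rewrite !facetE; apply: eq_in_count => a pa; apply: asbool_equiv_eq.
have fa m := aff_root_ev l m (pos_root_root pa).
split=> -[m [h1 h2]]; exists m; split.
- exact: h1 (cell_refl Phi l p).
- exact: h2 (cell_refl Phi l q).
- by move=> z [zp _]; apply/ev_eq0/(spec_eq0 zp (fa m))/ev_eq0.
- move=> z [_ qz]; rewrite /pos_side /= -evP.
  by apply: (qz _ (fa m)); rewrite evP.
Qed.

Definition regular p := forall f, aff_root f -> f p != 0.

Lemma arrangementP p : (~` arrangement Phi l) p <-> regular p.
Proof.
split=> [np|pr [a [m [pa ap]]]]; last first.
  have := pr _ (aff_root_ev l m (pos_root_root pa)).
  by rewrite (iffRL (ev_eq0 _ _ _ _) ap) eqxx.
have key a m : a \in pos_roots -> ev l a m p != 0.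
  move=> pa; apply/eqP => /ev_eq0 h; apply: np; by exists a, m.
by apply: pos_fun => a m pa; rewrite ?oppr_eq0; exact: key.
Qed.

Lemma line_continuous p q : continuous (fun t : R => p + t *: (q - p)).
Proof.
move=> t B /nbhs_ballP[e /= e0 eB].
have [M M0 MP] := @seq_ub R _ (index_enum 'I_n) (fun i => `|(q - p) 0 i|).
apply/nbhs_ballP; exists (e / (2 * M)) => /=; first by rewrite divr_gt0 // mulr_gt0.
move=> s; rewrite /ball /= => ts; apply: eB; split=> // i j; rewrite !ord1 /ball /= !mxE.
rewrite opprD addrACA subrr add0r -mulrBl normrM.
have := MP j (mem_index_enum j); rewrite !mxE => h.
have := ler_pM (normr_ge0 _) (normr_ge0 _) (ltW ts) h.
have -> : e / (2 * M) * M = e / 2 by field; lra.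
by lra.
Qed.

Lemma same_sign (C : set V) p q f : connected C -> C p -> C q -> aff_root f ->
  (forall r, C r -> f r != 0) -> 0 < f p -> 0 < f q.
Proof.
move=> cC Cp Cq ff fC fp.
have /connected_intervalP iI : connected (f @` C).
  apply: connected_continuous_connected => //; apply: continuous_subspaceT.
  exact: aff_root_continuous ff.
rewrite ltNge; apply/negP => fq.
have [] := iI (f q) (f p) _ _ 0; [by exists q|by exists p|by rewrite fq ltW|].
by move=> r Cr fr; have := fC _ Cr; rewrite fr eqxx.
Qed.

(** An affine root cannot change sign on a connected set where it does not
    vanish, and points with the same signs are joined by a segment. *)
Lemma component_cell p : regular p ->
  connected_component (~` arrangement Phi l) p = cell p.
Proof.
move=> pr; apply/seteqP; split=> q.
  move=> [C [Cp CA cC] Cq].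
  by split=> f ff; apply: (same_sign cC) => // r /CA/arrangementP/(_ _ ff).
move=> [qp pq]; have sub : [set p + t *: (q - p) | t in `[0, 1]] `<=` cell p.
  move=> _ [t /= + <-]; rewrite in_itv /= => /andP[t0 t1].
  split=> f ff; rewrite (aff_root_line _ _ _ ff) => h; last first.
    by have := pq _ ff h; nra.
  have [//|fp] := ltP 0 (f p); have : f p < 0 by rewrite lt_neqAle fp pr.
  rewrite -oppr_gt0 => h1; have := pq _ (aff_rootN ff) h1; nra.
apply: (@connected_component_max _ _ [set p + t *: (q - p) | t in `[0, 1]]).
- by exists 0; rewrite ?scale0r ?addr0 //= in_itv /= lexx ler01.
- move=> r /sub [rp pr']; apply/arrangementP => f ff; have := pr _ ff.
  by apply: contra_neq => fr; exact: (spec_eq0 pr' ff fr).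
- apply: connected_continuous_connected; first exact: segment_connected.
  by apply: continuous_subspaceT; exact: line_continuous.
- exists 1; last by rewrite scale1r addrC subrK.
  by rewrite /= in_itv /= lexx ler01.
Qed.

Lemma Wbase_regular w : W w -> regular (w a0).
Proof. by move=> Ww f ff; exact: (Wbase_neq0 l_gt0 ff Ww). Qed.

Lemma is_alcoveP A : is_alcove Phi l A <-> exists2 w, W w & A = cell (w a0).
Proof.
split=> [[p /arrangementP pr ->]|[w Ww ->]].
  have [w [Ww h1 h2]] := regular_alcove l_gt0 pr.
  exists w => //; rewrite component_cell //; exact: cell_eq.
exists (w a0); first exact/arrangementP/Wbase_regular.
by rewrite component_cell //; exact: Wbase_regular.
Qed.

Lemma alcove_plusE p : alcove_plus Phi l (facet Phi l p) = cell (top p a0).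
Proof.
rewrite facetE; have [Wt pt tP] := topP Phi l_gt0 p.
apply: xget_unique.
  split; first by apply/is_alcoveP; exists (top p).
    by move=> q [qp _]; apply/(closure_cellP Phi l); exact: spec_trans pt.
  move=> a m pa pm q [_ tq]; have fa := aff_root_ev l m (pos_root_root pa).
  rewrite /pos_side /= -evP; apply: (tq _ fa); apply: tP => //.
  by apply/ev_eq0/pm/cell_refl.
move=> A [/is_alcoveP[w Ww ->] pw wP].
suff -> : w = top p by [].
apply: (is_top_uniq l_gt0 _ (topP Phi l_gt0 p)); split=> //.
  by apply/(closure_cellP Phi l)/pw/cell_refl.
move=> a m pa /ev_eq0 am; rewrite evP; apply: (wP a m pa) (cell_refl Phi l _).
move=> q [qp _]; have fa := aff_root_ev l m (pos_root_root pa).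
by apply/ev_eq0/(spec_eq0 qp fa)/ev_eq0.
Qed.

Lemma W_cell w p : W w -> w @` cell p = cell (w p).
Proof.
move=> Ww; have [w' [Ww' e e']] := Waff_inv l_gt0 Ww.
apply/seteqP; split=> [_ [q [qp pq] <-]|q [qp pq]].
  by split; exact: spec_W.
exists (w' q); last by have /= -> := congr1 (@^~ q) e.
have pE : w' (w p) = p by have /= -> := congr1 (@^~ p) e'.
by split; [have := spec_W Ww' qp|have := spec_W Ww' pq]; rewrite pE.
Qed.

Lemma alcove_eltE w : Wf w -> alcove_elt Phi l (cell (w a0)) = w.
Proof.
move=> fw; have Ww := Wf_W fw; apply: xget_unique.
  by split=> //; rewrite -(cell_base Phi l_gt0) W_cell.
move=> x [fx]; have Wx := Wf_W fx; rewrite -(cell_base Phi l_gt0) W_cell // => e.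
apply: (regular_inj l_gt0 Wx Ww).
by have [] : cell (w a0) (x a0) by rewrite -e; exact: cell_refl.
Qed.

Lemma pt_alcove_elt p : chamber Phi (p + rho Phi) ->
  alcove_elt Phi l (pt_alcove Phi l p) = top (p + rho Phi).
Proof.
by move=> pC; rewrite /pt_alcove alcove_plusE alcove_eltE //; exact: top_Wf.
Qed.

Lemma cell_chamber p : cell p `<=` chamber Phi <-> chamber Phi p.
Proof.
split=> [|pC q [_ pq]]; first by apply; exact: cell_refl.
exact: chamber_spec pq pC.
Qed.

End Cells.

(** * The module of points *)

Section PointModule.
Context {R : realType} {n : nat} {Phi : rootSystem R n} {l : nat}.
Context (l_gt0 : (0 < l)%N) (H : heckeModule Phi l).
Local Notation V := 'rV[R]_n.
Local Notation spec := (spec Phi l).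
Local Notation a0 := (base Phi l).
Local Notation W := (Waff Phi l).
Local Notation Wf := (Wf Phi l).
Local Notation len := (cox_length Phi l).
Local Notation cf := (cf (H := H)).
Local Notation rho := (rho Phi).
Local Notation dominant := (dominant Phi).
Local Notation linked := (linked Phi l).
Local Notation pt_lt := (pt_lt Phi l).
Local Notation npt := (npoly_pt H).
Local Notation cpt := (canonical_pt H).
Local Notation M := {malg laurent[V]}.
Implicit Types (x y w : V -> V) (p q lam mu nu gam : V) (z : M) (c : laurent).

(** The element of the affine Weyl group that corresponds to the alcove
    [A_+(lam)]. *)
Definition ptop lam : V -> V := top Phi l (lam + rho).

Lemma ptop_Wf lam : dominant lam -> Wf (ptop lam).
Proof. exact: top_Wf. Qed.

Lemma base_pt q : exists p, spec p a0 /\ top Phi l q p = q.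
Proof.
have [Wt qt _] := topP Phi l_gt0 q; have [x [Wx e e']] := Waff_inv l_gt0 Wt.
exists (x q); split; last exact: (congr1 (@^~ q) e).
by have := spec_W Wx qt; have /= -> := congr1 (@^~ a0) e'.
Qed.

Lemma linkedP lam mu : linked lam mu <-> exists2 w, W w & lam + rho = w (mu + rho).
Proof.
by split=> -[w Ww e]; exists w => //; rewrite /wdot ?e ?subrK // -e addrK.
Qed.

Lemma linked_refl mu : linked mu mu.
Proof. by apply/linkedP; exists id => //; exact: Waff_id. Qed.

Lemma linked_trans mu lam nu : linked lam mu -> linked mu nu -> linked lam nu.
Proof.
move=> /linkedP[w Ww e] /linkedP[w' Ww' e']; apply/linkedP.
by exists (w \o w'); [exact: Waff_comp|rewrite e e'].
Qed.

Lemma ptop_orbit lam mu p : spec p a0 -> ptop mu p = mu + rho -> linked lam mu ->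
  ptop lam p = lam + rho.
Proof.
move=> pa mp /linkedP[w Ww e]; rewrite /ptop e -mp.
have -> : w (ptop mu p) = (w \o ptop mu) p by [].
by apply: top_act => //; apply: Waff_comp => //; exact: top_W.
Qed.

(** A point is the image, by the element of its highest alcove, of the
    representative of its orbit. *)
Lemma ptop_inj lam mu : linked lam mu -> ptop lam = ptop mu -> lam = mu.
Proof.
move=> lm e; have [p [pa mp]] := base_pt (mu + rho).
have := ptop_orbit pa mp lm; by rewrite e /ptop mp => /addIr.
Qed.

Lemma nptE lam mu : dominant lam -> dominant mu -> linked lam mu ->
  npt lam mu = cf (ptop lam) (canonical H (ptop mu)).
Proof.
move=> ld md lk; rewrite /npoly_pt ifT; last exact/asboolP.
by rewrite /npoly_alcove !pt_alcove_elt.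
Qed.

Lemma npt_unlinked lam mu : ~ linked lam mu -> npt lam mu = 0.
Proof. by move=> nl; rewrite /npoly_pt ifF //; apply/asboolP. Qed.

Lemma pt_ltP lam mu : pt_lt lam mu <->
  [/\ dominant lam, dominant mu, linked lam mu & bruhat_lt Phi l (ptop lam) (ptop mu)].
Proof. by split=> -[ld md lk lt]; split=> //; move: lt; rewrite /alcove_lt !pt_alcove_elt. Qed.

Lemma pt_lt_dom lam mu : pt_lt lam mu -> dominant lam. Proof. by case. Qed.

Lemma pt_lt_len lam mu : pt_lt lam mu -> (len (ptop lam) < len (ptop mu))%N.
Proof. by move=> /pt_ltP[_ _ _ /blt_len]. Qed.

Lemma pt_lt_trans mu lam nu : pt_lt lam mu -> pt_lt mu nu -> pt_lt lam nu.
Proof.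
move=> /pt_ltP[ld _ lk lt] /pt_ltP[_ nd lk' lt']; apply/pt_ltP; split=> //.
  exact: linked_trans lk'.
exact: ble_lt_trans lt.1 lt'.
Qed.

Lemma npt_diag mu : dominant mu -> npt mu mu = 1.
Proof.
move=> md; rewrite nptE //; last exact: linked_refl.
by have [[_ -> _] _] := canonicalP l_gt0 H (ptop_Wf md).
Qed.

Lemma npt_neq0 lam mu : dominant lam -> dominant mu -> npt lam mu != 0 ->
  lam = mu \/ pt_lt lam mu /\ in_vZv (npt lam mu).
Proof.
move=> ld md h; have [lk|/npt_unlinked e] := pselect (linked lam mu); last first.
  by rewrite e eqxx in h.
have [->|lm] := eqVneq lam mu; [by left|right].
have [[_ _ cl] _] := canonicalP l_gt0 H (ptop_Wf md).
move: h; rewrite nptE // => h.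
have [|lt lo] := cl (ptop lam) _ h.
  by apply: contra_neq lm; exact: ptop_inj.
by split=> //; apply/pt_ltP.
Qed.

Lemma mcoeff_fsum (D : set V) (F : V -> laurent) u :
  finite_set [set i | D i /\ F i != 0] ->
  mcoeff u (\sum_(i \in D) F i *: Npt i) = if `[< D u >] then F u else 0.
Proof.
move=> fin; set S := [set i | _] in fin.
rewrite (fsbigE (fset_set S)) ?fset_uniq //; last first.
- move=> i Di; rewrite in_fset_set // => /negP.
  rewrite inE => /not_andP[//|/negP]; rewrite negbK => /eqP ->.
  by rewrite scale0r.
- by move=> i /=; rewrite in_fset_set // inE => -[].
rewrite mcoeff_sum.
have -> : \sum_(i <- fset_set S | i \in D) mcoeff u (F i *: Npt i) =
    \sum_(i <- fset_set S) F i *+ (i == u).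
  rewrite [LHS]big_mkcond; apply: eq_big_seq => i; rewrite in_fset_set // !inE => -[Di _].
  rewrite ifT; last by rewrite inE.
  by rewrite mcoeffZ mcoeffU mulr_natr.
have [us|nus] := boolP (u \in fset_set S).
  rewrite (bigD1_seq u) ?fset_uniq //= eqxx mulr1n big1 ?addr0.
    by move: us; rewrite in_fset_set // inE => -[Du _]; rewrite ifT //; exact/asboolP.
  by move=> i /negbTE ->; rewrite mulr0n.
rewrite big1_seq.
  case: asboolP => // Du; apply/esym/eqP; apply: contraNT nus => Fu.
  by rewrite in_fset_set // inE.
by move=> i /= si; case: eqVneq => // e; rewrite -e si in nus.
Qed.

Lemma npt_finite mu : dominant mu -> finite_set [set lam | dominant lam /\ npt lam mu != 0].
Proof.
move=> md; have [p [pa mp]] := base_pt (mu + rho).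
apply: (@sub_finite_set _ _ ((fun x => x p - rho) @` [set` suppN (canonical H (ptop mu))])).
  move=> lam [ld h]; have lk : linked lam mu.
    by apply: contrapT => /npt_unlinked e; rewrite e eqxx in h.
  exists (ptop lam); last by rewrite (ptop_orbit pa mp lk) addrK.
  by rewrite /= suppNP -nptE.
exact/finite_image/finite_fset.
Qed.

Lemma mcoeff_cpt lam mu : dominant mu ->
  mcoeff lam (cpt mu) = if `[< dominant lam >] then npt lam mu else 0.
Proof. by move=> md; apply: mcoeff_fsum; exact: npt_finite. Qed.

Lemma cpt_neq0 lam mu : dominant mu -> mcoeff lam (cpt mu) != 0 ->
  lam = mu \/ pt_lt lam mu /\ in_vZv (mcoeff lam (cpt mu)).
Proof.
move=> md; rewrite mcoeff_cpt //; case: asboolP => [ld|_]; last by rewrite eqxx.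
exact: npt_neq0.
Qed.

Lemma cpt_diag mu : dominant mu -> mcoeff mu (cpt mu) = 1.
Proof. by move=> md; rewrite mcoeff_cpt // ifT ?npt_diag //; exact/asboolP. Qed.

(** * Self-dual elements *)

Lemma sd_coef (c : M) : (forall mu, mu \in msupp c ->
  dominant mu /\ lbar (mcoeff mu c) = mcoeff mu c) <->
  forall mu, (mcoeff mu c != 0 -> dominant mu) /\ lbar (mcoeff mu c) = mcoeff mu c.
Proof.
split=> h mu; last by rewrite -mcoeff_neq0 => /(h mu).1 ?; split=> //; exact: (h mu).2.
have [/h[? ?]|nm] := boolP (mu \in msupp c); first by [].
by rewrite (mcoeff_outdom nm) eqxx lbar0.
Qed.

Lemma self_dual0 : self_dual H 0.
Proof.
exists 0; split; first by move=> mu; rewrite msupp0 inE.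
by rewrite msupp0 big_seq_fset0.
Qed.

Lemma self_dualD z z' : self_dual H z -> self_dual H z' -> self_dual H (z + z').
Proof.
move=> [c [/sd_coef h ->]] [c' [/sd_coef h' ->]]; exists (c + c'); split.
  apply/sd_coef => mu; rewrite mcoeffD lbarD (h mu).2 (h' mu).2; split=> //.
  by have [e|] := eqVneq (mcoeff mu c) 0; [rewrite e add0r => /(h' mu).1|move=> /(h mu).1].
exact: (esym (combD _ _ _)).
Qed.

Lemma self_dualZ (a : laurent) z : lbar a = a -> self_dual H z -> self_dual H (a *: z).
Proof.
move=> aE [c [/sd_coef h ->]]; exists (a *: c); split.
  apply/sd_coef => mu; rewrite mcoeffZ lbarM aE (h mu).2; split=> //.
  by have [->|/(h mu).1 //] := eqVneq (mcoeff mu c) 0; rewrite mulr0 eqxx.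
exact: (esym (combZ _ _ _)).
Qed.

Lemma self_dualN z : self_dual H z -> self_dual H (- z).
Proof. by rewrite -scaleN1r; apply: self_dualZ; rewrite lbarN lbar1. Qed.

Lemma self_dualMz z (k : int) : self_dual H z -> self_dual H (z *~ k).
Proof.
move=> zs; have pos (m : nat) : self_dual H (z *+ m).
  by elim: m => [|m IH]; [exact: self_dual0|rewrite mulrS; exact: self_dualD].
by case: k => m; rewrite ?NegzE ?mulrNz -?pmulrn; [exact: pos|exact/self_dualN/pos].
Qed.

Lemma self_dual_cpt mu : dominant mu -> self_dual H (cpt mu).
Proof.
move=> md; exists (mkmalgU mu 1); split; last exact: (esym (combU _ _)).
apply/sd_coef => lam; rewrite mcoeffU; have [<-|_] := eqVneq mu lam.
  by rewrite mulr1n lbar1; split=> // _; rewrite -/(dominant _).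
by rewrite mulr0n lbar0 eqxx.
Qed.

Lemma self_dual_sum (J : Type) (s : seq J) (P : pred J) (F : J -> M) :
  (forall j, P j -> self_dual H (F j)) -> self_dual H (\sum_(j <- s | P j) F j).
Proof. by move=> h; apply: big_ind => //; [exact: self_dual0|exact: self_dualD]. Qed.

(** A coefficient of maximal length in the expansion in canonical elements is
    also a coefficient of [z], hence a bar invariant element of [v Z[v]]. *)
Lemma self_dual_small z : self_dual H z ->
  (forall lam, dominant lam -> in_vZv (mcoeff lam z)) -> z = 0.
Proof.
move=> [c [/sd_coef h ->]] hz.
have [s0|/(seq_max (fun mu => len (ptop mu)))[mu sx xP]] := eqVneq (msupp c : seq _) [::].
  by rewrite s0 big_nil.
move: sx; rewrite -mcoeff_neq0 => cm; have md := (h mu).1 cm.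
suff e : mcoeff mu c = 0 by rewrite e eqxx in cm.
apply: low1_bar (h mu).2; apply/vZvE.
suff <- : mcoeff mu (\sum_(nu <- msupp c) mcoeff nu c *: cpt nu) = mcoeff mu c.
  exact/vZvE/hz.
rewrite mcoeff_sum -[RHS](mcoeff_pick c mu); apply: eq_big_seq => nu sn.
have nd : dominant nu by apply: (h nu).1; rewrite mcoeff_neq0.
have [->|nm] := eqVneq nu mu; rewrite mcoeffZ; first by rewrite (cpt_diag md) mulr1.
rewrite mulr0n; suff -> : mcoeff mu (cpt nu) = 0 by rewrite mulr0.
apply/eqP; apply: contrapT => /negP hn.
have [e|[/pt_lt_len]] := cpt_neq0 nd hn; first by rewrite e eqxx in nm.
by rewrite ltnNge xP.
Qed.

(** * The positivity algorithm *)

Local Notation leading := (@leading R n Phi l).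
Local Notation min_exponent := (@min_exponent R n Phi l).
Local Notation reduce := (reduce H).

Lemma mcoeff_reduce lam nu (i : int) c z : mcoeff lam (reduce nu i c z) =
  mcoeff lam z - \sum_(mu <- msupp z | `[< pt_lt mu nu >])
    (c * mcoeff lam (cpt mu)) *~ mcoeff i (mcoeff mu z).
Proof.
rewrite mcoeffB mcoeff_sum; congr (_ - _); apply: eq_bigr => mu _.
by rewrite mcoeffMz mcoeffZ.
Qed.

Lemma reduce_self_dual nu i c z : lbar c = c -> self_dual H z ->
  self_dual H (reduce nu i c z).
Proof.
move=> cb zs; apply: self_dualD => //; apply: self_dualN; apply: self_dual_sum.
move=> mu /asboolP/pt_lt_dom md; apply: self_dualMz; apply: self_dualZ => //.
exact: self_dual_cpt.
Qed.

Lemma reduce_leading nu i c z : leading nu z -> leading nu (reduce nu i c z).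
Proof.
move=> [nd z1 zl]; split=> // [|lam].
  rewrite mcoeff_reduce z1 big1 ?subr0 // => mu /asboolP mn.
  have [->|h] := eqVneq (mcoeff nu (cpt mu)) 0; first by rewrite mulr0 mul0rz.
  have lt := pt_lt_len mn; have [e|[/pt_lt_len]] := cpt_neq0 (pt_lt_dom mn) h.
    by rewrite e ltnn in lt.
  by rewrite ltnNge ltnW.
rewrite -mcoeff_neq0 mcoeff_reduce => h; apply: contrapT => /not_orP[ln nlt].
move: h; have -> : mcoeff lam z = 0.
  by apply: mcoeff_outdom; apply/negP => /zl[].
rewrite big1 ?subrr ?eqxx // => mu /asboolP mn.
have [->|h] := eqVneq (mcoeff lam (cpt mu)) 0; first by rewrite mulr0 mul0rz.
case: nlt; have [->//|[lm _]] := cpt_neq0 (pt_lt_dom mn) h.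
exact: pt_lt_trans mn.
Qed.

Lemma vpow_sym_bar (i : int) : lbar (vpow i + vpow (- i)) = vpow i + vpow (- i).
Proof. by rewrite lbarD !vpow_bar opprK addrC. Qed.

(** Each round subtracts bar invariant multiples of canonical elements that lie
    below the leading term. *)
Lemma reduces_inv nu z z' : reduces_to H nu z z' -> self_dual H z -> leading nu z ->
  [/\ self_dual H z', leading nu z' & forall lam, pt_lt lam nu -> in_vZv (mcoeff lam z')].
Proof.
elim=> [{}z h|{}z {}z' i _ _ _ IH|{}z {}z' _ _ IH] zs zl //; apply: IH.
- exact/reduce_self_dual/zs/vpow_sym_bar.
- exact: reduce_leading.
- exact/reduce_self_dual/zs/lbar1.
- exact: reduce_leading.
Qed.

(** The difference with the canonical element is self-dual with all coefficients
    in [v Z[v]]. *)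
Lemma reduced_uniq nu z : self_dual H z -> leading nu z ->
  (forall lam, pt_lt lam nu -> in_vZv (mcoeff lam z)) -> z = cpt nu.
Proof.
move=> zs [nd z1 zl] hz; apply/eqP; rewrite -subr_eq0; apply/eqP.
apply: self_dual_small.
  by apply: self_dualD => //; apply/self_dualN/self_dual_cpt.
move=> lam ld; apply/vZvE; rewrite mcoeffB.
have [->|ln] := eqVneq lam nu; first by rewrite z1 cpt_diag // subrr; exact: low0.
apply: lowD; last apply: lowN.
  have [->|] := eqVneq (mcoeff lam z) 0; first exact: low0.
  rewrite mcoeff_neq0 => /zl[e|lt]; first by rewrite e eqxx in ln.
  exact/vZvE/hz.
have [->|h] := eqVneq (mcoeff lam (cpt nu)) 0; first exact: low0.
by have [e|[_ /vZvE//]] := cpt_neq0 nd h; rewrite e eqxx in ln.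
Qed.

Lemma low_bound z : exists k : nat, forall lam, low (1 - k%:Z) (mcoeff lam z).
Proof.
pose F (f : laurent) : nat := \max_(i <- msupp f) absz i.
exists (\max_(lam <- msupp z) F (mcoeff lam z)).+1 => lam i h.
have h1 : (absz i <= F (mcoeff lam z))%N.
  have si : i \in msupp (mcoeff lam z) by rewrite -mcoeff_neq0.
  exact: (@leq_bigmax_seq _ _ xpredT (fun i : int => absz i) _ si isT).
have sz : lam \in msupp z.
  by rewrite -mcoeff_neq0; apply: contraNneq h => ->; rewrite mcoeff0.
have h2 := @leq_bigmax_seq _ _ xpredT (fun lam => F (mcoeff lam z)) _ sz isT.
move: (\max_(_ <- msupp z) _) h2 => B h2; move: (F _) h1 h2 => C h1 h2.
lia.
Qed.

Lemma low_cancel (i : int) (f g : laurent) : low i f -> low i g ->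
  mcoeff i f = mcoeff i g -> low (i + 1) (f - g).
Proof.
move=> fi gi e j; rewrite mcoeffB; have [->|ji] := eqVneq j i; first by rewrite e subrr eqxx.
move=> h; suff : i <= j by move: ji => /eqP; lia.
have [f0|/fi //] := eqVneq (mcoeff j f) 0; apply: gi.
by apply: contraNneq h => ->; rewrite f0 subrr.
Qed.

(** A round removes the terms of smallest exponent: the coefficient of the
    subtracted canonical element at [lam] is [1] at [lam] itself and in [v Z[v]]
    elsewhere. *)
Lemma reduce_low nu (k : nat) c z : (forall lam, pt_lt lam nu -> low (- k%:Z) (mcoeff lam z)) ->
  low (- k%:Z) c -> mcoeff (- k%:Z) c = 1 ->
  forall lam, pt_lt lam nu -> low (1 - k%:Z) (mcoeff lam (reduce nu (- k%:Z) c z)).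
Proof.
move=> zl cl c1 lam ln; have ld := pt_lt_dom ln; rewrite mcoeff_reduce addrC.
set e := fun mu => mcoeff (- k%:Z) (mcoeff mu z).
have other mu : pt_lt mu nu -> mu != lam ->
    low (- k%:Z + 1) ((c * mcoeff lam (cpt mu)) *~ e mu).
  move=> mn ml; apply: lowMz; have [->|h] := eqVneq (mcoeff lam (cpt mu)) 0.
    by rewrite mulr0; exact: low0.
  have [e1|[_ /vZvE lo]] := cpt_neq0 (pt_lt_dom mn) h; first by rewrite e1 eqxx in ml.
  exact: low_mul.
have [sl|nsl] := boolP (lam \in msupp z).
  rewrite (bigID (pred1 lam)) /= opprD addrA; apply: lowD; last first.
    by apply: lowN; apply: low_sum => mu /andP[/asboolP mn ml]; exact: other.
  have fE : [seq mu <- msupp z | `[< pt_lt mu nu >] && (mu == lam)] = [:: lam].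
    rewrite -(filter_pred1_uniq (fset_uniq _) sl); apply: eq_filter => mu /=.
    by have [->|_] := eqVneq mu lam; rewrite ?andbF // andbT; apply/asboolP.
  rewrite -big_filter fE big_seq1 (cpt_diag ld) mulr1; apply: low_cancel; [exact: zl|exact: lowMz|].
  by rewrite mcoeffMz c1 intz.
rewrite (mcoeff_outdom nsl) add0r; apply: lowN; rewrite big_seq_cond.
apply: low_sum => mu /andP[sm /asboolP mn]; apply: other => //.
by apply: contraNneq nsl => <-.
Qed.

(** Each round increases the smallest exponent, so that the algorithm
    terminates. *)
Lemma reduces_exists nu z : leading nu z -> exists z', reduces_to H nu z z'.
Proof.
have [k0 k0P] := low_bound z.
have : forall lam, pt_lt lam nu -> low (1 - k0%:Z) (mcoeff lam z) by move=> lam _.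
elim: k0 z {k0P} => [|k IH] z zl zn.
  exists z; apply: reduce_done => lam /zl lo; apply/vZvE; exact: lowW lo.
have [lo|nlo] := pselect (forall lam, pt_lt lam nu -> low (1 - k%:Z) (mcoeff lam z)).
  exact: IH.
have zl' lam : pt_lt lam nu -> low (- k%:Z) (mcoeff lam z).
  by move=> /zl; apply: lowW; lia.
have mz : min_exponent nu z (- k%:Z).
  split; last by move=> lam j /zl' h /h.
  apply: contrapT => H1; apply: nlo => lam ln i h.
  have := zl' _ ln _ h; have [e|] := eqVneq i (- k%:Z).
    by case: H1; exists lam => //; rewrite -e.
  by move=> /eqP; lia.
case: (posnP k) => [k0|kpos].
  rewrite k0 oppr0 in mz.
  have [|z' zr] := IH (reduce nu 0 1 z) _ (reduce_leading _ _ zn).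
    rewrite -[X in reduce nu X]oppr0 -[X in reduce nu (- X)]/(0%N%:Z) k0.
    apply: reduce_low.
    - by move=> lam /zl'; rewrite k0.
    - exact: low_1.
    - by rewrite -vpow0 mcoeff_vpow eqxx.
  exists z'; exact: reduce_zero zr.
have [|z' zr] := IH (reduce nu (- k%:Z) (vpow (- k%:Z) + vpow (- - k%:Z)) z) _
  (reduce_leading _ _ zn).
  apply: reduce_low => //.
    have lv (j : int) : - k%:Z <= j -> low (- k%:Z) (vpow j).
      by move=> hj i; rewrite mcoeff_vpow; have [<-|_] := eqVneq j i; rewrite ?eqxx.
    by apply: lowD; apply: lv => //; lia.
  rewrite mcoeffD !mcoeff_vpow eqxx opprK; have [|] := eqVneq (k%:Z) (- k%:Z); [lia|by []].
exists z'; apply: reduce_neg zr => //; lia.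
Qed.

Lemma leading_uniq nu nu' z : leading nu z -> leading nu' z -> nu' = nu.
Proof.
move=> [_ z1 zl] [_ z1' zl'].
have s1 : nu \in msupp z by rewrite -mcoeff_neq0 z1 oner_eq0.
have s2 : nu' \in msupp z by rewrite -mcoeff_neq0 z1' oner_eq0.
have [//|/pt_lt_len lt1] := zl _ s2; have [//|/pt_lt_len lt2] := zl' _ s1.
by move: lt1; rewrite ltnNge ltnW.
Qed.

Theorem positivityE nu z : self_dual H z -> leading nu z -> positivity H z = cpt nu.
Proof.
move=> zs zn; apply: xget_unique.
  have [z' zr] := reduces_exists zn; exists nu; split=> //.
  by have [z's z'n hz] := reduces_inv zr zs zn; rewrite -(reduced_uniq z's z'n hz).
move=> z' [nu' [_ zn' zr]]; rewrite (leading_uniq zn zn') in zr.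
by have [z's z'n hz] := reduces_inv zr zs zn; exact: reduced_uniq.
Qed.

End PointModule.

(** * Cosets of a parabolic subgroup in the dominant chamber *)

Section Parabolic.
Context {R : realType} {n : nat} {Phi : rootSystem R n} {l : nat}.
Context (l_gt0 : (0 < l)%N) (H : heckeModule Phi l).
Local Notation V := 'rV[R]_n.
Local Notation aff_root := (aff_root Phi l).
Local Notation wall := (wall Phi l).
Local Notation spec := (spec Phi l).
Local Notation a0 := (base Phi l).
Local Notation W := (Waff Phi l).
Local Notation Wf := (Wf Phi l).
Local Notation len := (cox_length Phi l).
Local Notation N := (indmod H).
Local Notation cf := (cf (H := H)).
Local Notation v := (vpow 1).
Local Notation v' := (vpow (-1)).
Local Notation stab p := (generated (stab_refl Phi l p)).
Local Notation is_top := (is_top Phi l).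
Implicit Types (x y w g : V -> V) (p q : V) (f : V -> R) (z : N).

Lemma stab1 q f : wall f -> f q = 0 -> stab q (rf f).
Proof. by move=> wf fq; apply: gen1; exists f. Qed.

Lemma stab_mulr q g f : wall f -> f q = 0 -> stab q g -> stab q (g \o rf f).
Proof. by move=> wf fq sg; apply: gen_comp => //; exact: stab1. Qed.

(** For [y] the highest alcove at a dominant point, [negc_top] measures the
    position of [y g] by the length of [g], and by [len_negc_step] this position
    goes down when the length of [y g] goes up. *)
Lemma coset_flip q y g f : spec q a0 -> is_top (y q) y -> chamber Phi (y q) ->
  stab q g -> wall f -> f q = 0 ->
  (len (y \o g \o rf f) < len (y \o g))%N = (len g < len (g \o rf f))%N.
Proof.
move=> qa yt yC sg wf fq; have ff := wall_fun wf; have [Wy _ _] := yt.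
have Wg := stab_W l_gt0 sg; have Wyg := Waff_comp Wy Wg.
have sgs := stab_mulr wf fq sg; have Wgs := stab_W l_gt0 sgs.
have Wygs := Waff_comp Wy Wgs.
have e1 := negc_top l_gt0 qa yt sg; have e2 := negc_top l_gt0 qa yt sgs.
have gq := stab_fix l_gt0 sg.
apply/idP/idP => h.
  have := len_negc_step l_gt0 Wyg wf fq; rewrite /= gq => /(_ yC h).
  by move: e1 e2 => /= -> -> ->.
have [//|h'] := len_right_cases l_gt0 Wyg wf; exfalso.
have := len_negc_step l_gt0 Wygs wf fq; rewrite /= (rf_fix fq) gq => /(_ yC).
have E : (y \o (g \o rf f)) \o rf f = y \o g by exact: (compA_rf (y \o g) ff).
rewrite E => /(_ h'); move: e1 e2 => /= e1 e2; rewrite e2.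
have -> : negc Phi l (y q) (y (g (rf f (rf f a0)))) = len g by rewrite (rfK ff).
by move=> e; move: h; rewrite e ltnNge leqnSn.
Qed.

(** By [coset_flip] the length decreases along the coset by one at each step. *)
Lemma coset_len q y g : spec q a0 -> is_top (y q) y -> chamber Phi (y q) ->
  stab q g -> (len (y \o g) + len g)%N = len y.
Proof.
move=> qa yt yC; have [Wy _ _] := yt; move: g; apply: gen_ind_r.
  by rewrite (len_id l_gt0) addn0.
move=> g _ sg IH [f [wf fq ->]]; have flip := coset_flip qa yt yC sg wf fq.
have Wg := stab_W l_gt0 sg; have Wyg := Waff_comp Wy Wg.
have [lt|lt] := len_right_cases l_gt0 Wg wf.
  have flipF : (len (y \o g \o rf f) < len (y \o g))%N = false.
    by rewrite flip; apply/negbTE; rewrite -leqNgt ltnW.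
  have := len_down l_gt0 Wg wf lt.
  have [h'|h'] := len_right_cases l_gt0 Wyg wf; first by rewrite flipF in h'.
  have := len_up l_gt0 Wyg wf h'; rewrite -compA; lia.
have := len_up l_gt0 Wg wf lt; move: flip; rewrite lt => h'.
have := len_down l_gt0 Wyg wf h'; rewrite -compA; lia.
Qed.

Lemma coset_Wf q y g : spec q a0 -> W y -> chamber Phi (y q) -> stab q g -> Wf (y \o g).
Proof.
move=> qa Wy yC sg; apply: (chamber_coset l_gt0 Wy _ qa) yC.
  exact/Waff_comp/(stab_W l_gt0 sg).
by rewrite /= (stab_fix l_gt0 sg).
Qed.

(** * Spherical elements *)

Definition spherical_at q z := forall f, wall f -> f q = 0 -> spherical f z.

Lemma spherical_at_sub p q z : spec q p -> spherical_at q z -> spherical_at p z.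
Proof. by move=> qp zs f wf fp; apply: zs => //; exact: (spec_eq0 qp (wall_fun wf)). Qed.

Lemma vpowS (m : nat) : vpow m.+1 = v * vpow m.
Proof. by rewrite -vpowD; congr vpow; lia. Qed.

Lemma vpow_cancel (i : int) (a b : laurent) : vpow i * a = b -> a = vpow (- i) * b.
Proof. by move=> <-; rewrite mulrA -vpowD addNr vpow0 mul1r. Qed.

(** Apply [sph_down] at each step down the coset, starting from its highest
    alcove. *)
Lemma sph_coset q y g z : spec q a0 -> is_top (y q) y -> chamber Phi (y q) ->
  spherical_at q z -> stab q g -> cf (y \o g) z = vpow (len g) * cf y z.
Proof.
move=> qa yt yC zs; have [Wy _ _] := yt; move: g; apply: gen_ind_r.
  by rewrite (len_id l_gt0) vpow0 mul1r.
move=> g _ sg IH [f [wf fq ->]]; have flip := coset_flip qa yt yC sg wf fq.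
have ff := wall_fun wf; have Wg := stab_W l_gt0 sg; have Wyg := Waff_comp Wy Wg.
have sgs := stab_mulr wf fq sg.
have fy := coset_Wf qa Wy yC sg; have fys := coset_Wf qa Wy yC sgs.
have sz := zs f wf fq.
have [lt|lt] := len_right_cases l_gt0 Wg wf.
  have flipF : (len (y \o g \o rf f) < len (y \o g))%N = false.
    by rewrite flip; apply/negbTE; rewrite -leqNgt ltnW.
  have e := len_down l_gt0 Wg wf lt.
  have [h'|h'] := len_right_cases l_gt0 Wyg wf; first by rewrite flipF in h'.
  have := @sph_down _ _ _ _ l_gt0 H (y \o (g \o rf f)) f z fys wf sz.
  have E : (y \o (g \o rf f)) \o rf f = y \o g by exact: (compA_rf (y \o g) ff).
  rewrite E => /(_ h'); rewrite IH e vpowS -mulrA => /esym/vpow_cancel ->.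
  by rewrite !mulrA -!vpowD; congr (vpow _ * _); lia.
have e := len_up l_gt0 Wg wf lt; move: flip; rewrite lt => h'.
by have := sph_down l_gt0 fy wf sz h'; rewrite e vpowS -mulrA -IH => <-.
Qed.

(** The coefficients at alcoves linked by walls through [q] differ by powers of
    [v], and the coefficient vanishes where the next step leaves the dominant
    chamber. *)
Lemma sph_exit q x g z : spherical_at q z -> stab q g -> Wf x -> ~ Wf (x \o g) -> cf x z = 0.
Proof.
move=> zs [k wk] + ; elim: wk x => [x fx nx|j _ {}g [f [wf fq ->]] _ IH x fx nx].
  by case: nx.
have ff := wall_fun wf; have sz := zs f wf fq.
have [fxs|nxs] := pselect (Wf (x \o rf f)); last exact: (sph_out l_gt0 fx wf nxs sz).
have e := IH _ fxs nx.
have [lt|lt] := len_right_cases l_gt0 (Wf_W fx) wf.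
  have := sph_down l_gt0 fx wf sz lt; rewrite e => /esym/vpow_cancel ->.
  by rewrite mulr0.
have E : x \o rf f \o rf f = x by exact: (compA_rf x ff).
have := @sph_down _ _ _ _ l_gt0 H (x \o rf f) f z fxs wf sz; rewrite E => /(_ lt) ->.
by rewrite e mulr0.
Qed.

(** A dominant alcove [x A_+] has at its point [x q] outside of the open chamber
    a mirror image in the hyperplane of a simple root, which is not dominant. *)
Lemma sph_out_chamber q x z : spec q a0 -> spherical_at q z -> ~ chamber Phi (x q) ->
  cf x z = 0.
Proof.
move=> qa zs nC; have [fx|nx] := pselect (Wf x); last exact: cf_nf.
have [Wx xC] := (WfP Phi l_gt0 x).1 fx.
have /existsNP[i hi] : ~ forall i, 0 < ev l (simple Phi i) 0 (x q).
  by move=> h; apply: nC; exact/(chamberP Phi l).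
have wi := simple_wall Phi l i; have fi := wall_fun wi.
have xi := (chamberP Phi l _).1 xC i.
have e0 : ev l (simple Phi i) 0 (x q) = 0.
  apply/eqP; rewrite eq_le leNgt (introF idP hi) /=.
  exact: (spec_ge0 (spec_orbit Wx qa) fi (ltW xi)).
have gf := aff_root_W fi Wx.
have [|_ sg] := fundamental l_gt0 (Waff_rf l_gt0 gf) qa; first by rewrite rf_fix.
apply: (sph_exit zs sg fx); rewrite -(rf_W fi Wx) => /(WfP Phi l_gt0)[_ /(chamberP Phi l)/(_ i)].
by rewrite /= (rf_anti _ fi) oppr_gt0 => /(lt_trans xi); rewrite ltxx.
Qed.

(** * Sums over a finite stabilizer *)

Definition stab_seq q : seq (V -> V) := fset_set (stab q).

Lemma stab_seqP q g : spec q a0 -> g \in stab_seq q <-> stab q g.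
Proof.
move=> qa; rewrite in_fset_set; last exact: stab_finite.
by rewrite inE.
Qed.

Lemma stab_seq_uniq q : uniq (stab_seq q).
Proof. exact: fset_uniq. Qed.

Lemma stab_inv q w : stab q w -> exists w', [/\ stab q w', w \o w' = id & w' \o w = id].
Proof.
apply: gen_inv => s [f [wf _ ->]]; exact: (rfK (wall_fun wf)).
Qed.

Lemma sum_stab_shift (A : nmodType) q w (F : (V -> V) -> A) : spec q a0 -> stab q w ->
  \sum_(g <- stab_seq q) F (g \o w) = \sum_(g <- stab_seq q) F g.
Proof.
move=> qa sw; have [w' [sw' e e']] := stab_inv sw.
have K g : g \o w \o w' = g.
  by apply/funext => r /=; have /= -> := congr1 (@^~ r) e.
have K' g : g \o w' \o w = g.
  by apply/funext => r /=; have /= -> := congr1 (@^~ r) e'.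
rewrite -(big_map (fun g => g \o w) xpredT F); apply: perm_big; apply: uniq_perm.
- rewrite map_inj_uniq ?stab_seq_uniq // => g1 g2 eg.
  by rewrite -(K g1) eg K.
- exact: stab_seq_uniq.
- move=> g; apply/mapP/idP => [[g1 /(stab_seqP _ qa) s1 ->]|/(stab_seqP _ qa) sg].
    by apply/(stab_seqP _ qa)/gen_comp.
  exists (g \o w'); first by apply/(stab_seqP _ qa)/gen_comp.
  by rewrite K'.
Qed.

Lemma eq_stab (A : nmodType) q (F G : (V -> V) -> A) : spec q a0 ->
  (forall g, stab q g -> F g = G g) ->
  \sum_(g <- stab_seq q) F g = \sum_(g <- stab_seq q) G g.
Proof. by move=> qa h; apply: eq_big_seq => g /(stab_seqP _ qa)/h. Qed.

(** The Poincare polynomial of the stabilizer, in [v^2]. *)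
Definition poincare q : laurent := \sum_(g <- stab_seq q) vpow (2 * (len g)%:Z).

Lemma poincare_neq0 q : spec q a0 -> poincare q != 0.
Proof.
move=> qa; apply: (@vpow_sum_neq0 _ _ (fun g : V -> V => 2 * (len g)%:Z) id).
by apply/(stab_seqP _ qa); exact: gen_id.
Qed.

(** Multiplication by the longest element reverses the lengths. *)
Lemma poincare_bar q L : spec q a0 ->
  (exists2 w, stab q w & forall k : V -> V, stab q k -> (len (k \o w) + len k = L)%N) ->
  lbar (poincare q) = vpow (- (2 * L%:Z)) * poincare q.
Proof.
move=> qa [w sw wP]; rewrite /poincare lbar_sum mulr_sumr.
rewrite -(sum_stab_shift (fun g => lbar (vpow (2 * (len g)%:Z))) qa sw).
apply: (eq_stab qa) => g sg; rewrite vpow_bar -vpowD.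
by congr vpow; have := wP _ sg; lia.
Qed.

(** * The averaging element of a finite parabolic subgroup *)

Lemma hbar0 : hbar (0 : hecke H) = 0.
Proof. by apply: (@addIr _ (hbar (0 : hecke H))); rewrite -hbarD !add0r. Qed.

Lemma hbar_sum (J : Type) (s : seq J) (P : pred J) (F : J -> hecke H) :
  hbar (\sum_(j <- s | P j) F j) = \sum_(j <- s | P j) hbar (F j).
Proof. by apply: (big_morph (@hbar _ _ _ _ H)) => [h k|]; rewrite ?hbarD ?hbar0. Qed.

Lemma Hb_up w f : W w -> wall f -> (len w < len (w \o rf f))%N ->
  Hb H w * Hb H (rf f) = Hb H (w \o rf f).
Proof.
move=> Ww wf lt; apply: Hb_mul => //; first exact: (Waff_rf l_gt0 (wall_fun wf)).
by rewrite (len_wall l_gt0 wf) addn1; exact: len_up.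
Qed.

Lemma Hb_down w f : W w -> wall f -> (len (w \o rf f) < len w)%N ->
  Hb H w = Hb H (w \o rf f) * Hb H (rf f).
Proof.
move=> Ww wf lt; have ff := wall_fun wf.
by rewrite Hb_up ?(compA_rf w ff) //; exact: Waff_rfr.
Qed.

(** The multiple of the symmetrizer of the parabolic Hecke algebra with
    coefficient [1] at the identity; it is self-dual only after multiplication
    by a power of [v]. *)
Definition avg q : hecke H := \sum_(g <- stab_seq q) vpow (- (len g)%:Z) *: Hb H g.

(** Reindexing the sum by [g -> g s] and expanding [H_s^2] pairs the terms of
    [g] and [g s]. *)
Lemma avg_Hs q f : spec q a0 -> wall f -> f q = 0 ->
  avg q * Hb H (rf f) = v' *: avg q.
Proof.
move=> qa wf fq; have ff := wall_fun wf.
(* The first summand is the term of [g s] moved to [g]; the second comes from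
   [H_s^2] if [g s < g]. *)
pose F g := vpow (- (len (g \o rf f))%:Z) *: Hb H g +
  (if (len (g \o rf f) < len g)%N then vpow (- (len g)%:Z) * (v' - v) else 0) *: Hb H g.
transitivity (\sum_(g <- stab_seq q) F g).
  rewrite /F big_split /=.
  rewrite -(sum_stab_shift (fun g => vpow (- (len (g \o rf f))%:Z) *: Hb H g) qa (stab1 wf fq)).
  rewrite -big_split mulr_suml; apply: (eq_stab qa) => g sg /=.
  have Wg := stab_W l_gt0 sg; have E : g \o rf f \o rf f = g by exact: (compA_rf g ff).
  rewrite E -scalerAl; have [lt|lt] := len_right_cases l_gt0 Wg wf.
    rewrite lt {1}(Hb_down Wg wf lt) -mulrA Hs_quad // mulrDr mulr1 -scalerAr.
    by rewrite -(Hb_down Wg wf lt) scalerDr scalerA.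
  by rewrite ltnNge ltnW //= scale0r addr0 Hb_up.
rewrite /avg scaler_sumr; apply: (eq_stab qa) => g sg.
have Wg := stab_W l_gt0 sg; rewrite /F -scalerDl scalerA; congr (_ *: _).
have [lt|lt] := len_right_cases l_gt0 Wg wf.
  rewrite lt mulrBr -!vpowD addrCA (_ : vpow (- (len (g \o rf f))%:Z) - _ = 0) ?addr0.
    by rewrite addrC.
  apply/eqP; rewrite subr_eq0; apply/eqP; congr vpow.
  by have := len_down l_gt0 Wg wf lt; lia.
rewrite ltnNge ltnW //= addr0 (len_up l_gt0 Wg wf lt) -vpowD; congr vpow; lia.
Qed.

Lemma avg_Cs q f : spec q a0 -> wall f -> f q = 0 ->
  avg q * Cs H f = (v + v') *: avg q.
Proof.
move=> qa wf fq; rewrite /Cs mulrDr avg_Hs // -scalerAr mulr1 -scalerDl.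
by rewrite addrC.
Qed.

(** Since [avg] is only self-dual up to a power of [v], its bar conjugate is
    added to it. *)
Definition sdavg q : hecke H := avg q + hbar (avg q).

Lemma hbar_sdavg q : hbar (sdavg q) = sdavg q.
Proof. by rewrite hbarD hbarK addrC. Qed.

Lemma sdavg_sph q z : spec q a0 -> spherical_at q (act z (sdavg q)).
Proof.
move=> qa f wf fq; rewrite /spherical /act_Cs actM -act_scaler; congr act.
have e := avg_Cs qa wf fq; rewrite mulrDl e scalerDr; congr (_ + _).
rewrite -(hbar_Cs l_gt0 H wf) -hbarM e hbarZ lbarD !vpow_bar opprK.
by rewrite [v' + v]addrC.
Qed.

(** A functional on which the parabolic Hecke algebra acts through the character
    [H_g -> v^-len(g)] (see [tau_Hb]). *)
Definition tau q y z : laurent := \sum_(g <- stab_seq q) vpow (len g) * cf (y \o g) z.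

Lemma tauD q y z z' : tau q y (z + z') = tau q y z + tau q y z'.
Proof. by rewrite -big_split; apply: eq_bigr => g _; rewrite cfN_D mulrDr. Qed.

Lemma tauZ q y a z : tau q y (a *: z) = a * tau q y z.
Proof. by rewrite mulr_sumr; apply: eq_bigr => g _; rewrite cfN_Z mulrCA. Qed.

Lemma tau0 q y : tau q y 0 = 0.
Proof. by rewrite /tau big1 // => g _; rewrite cfN_0 mulr0. Qed.

Lemma tau_sum q y (J : Type) (s : seq J) (P : pred J) (F : J -> N) :
  tau q y (\sum_(j <- s | P j) F j) = \sum_(j <- s | P j) tau q y (F j).
Proof. exact: (big_morph (tau q y) (tauD q y) (tau0 q y)). Qed.

Lemma tau_sph q y z : spec q a0 -> is_top (y q) y -> chamber Phi (y q) ->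
  spherical_at q z -> tau q y z = poincare q * cf y z.
Proof.
move=> qa yt yC zs; rewrite /tau /poincare mulr_suml; apply: (eq_stab qa) => g sg.
rewrite (sph_coset qa yt yC zs sg) mulrA -vpowD.
by congr (vpow _ * _); lia.
Qed.

Section Tau.
Context (q : V) (y : V -> V) (qa : spec q a0) (yt : is_top (y q) y).
Context (yC : chamber Phi (y q)).

(** By [coset_flip], stepping from [y g] to [y g s] changes the lengths of [g]
    and [y g] in opposite directions, so that the weights [v^len(g)] compensate
    the coefficients in [cf_act_Cs]. *)
Lemma tau_act_Cs f z : wall f -> f q = 0 -> tau q y (act_Cs f z) = (v + v') * tau q y z.
Proof.
move=> wf fq; have ff := wall_fun wf; have [Wy _ _] := yt.
transitivity (\sum_(g <- stab_seq q) (vpow (len (g \o rf f)) * cf (y \o g) z +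
    vpow (len g) * (@step_coef _ _ Phi l (y \o g) f * cf (y \o g) z))).
  rewrite big_split /=.
  rewrite -(sum_stab_shift (fun g => vpow (len (g \o rf f)) * cf (y \o g) z) qa (stab1 wf fq)).
  rewrite -big_split; apply: (eq_stab qa) => g sg /=.
  have E : g \o rf f \o rf f = g by exact: (compA_rf g ff).
  have fyg := coset_Wf qa Wy yC sg; have fygs := coset_Wf qa Wy yC (stab_mulr wf fq sg).
  by rewrite E (cf_act_Cs l_gt0 _ fyg wf fygs) mulrDr.
rewrite mulr_sumr; apply: (eq_stab qa) => g sg.
have Wg := stab_W l_gt0 sg; rewrite !mulrA -mulrDl; congr (_ * _).
rewrite /step_coef (coset_flip qa yt yC sg wf fq) mulrDl.
have [lt|lt] := len_right_cases l_gt0 Wg wf.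
  rewrite (ltnNge (len g)) (ltnW lt) /= -!vpowD addrC.
  have e := len_down l_gt0 Wg wf lt.
  by congr (_ + _); congr vpow; lia.
have e := len_up l_gt0 Wg wf lt; rewrite lt -!vpowD.
by congr (_ + _); congr vpow; lia.
Qed.

Lemma tau_Hs f z : wall f -> f q = 0 -> tau q y (act z (Hb H (rf f))) = v' * tau q y z.
Proof.
move=> wf fq; have := tau_act_Cs z wf fq; rewrite act_CsE tauD tauZ mulrDl addrC.
exact: addrI.
Qed.

Lemma tau_Hsbar f z : wall f -> f q = 0 ->
  tau q y (act z (hbar (Hb H (rf f)))) = v * tau q y z.
Proof.
move=> wf fq; rewrite hbar_Hs // act_addr -scaleNr act_scaler act1 tauD tauZ tau_Hs //.
by rewrite -mulrDl opprB addrCA subrr addr0.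
Qed.

Lemma tau_Hb g z : stab q g ->
  tau q y (act z (Hb H g)) = vpow (- (len g)%:Z) * tau q y z /\
  tau q y (act z (hbar (Hb H g))) = vpow (len g) * tau q y z.
Proof.
move: g; apply: gen_ind_r.
  by rewrite Hb_id // hbar1 // act1 (len_id l_gt0) oppr0 vpow0 mul1r.
move=> g _ sg [IH1 IH2] [f [wf fq ->]]; have ff := wall_fun wf.
have Wg := stab_W l_gt0 sg.
have [lt|lt] := len_right_cases l_gt0 Wg wf.
  have e := Hb_down Wg wf lt; have el := len_down l_gt0 Wg wf lt.
  move: IH1 IH2; rewrite e hbarM -!actM (tau_Hs _ wf fq) (tau_Hsbar _ wf fq).
  move=> /vpow_cancel -> /vpow_cancel ->; rewrite !mulrA -!vpowD.
  by split; congr (vpow _ * _); lia.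
have el := len_up l_gt0 Wg wf lt.
rewrite -(Hb_up Wg wf lt) hbarM -!actM (tau_Hs _ wf fq) (tau_Hsbar _ wf fq) IH1 IH2.
by rewrite !mulrA -!vpowD; split; congr (vpow _ * _); lia.
Qed.

(** The value of the character on [sdavg]. *)
Definition avg_scalar : laurent := \sum_(g <- stab_seq q) vpow (- (2 * (len g)%:Z)) + poincare q.

Lemma tau_sdavg z : tau q y (act z (sdavg q)) = avg_scalar * tau q y z.
Proof.
rewrite act_addr tauD mulrDl; congr (_ + _).
  rewrite act_sumr tau_sum mulr_suml; apply: (eq_stab qa) => g sg.
  rewrite act_scaler tauZ (tau_Hb z sg).1 mulrA -vpowD.
  by congr (vpow _ * _); lia.
rewrite hbar_sum act_sumr tau_sum mulr_suml; apply: (eq_stab qa) => g sg.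
rewrite hbarZ vpow_bar act_scaler tauZ (tau_Hb z sg).2 mulrA -vpowD.
by congr (vpow _ * _); lia.
Qed.

Lemma avg_scalar_bar : lbar avg_scalar = avg_scalar.
Proof.
rewrite /avg_scalar /poincare lbarD !lbar_sum addrC; congr (_ + _).
  by apply: eq_bigr => g _; rewrite vpow_bar.
by apply: eq_bigr => g _; rewrite vpow_bar opprK.
Qed.

Lemma avg_scalar_neq0 : avg_scalar != 0.
Proof.
pose k (u : bool * (V -> V)) : int := if u.1 then 2 * (len u.2)%:Z else - (2 * (len u.2)%:Z).
have := @vpow_sum_neq0 _ 
  (map (pair false) (stab_seq q) ++ map (pair true) (stab_seq q)) k (false, id).
rewrite big_cat !big_map /=; apply; rewrite mem_cat; apply/orP; left.
by apply/mapP; exists id => //; apply/(stab_seqP _ qa)/gen_id.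
Qed.

(** The same value of [tau] computed by sphericity and by the character. *)
Lemma cf_sdavg z : poincare q * cf y (act z (sdavg q)) = avg_scalar * tau q y z.
Proof. by rewrite -tau_sdavg (tau_sph qa yt yC) //; exact: sdavg_sph. Qed.

End Tau.

End Parabolic.

(** * The operator of a facet *)

Section Crossing.
Context {R : realType} {n : nat} {Phi : rootSystem R n} {l : nat}.
Context (l_gt0 : (0 < l)%N) (H : heckeModule Phi l).
Local Notation V := 'rV[R]_n.
Local Notation aff_root := (aff_root Phi l).
Local Notation wall := (wall Phi l).
Local Notation spec := (spec Phi l).
Local Notation a0 := (base Phi l).
Local Notation W := (Waff Phi l).
Local Notation Wf := (Wf Phi l).
Local Notation len := (cox_length Phi l).
Local Notation cf := (cf (H := H)).
Local Notation stab p := (generated (stab_refl Phi l p)).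
Local Notation is_top := (is_top Phi l).
Local Notation rho := (rho Phi).
Local Notation dominant := (dominant Phi).
Local Notation linked := (linked Phi l).
Local Notation pt_lt := (pt_lt Phi l).
Local Notation npt := (npoly_pt H).
Local Notation cpt := (canonical_pt H).
Local Notation ptop := (ptop (Phi := Phi) (l := l)).
Local Notation M := {malg laurent[V]}.
Local Notation poincare := (poincare (Phi := Phi) (l := l)).
Local Notation stab_seq := (stab_seq (Phi := Phi) (l := l)).
Local Notation negc := (negc Phi l).
Local Notation posc := (posc Phi l).
Implicit Types (x y w g : V -> V) (p q r lam mu nu gam : V) (f : V -> R).

Lemma spec_Winv w p q : W w -> spec (w p) (w q) -> spec p q.
Proof.
move=> Ww; have [w' [Ww' _ e]] := Waff_inv l_gt0 Ww.
move=> /(spec_W Ww'); by have /= -> := congr1 (@^~ p) e; have /= -> := congr1 (@^~ q) e.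
Qed.

(** When a point [k] of the orbit of [q] lies in the closure of the facet of
    [lam + rho], it is in the closure of the alcove [A_+(lam)], whose only point
    in this orbit it is. *)
Lemma ptop_lim k x q lam : W x -> spec q a0 -> x q = k -> spec k (lam + rho) ->
  ptop lam q = k.
Proof.
move=> Wx qa <- h; apply: (orbit_closed l_gt0 Wx (top_W _ l_gt0 _) qa).
exact/(spec_trans h)/top_spec.
Qed.

(** The group generated by the reflections in the hyperplanes through a facet is
    the stabilizer of any of its points: both are conjugate to the stabilizer of
    the point [q] of the closed fundamental alcove. *)
Lemma facet_groupP x q g : W x -> spec q a0 ->
  facet_group Phi l (cell Phi l (x q)) g <-> W g /\ g (x q) = x q.
Proof.
move=> Wx qa; split.
  case=> j; elim: j g => [g wg|j IH g wg].
    case: (word_case wg) => [[_ ->]|[? [? [? []]]]] //.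
    by split=> //; exact: Waff_id.
  case: (word_case wg) => [[]//|[i [s [w [[<-] [a [m [pa am ->]]] /IH[Ww wq] ->]]]]].
  move/(_ _ (cell_refl Phi l _)): am => am.
  have sE : aff_refl a (lmul l m) = rf (ev l a m) by rewrite rf_ev.
  have fa : aff_root (ev l a m) by exists a, m; split=> //; exact: pos_root_root.
  rewrite sE; split; first exact/(Waff_comp _ Ww)/Waff_rf.
  by rewrite /= wq rf_fix //; apply/ev_eq0.
move=> [Wg gq]; have [x' [Wx' xx' x'x]] := Waff_inv l_gt0 Wx.
(* Conjugation by [x] carries the walls through [q] to hyperplanes through [x
   q]. *)
have key k : stab q k -> facet_group Phi l (cell Phi l (x q)) (x \o k \o x').
  move: k; apply: gen_ind_r; first by rewrite compA xx'; exact: gen_id.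
  move=> w _ sw IH [f [wf fq ->]].
  have [g' [fg' g'x e]] := rf_right l_gt0 Wx (wall_fun wf).
  have -> : x \o (w \o rf f) \o x' = (x \o w \o x') \o rf g'.
    apply/funext => u /=; congr (x (w _)).
    have /= E := congr1 (@^~ (x' u)) e; rewrite (congr1 (@^~ u) xx' : x (x' u) = u) in E.
    rewrite -E; exact: (esym (congr1 (@^~ (rf f (x' u))) x'x)).
  apply: gen_comp => //; apply: gen1.
  have gk : g' (x q) = 0 by have /= -> := congr1 (@^~ q) g'x.
  have h : forall f, aff_root f -> f (x q) = 0 -> exists a m, [/\ a \in pos_roots Phi,
      cell Phi l (x q) `<=` hyperplane a (lmul l m) & rf f = aff_refl a (lmul l m)].
    have cl a m : a \in pos_roots Phi -> ev l a m (x q) = 0 ->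
        cell Phi l (x q) `<=` hyperplane a (lmul l m).
      move=> pa e0 u [us _]; apply/ev_eq0; apply: (spec_eq0 us _ e0).
      by exists a, m; split=> //; exact: pos_root_root.
    apply: pos_fun => a m pa e0; exists a, m.
      by split=> //; [exact: cl|rewrite rf_ev].
    split=> //; first by apply: cl => //; apply/eqP; rewrite -oppr_eq0 e0.
    by rewrite (@rfN _ _ Phi l) ?rf_ev //; exists a, m; split=> //; exact: pos_root_root.
  exact: h.
have h : (x' \o g \o x) q = q by rewrite /= gq; have /= -> := congr1 (@^~ q) x'x.
have [|_ sk] := fundamental l_gt0 (Waff_comp (Waff_comp Wx' Wg) Wx) qa; first by rewrite h.
have := key _ sk; congr (facet_group _ _ _); apply/funext => u /=.
by have /= -> := congr1 (@^~ u) xx'; have /= -> := congr1 (@^~ (g u)) xx'.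
Qed.

(** By admissibility [F] contains a point of the segment from [mu + rho] to [mu
    + rho + Lam]; only the relative position of the three points matters. *)
Lemma admissibleP mu Lam : admissible Phi l mu Lam -> exists t, 0 <= t <= 1 /\
  let q := mu + rho + t *: Lam in
  [/\ adm_facet Phi l mu Lam = cell Phi l q, spec q (mu + rho) & spec q (mu + rho + Lam)].
Proof.
move=> /(xgetPex set0); rewrite -/(adm_facet _ _ _ _) => -[fF [F0 F1] [q [[t t01 <-] Fq]] _].
exists t; split; first exact: t01.
move: F0 F1; rewrite !(facetE Phi l_gt0) => F0 F1; split.
- exact: facet_cell.
- exact/closure_cellP/F0.
- exact/closure_cellP/F1.
Qed.

Lemma sum_delta (A : nmodType) (I : eqType) (s : seq I) (j : I) (a : A) : uniq s ->
  \sum_(i <- s) (if j == i then a else 0) = if j \in s then a else 0.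
Proof.
move=> us; case: ifP => js.
  rewrite (bigD1_seq j) //= eqxx big1 ?addr0 // => i /negbTE.
  by rewrite eq_sym => ->.
rewrite big1_seq // => i /andP[_ si]; case: eqP => // e.
by rewrite e si in js.
Qed.

Lemma is_top_ptop lam p : ptop lam p = lam + rho -> is_top (ptop lam p) (ptop lam).
Proof. by move=> e; rewrite {1}e; exact: topP. Qed.

(** All the walls through [p] are right descents of the highest alcove at the
    point in the orbit of [p]. *)
Lemma canonical_sph lam p : spec p a0 -> ptop lam p = lam + rho -> dominant lam ->
  spherical_at p (canonical H (ptop lam)).
Proof.
move=> pa e ld f wf fp; have [_ ds] := canonicalP l_gt0 H (ptop_Wf l_gt0 ld).
apply: ds => //; have tt := is_top_ptop e.
have lC : chamber Phi (ptop lam p) by rewrite e.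
have h : (len (ptop lam \o rf f) < len (ptop lam))%N = (len id < len (rf f))%N.
  exact: (coset_flip l_gt0 pa tt lC (gen_id _) wf fp).
by rewrite h (len_id l_gt0) (len_wall l_gt0 wf).
Qed.

(** By [coset_flip] all the walls through [q] are descents of the highest alcove
    [y], so that [bruhat_lift_down] applies at each step. *)
Lemma bruhat_coset q y x g : spec q a0 -> is_top (y q) y -> chamber Phi (y q) ->
  W x -> bruhat_le Phi l x y -> stab q g -> bruhat_le Phi l (x \o g) y.
Proof.
move=> qa yt yC Wx xy; have [Wy _ _] := yt; move: g; apply: gen_ind_r; first exact: xy.
move=> g _ sg IH [f [wf fq ->]].
apply: (bruhat_lift_down l_gt0 (Waff_comp Wx (stab_W l_gt0 sg)) Wy wf IH).
have h : (len (y \o rf f) < len y)%N = (len id < len (rf f))%N.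
  exact: (coset_flip l_gt0 qa yt yC (gen_id _) wf fq).
by rewrite h (len_id l_gt0) (len_wall l_gt0 wf).
Qed.

Lemma pos_roots_ge0 d a : (forall i, 0 <= dot d (simple Phi i)) ->
  a \in pos_roots Phi -> 0 <= dot d a.
Proof.
move=> d0 /pos_rootsP[_ [c ->]]; rewrite dot_sumr; apply: sumr_ge0 => i _.
by rewrite dotZr mulr_ge0.
Qed.

Lemma negc_add q d : (forall i, 0 <= dot d (simple Phi i)) -> negc q (q + d) = 0%N.
Proof.
move=> d0; apply/eqP; rewrite -leqn0 leqNgt -has_count; apply/hasPn => a pa.
apply/asboolP => -[m [qm]]; rewrite dotDl qm.
by rewrite gtrDl ltNge pos_roots_ge0.
Qed.

Lemma posc_sub q d : (forall i, 0 <= dot d (simple Phi i)) -> posc q (q - d) = 0%N.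
Proof.
move=> d0; apply/eqP; rewrite -leqn0 leqNgt -has_count; apply/hasPn => a pa.
apply/asboolP => -[m [qm]]; rewrite dotBl qm.
by rewrite ltrDl oppr_gt0 ltNge pos_roots_ge0.
Qed.

Section FacetOperator.
Context (mu Lam p q r qF : V).
Local Notation nu := (mu + Lam).
Context (mud : dominant mu) (nud : dominant nu).
Context (pa : spec p a0) (qa : spec q a0) (ra : spec r a0).
Context (mp : ptop mu p = mu + rho) (mq : ptop mu q = qF) (nr : ptop nu r = nu + rho).
Context (qFp : spec qF (mu + rho)) (qFr : spec qF (nu + rho)) (nq : ptop nu q = qF).
Context (admF : adm_facet Phi l mu Lam = cell Phi l qF).

Lemma base_spec : spec q p /\ spec q r.
Proof.
split; first by apply: (spec_Winv (top_W _ l_gt0 (mu + rho)));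
  rewrite [X in spec X _]mq [X in spec _ X]mp.
by apply: (spec_Winv (top_W _ l_gt0 (nu + rho))); rewrite [X in spec X _]nq [X in spec _ X]nr.
Qed.

(** The point of the facet [w(F)] attached to [lam = w . mu], in terms of the
    alcove of [lam] and thus without choosing [w] (see [transportP]). *)
Definition moved_pt lam := ptop lam q.

Lemma transportP lam : linked lam mu -> let w := transporter Phi l mu lam in
  [/\ W w, lam + rho = w (mu + rho), w qF = moved_pt lam & spec (moved_pt lam) (lam + rho)].
Proof.
move=> [w0 Ww0 e0] w.
have [Ww e] : W w /\ lam = wdot Phi w mu.
  have h : exists w, [set w | W w /\ lam = wdot Phi w mu] w by exists w0.
  exact: (xgetPex (@id V) h).
have e' : lam + rho = w (mu + rho) by rewrite e /wdot subrK.
have s : spec (w qF) (lam + rho) by rewrite e'; exact: spec_W.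
have m : moved_pt lam = w qF.
  apply: (@ptop_lim _ (w \o ptop mu)) => //; first exact/(Waff_comp Ww)/top_W.
  by rewrite /= mq.
by rewrite m.
Qed.

(** Both points are images of [r], and an element that links them can be chosen
    to fix the point of the facet exactly when the two alcoves have the same
    point in the orbit of [q]. *)
Lemma moved_orbitP lam gam : linked lam mu ->
  moved_orbit Phi l mu Lam lam (gam + rho) <-> linked gam nu /\ moved_pt gam = moved_pt lam.
Proof.
move=> lk; have [Ww e wq s] := transportP lk; set w := transporter _ _ _ _ in Ww e wq.
have nE : mu + rho + Lam = nu + rho by rewrite addrAC.
have mE : moved_facet Phi l mu Lam lam = cell Phi l (moved_pt lam).
  by rewrite /moved_facet admF -/w (W_cell l_gt0 _ Ww) wq.
have movedE : moved_pt lam = (ptop lam) q by [].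
have Wl : W (ptop lam) by exact: top_W.
split=> [[g]|[lg mg]].
  rewrite -/w mE movedE => /(facet_groupP _ Wl qa)[Wg gq] e1.
  have e2 : gam + rho = g (w (nu + rho)) by rewrite -nE.
  split; first by apply/linkedP; exists (g \o w) => //; exact: Waff_comp.
  apply: (@ptop_lim _ (g \o w \o ptop nu)) => //.
  - apply: (Waff_comp _ (top_W _ l_gt0 _)); exact: Waff_comp.
  -
    by rewrite /= nq wq.
  - rewrite -gq e2 -movedE -wq; exact: (spec_W Wg (spec_W Ww qFr)).
have Wwn : W (w \o ptop nu) by exact/Waff_comp/top_W.
have [x [Wx e1 e2]] := Waff_inv l_gt0 Wwn.
have gr : ptop gam r = gam + rho by exact: (ptop_orbit l_gt0 ra nr lg).
have Wgam : W (ptop gam) by exact: top_W.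
have xr : x (w (nu + rho)) = r by rewrite -nr; exact: (congr1 (@^~ r) e2).
have xq : x (moved_pt lam) = q by rewrite -wq -nq; exact: (congr1 (@^~ q) e2).
exists (ptop gam \o x); last by rewrite -/w nE /= xr.
rewrite mE movedE; apply/(facet_groupP _ Wl qa); split; first exact: Waff_comp.
by rewrite -movedE /= xq.
Qed.

Lemma mcoeff_term lam gam : linked lam mu -> dominant lam ->
  mcoeff gam (@facet_term _ _ Phi l mu Lam lam) =
  if `[< [/\ chamber Phi (moved_pt gam), linked gam nu & moved_pt gam = moved_pt lam] >]
  then vpow ((negc (moved_pt lam) (gam + rho))%:Z - (posc (moved_pt lam) (lam + rho))%:Z) else 0.
Proof.
move=> lk ld; have [Ww e wq s] := transportP lk; set w := transporter _ _ _ _ in Ww e wq.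
have mE : moved_facet Phi l mu Lam lam = cell Phi l (moved_pt lam).
  by rewrite /moved_facet admF -/w (W_cell l_gt0 _ Ww) wq.
rewrite /facet_term mE; case: asboolP => [/cell_chamber kC|nC]; last first.
  rewrite mcoeff0; case: asboolP => // -[gC _ gl]; case: nC.
  by apply/cell_chamber; rewrite -?gl.
rewrite -!(facetE Phi l_gt0) mcoeff_fsum.
  rewrite (neg_countE Phi l_gt0) (pos_countE Phi l_gt0).
  case: asboolP => [/(moved_orbitP _ lk)[lg gl]|ng].
    by rewrite ifT //; apply/asboolP; rewrite gl.
  case: asboolP => // -[_ lg gl]; case: ng; exact/moved_orbitP.
apply: (@sub_finite_set _ _ ((fun g => ptop lam (g r) - rho) @` stab q)); last first.
  exact/finite_image/stab_finite.
move=> u [/(moved_orbitP _ lk)[lu ul] _] /=.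
have [g sg e1] := coset l_gt0 (top_W _ l_gt0 _) (top_W _ l_gt0 _) qa (esym ul).
exists g => //; have -> : ptop lam (g r) = ptop u r by rewrite [X in _ = X r]e1.
by rewrite (ptop_orbit l_gt0 ra nr lu) addrK.
Qed.

Definition npt_supp : seq V := fset_set [set lam | dominant lam /\ npt lam mu != 0].

Lemma npt_suppP lam : lam \in npt_supp <-> dominant lam /\ npt lam mu != 0.
Proof.
rewrite in_fset_set; last exact: npt_finite.
by rewrite inE.
Qed.

Lemma npt_supp_linked lam : lam \in npt_supp -> linked lam mu.
Proof.
by move=> /npt_suppP[_]; apply: contra_neqP => /(npt_unlinked H).
Qed.

(** The part of a coefficient of [F_Lam] that depends only on the facet: the
    contribution of all the points [lam] whose facet [F'] contains [k]. *)
Definition fibre_sum (k : V) : laurent := \sum_(lam <- npt_supp)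
  (if moved_pt lam == k then vpow (- (posc k (lam + rho))%:Z) * npt lam mu else 0).

Lemma mcoeff_facet_op gam : mcoeff gam (facet_op H Lam mu) =
  if `[< chamber Phi (moved_pt gam) /\ linked gam nu >]
  then vpow (negc (moved_pt gam) (gam + rho)) * fibre_sum (moved_pt gam) else 0.
Proof.
rewrite /facet_op (fsbigE npt_supp) ?fset_uniq //; last first.
- move=> lam [lk ld] /negP h; have -> : npt lam mu = 0.
    by apply/eqP/negPn/negP => n0; apply: h; apply/npt_suppP.
  by rewrite scale0r.
- by move=> lam /= ls; split; [exact: npt_supp_linked|have /npt_suppP[] := ls].
rewrite mcoeff_sum big_mkcond /fibre_sum.
case: asboolP => [[kC lg]|h].
  rewrite mulr_sumr; apply: eq_big_seq => lam ls.
  have lk := npt_supp_linked ls; have [ld _] := (npt_suppP lam).1 ls.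
  rewrite ifT; last by rewrite inE.
  rewrite mcoeffZ mcoeff_term //; have [e|ne] := eqVneq (moved_pt lam) (moved_pt gam).
    rewrite ifT; last by apply/asboolP.
    by rewrite e [in RHS]mulrA -vpowD mulrC.
  rewrite ifF ?mulr0 //; apply/asboolP => -[_ _ e]; by rewrite e eqxx in ne.
rewrite big1_seq // => lam /andP[_ ls]; case: ifP => // _.
have lk := npt_supp_linked ls; have [ld _] := (npt_suppP lam).1 ls.
rewrite mcoeffZ mcoeff_term // ifF ?mulr0 //.
by apply/asboolP => -[kC lg _]; apply: h.
Qed.

Context (Lp Lq : nat).
Context (hLp : forall y, is_top (y p) y -> hypc Phi l (y p) = Lp).
Context (hLq : forall y, is_top (y q) y -> hypc Phi l (y q) = Lq).

Lemma ptop_p lam : linked lam mu -> ptop lam p = lam + rho.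
Proof. exact: ptop_orbit. Qed.

Lemma moved_pt_eq x lam : W x -> x p = lam + rho -> moved_pt lam = x q.
Proof.
move=> Wx e; apply: (ptop_lim Wx qa (erefl _)); rewrite -e.
exact: (spec_W Wx base_spec.1).
Qed.

(** The hyperplanes through the facet that separate [y A_+] from the alcove of
    [y g] either have [lam + rho] on their negative side or contain [lam + rho];
    [len k] counts the latter. *)
Lemma coset_len_eq lam y g k : linked lam mu -> is_top (y q) y -> moved_pt lam = y q ->
  stab q g -> stab p k -> y \o g = ptop lam \o k ->
  (len g + posc (y q) (lam + rho) + Lp = len k + Lq)%N.
Proof.
move=> lk yt e sg sk E; have Tp := ptop_p lk.
have WT : W (ptop lam) := top_W Phi l_gt0 (lam + rho).
have s1 : spec (y q) (lam + rho).
  by rewrite -e -Tp; exact: (spec_W WT base_spec.1).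
have s2 : spec (lam + rho) ((ptop lam \o k) a0).
  have := spec_W (Waff_comp WT (stab_W l_gt0 sk)) pa.
  by rewrite /= (stab_fix l_gt0 sk) Tp.
have := negc_top l_gt0 qa yt sg; rewrite E (neg_split l_gt0 s1 s2) -Tp.
rewrite (negc_top l_gt0 pa (is_top_ptop Tp) sk).
have := hyp_split l_gt0 s1; rewrite (hLq yt) -Tp (hLp (is_top_ptop Tp)).
lia.
Qed.

Lemma cf_coset lam y g k : linked lam mu -> dominant lam -> is_top (y q) y ->
  moved_pt lam = y q -> stab q g -> stab p k -> y \o g = ptop lam \o k ->
  vpow (len g) * cf (y \o g) (canonical H (ptop mu)) =
  vpow (2 * (len k)%:Z) *
    (vpow (Lq%:Z - Lp%:Z) * (vpow (- (posc (y q) (lam + rho))%:Z) * npt lam mu)).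
Proof.
move=> lk ld yt e sg sk E; have Tp := ptop_p lk.
have lC : chamber Phi (ptop lam p) by rewrite Tp.
rewrite E (sph_coset l_gt0 pa (is_top_ptop Tp) lC (canonical_sph pa mp mud) sk).
rewrite -(nptE l_gt0 H ld mud lk) !mulrA -!vpowD; congr (vpow _ * _).
by have := coset_len_eq lk yt e sg sk E; lia.
Qed.

(** Group the alcoves of the coset [y W_q] by the point of the orbit of [mu +
    rho] in their closure. The alcoves at one point form a coset of [W_p], which
    contributes the Poincare polynomial of [W_p]. *)
Lemma tau_canonical y : is_top (y q) y -> chamber Phi (y q) ->
  tau q y (canonical H (ptop mu)) = poincare p * (vpow (Lq%:Z - Lp%:Z) * fibre_sum (y q)).
Proof.
move=> yt yC; have [Wy _ _] := yt.
have sub k : stab p k -> stab q k by exact: (stab_sub base_spec.1).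
(* The point of the orbit of [mu + rho], shifted by [- rho], in the closure of
   the alcove of [y g]. *)
pose lamg (g : V -> V) : V := y (g p) - rho.
have lamgP g : stab q g -> [/\ linked (lamg g) mu, dominant (lamg g),
    moved_pt (lamg g) = y q & exists2 k, stab p k & y \o g = ptop (lamg g) \o k].
  move=> sg; have Wg := stab_W l_gt0 sg; have Wyg := Waff_comp Wy Wg.
  have gq := stab_fix l_gt0 sg; have gE : lamg g + rho = (y \o g) p by rewrite subrK.
  have lk : linked (lamg g) mu.
    have [x [Wx _ xT]] := Waff_inv l_gt0 (top_W Phi l_gt0 (mu + rho)).
    apply/linkedP; exists (y \o g \o x); first exact: Waff_comp.
    rewrite gE -mp /=; congr (y (g _)); exact: (esym (congr1 (@^~ p) xT)).
  have me : moved_pt (lamg g) = y q by rewrite (moved_pt_eq Wyg (esym gE)) /= gq.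
  split=> //.
    rewrite /Defs.dominant gE; apply: (chamber_spec _ yC).
    have := spec_W Wyg base_spec.1; rewrite /= gq; exact.
  apply: (coset l_gt0 (top_W Phi l_gt0 _) Wyg pa); by rewrite [LHS](ptop_p lk).
pose tm (g : V -> V) : laurent := vpow (len g) * cf (y \o g) (canonical H (ptop mu)).
transitivity (\sum_(g <- stab_seq q) \sum_(lam <- npt_supp)
    (if lamg g == lam then tm g else 0)).
  apply: (eq_stab l_gt0 qa) => g sg; rewrite sum_delta ?fset_uniq //.
  have [lk ld me [k sk E]] := lamgP g sg; case: ifP => // ns.
  rewrite (cf_coset lk ld yt me sg sk E).
  have -> : npt (lamg g) mu = 0; last by rewrite !mulr0.
  by apply/eqP/negPn/negP => n0; move/negP: ns; apply; apply/npt_suppP.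
rewrite exchange_big /fibre_sum !mulr_sumr; apply: eq_big_seq => lam ls.
have lk := npt_supp_linked ls; have [ld _] := (npt_suppP lam).1 ls.
have [e|ne] := eqVneq (moved_pt lam) (y q); last first.
  rewrite !mulr0 big1_seq // => g /andP[_ /(stab_seqP l_gt0 _ qa) sg].
  have [_ _ me _] := lamgP g sg; case: eqP => // ge.
  by rewrite -ge me eqxx in ne.
have [g0 sg0 E0] := coset l_gt0 Wy (top_W Phi l_gt0 (lam + rho)) qa (esym e).
have [g0' [sg0' K K']] := stab_inv sg0.
have g0p : y (g0 p) = lam + rho by rewrite -(ptop_p lk) [in RHS](E0 : ptop lam = _).
rewrite -big_mkcond -big_filter.
rewrite (perm_big (map (fun k => g0 \o k) (stab_seq p))); last first.
  apply: uniq_perm.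
  - exact/filter_uniq/stab_seq_uniq.
  - rewrite map_inj_uniq ?stab_seq_uniq // => k1 k2 ek.
    have kE (k : V -> V) : g0' \o (g0 \o k) = k by rewrite compA K'.
    by rewrite -(kE k1) -(kE k2) ek.
  - move=> g; rewrite mem_filter; apply/andP/mapP.
      move=> [/eqP ge /(stab_seqP l_gt0 _ qa) sg].
      have gp : y (g p) = lam + rho by rewrite -ge subrK.
      have [k sk Ek] := coset l_gt0 (stab_W l_gt0 sg0) (stab_W l_gt0 sg) pa
        (Waff_inj l_gt0 Wy (etrans g0p (esym gp))).
      by exists k => //; exact/(stab_seqP l_gt0 _ pa).
    move=> [k /(stab_seqP l_gt0 _ pa) sk ->]; split.
      by rewrite /lamg /= (stab_fix l_gt0 sk) g0p addrK.
    apply/(stab_seqP l_gt0 _ qa); exact: (gen_comp sg0 (sub _ sk)).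
rewrite big_map /poincare mulr_suml; apply: (eq_stab l_gt0 pa) => k sk.
apply: (cf_coset lk ld yt e) => //; last by rewrite compA -E0.
exact: (gen_comp sg0 (sub _ sk)).
Qed.

Context (wLp : exists2 w, stab p w & forall k, stab p k -> (len (k \o w) + len k = Lp)%N).
Context (wLq : exists2 w, stab q w & forall k, stab q k -> (len (k \o w) + len k = Lq)%N).

(** The ratio between the coefficients of [averaged] and those of [F_Lam] of the
    canonical element. *)
Definition avg_factor : laurent :=
  avg_scalar (Phi := Phi) (l := l) q * (vpow (- Lp%:Z) * poincare p).

Lemma norm_poincare_bar o L : spec o a0 ->
  (exists2 w, stab o w & forall k, stab o k -> (len (k \o w) + len k = L)%N) ->
  lbar (vpow (- L%:Z) * poincare o) = vpow (- L%:Z) * poincare o.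
Proof.
move=> oa wo; rewrite lbarM vpow_bar (poincare_bar l_gt0 oa wo) mulrA -vpowD.
by congr (vpow _ * _); lia.
Qed.

Lemma avg_factor_bar : lbar avg_factor = avg_factor.
Proof. by rewrite lbarM avg_scalar_bar norm_poincare_bar. Qed.

Lemma avg_factor_neq0 : avg_factor != 0.
Proof.
apply/negP => /eqP e; have /negP := poincare_neq0 l_gt0 pa; apply.
have v0 : vpow (- Lp%:Z) != 0 by rewrite monalgU_eq0.
apply/eqP/(laurent_mulf_eq0 _ v0)/(laurent_mulf_eq0 e).
exact: avg_scalar_neq0.
Qed.

(** The element [m h], normalized so as to be self-dual. *)
Definition averaged : indmod H :=
  (vpow (- Lq%:Z) * poincare q) *: act (canonical H (ptop mu)) (sdavg H q).

Lemma averaged_bar : nbar averaged = averaged.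
Proof.
have [[mb _ _] _] := canonicalP l_gt0 H (ptop_Wf l_gt0 mud).
by rewrite /averaged nbarZ (norm_poincare_bar qa wLq) nbar_act mb hbar_sdavg.
Qed.

Lemma averaged_sph : spherical_at r averaged.
Proof.
apply: (spherical_at_sub base_spec.2) => f wf fq; apply: sphZ; exact: sdavg_sph.
Qed.

(** Evaluate [tau] at [m h] in two ways: [m h] is spherical at [q], and [tau] of
    [m h] is a multiple of [tau] of [m]. *)
Lemma cf_averaged gam : dominant gam -> linked gam nu ->
  cf (ptop gam) averaged = avg_factor * mcoeff gam (facet_op H Lam mu).
Proof.
move=> gd lg; rewrite /averaged cfN_Z mcoeff_facet_op.
have zs := sdavg_sph l_gt0 (canonical H (ptop mu)) qa.
have WT : W (ptop gam) := top_W Phi l_gt0 (gam + rho).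
case: asboolP => [[kC _]|h]; last first.
  rewrite (sph_out_chamber l_gt0 qa zs) ?mulr0 // => kC; exact: h.
pose y := top Phi l (moved_pt gam).
have yq : y q = moved_pt gam by exact: (top_act l_gt0 WT qa).
have yt : is_top (y q) y by rewrite yq; exact: topP.
have yC : chamber Phi (y q) by rewrite yq.
have [Wy _ _] := yt; have gr := ptop_orbit l_gt0 ra nr lg.
have [g sg E] := coset l_gt0 Wy WT qa yq.
have el : len g = negc (moved_pt gam) (gam + rho).
  have s1 : spec (moved_pt gam) (gam + rho) by rewrite -gr; exact: (spec_W WT base_spec.2).
  have s2 : spec (gam + rho) (ptop gam a0) by exact: top_spec.
  rewrite -(negc_top l_gt0 qa yt sg) -E yq (neg_split l_gt0 s1 s2).
  have := negc_top l_gt0 ra (is_top_ptop gr) (gen_id _).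
  by rewrite /= (len_id l_gt0) [X in negc X _]gr => ->.
have eT := tau_canonical yt yC; have eA := cf_sdavg l_gt0 qa yt yC (canonical H (ptop mu)).
rewrite E (sph_coset l_gt0 qa yt yC zs sg) el -yq.
transitivity (vpow (- Lq%:Z) * vpow (negc (y q) (gam + rho)) *
  (poincare q * cf y (act (canonical H (ptop mu)) (sdavg H q)))); first by ring.
rewrite eA eT /avg_factor vpowD.
transitivity ((vpow (- Lq%:Z) * vpow Lq%:Z) * (avg_scalar (Phi := Phi) (l := l) q *
  (vpow (- Lp%:Z) * poincare p) * (vpow (negc (y q) (gam + rho)) * fibre_sum (y q)))).
  by ring.
rewrite -(vpowD (- Lq%:Z) Lq%:Z) addNr vpow0; exact: mul1r.
Qed.

Context (n0 : negc qF (nu + rho) = 0%N) (p0 : posc qF (mu + rho) = 0%N).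
Context (qC : chamber Phi qF).

(** No hyperplane through [F] has [nu + rho] on its negative side, so the
    highest alcove at [nu + rho] is also the highest alcove at [F]. *)
Lemma top_nu : is_top (ptop nu q) (ptop nu).
Proof.
have [WT s3 tP] := topP Phi l_gt0 (nu + rho); rewrite nq; split=> //.
  exact/(spec_trans qFr)/top_spec.
move=> a m pa0 e; have fa : aff_root (ev l a m) by exists a, m; split=> //; exact: pos_root_root.
have nneg : 0 <= ev l a m (nu + rho).
  rewrite leNgt; apply/negP => neg; have em := (ev_eq0 l a m qF).1 e.
  have : has (neg_at l qF (nu + rho)) (pos_roots Phi).
    by apply/hasP; exists a => //; rewrite (neg_atE _ em).
  by rewrite has_count -/(negc _ _) n0.
move: nneg; rewrite le_eqVlt => /orP[/eqP/esym e'|]; first exact: tP.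
exact: top_spec.
Qed.

Lemma nu_chamber : chamber Phi (ptop nu q). Proof. by rewrite nq. Qed.

Lemma ptop_moved lam : moved_pt lam = qF -> exists2 g, stab q g & ptop lam = ptop nu \o g.
Proof.
move=> e; apply: (coset l_gt0 (top_W _ l_gt0 _) (top_W _ l_gt0 _) qa).
by rewrite [LHS]nq -e.
Qed.

(** The alcove of [lam] is below that of [mu], which lies in the coset of the
    highest alcove at [F]; [bruhat_coset] keeps the alcove of [gam] below the
    latter. *)
Lemma facet_op_le gam : mcoeff gam (facet_op H Lam mu) != 0 ->
  [/\ dominant gam, linked gam nu & bruhat_le Phi l (ptop gam) (ptop nu)].
Proof.
rewrite mcoeff_facet_op; case: asboolP => [[kC lg]|_]; last by rewrite eqxx.
move=> nz; have gr := ptop_orbit l_gt0 ra nr lg.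
have WT lam : W (ptop lam) by exact: top_W.
have [lam ls e] : exists2 lam, lam \in npt_supp & moved_pt lam = moved_pt gam.
  apply: contrapT => nex; move/eqP: nz; apply; rewrite /fibre_sum big1_seq ?mulr0 //.
  move=> lam /andP[_ ls]; case: eqP => // e; by case: nex; exists lam.
have lk := npt_supp_linked ls; have [ld nl] := (npt_suppP lam).1 ls.
split=> //.
  rewrite /Defs.dominant -gr; apply: (chamber_spec _ kC).
  exact: (spec_W (WT gam) base_spec.2).
have leW x g := bruhat_coset (x := x) (g := g) qa top_nu nu_chamber.
have mle : bruhat_le Phi l (ptop mu) (ptop nu).
  have [g sg ->] := ptop_moved mq; apply: leW => //; exact: bruhat_refl.
have lle : bruhat_le Phi l (ptop lam) (ptop nu).
  have [->|[lt _]] := npt_neq0 l_gt0 ld mud nl; first exact: mle.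
  have [_ _ _ [lm _]] := (pt_ltP l_gt0 _ _).1 lt; exact: (bruhat_trans lm mle).
have [g sg ->] := coset l_gt0 (WT lam) (WT gam) qa e.
exact: leW.
Qed.

(** Only [lam = mu] contributes. Since no hyperplane through [F] has [mu + rho]
    on its positive side, its alcove is shortest among those of the points at
    [F] in the orbit, so the other such points have length at least that of [mu]
    and cannot occur in the canonical element at [mu]. *)
Lemma facet_op_nu : mcoeff nu (facet_op H Lam mu) = 1.
Proof.
rewrite mcoeff_facet_op ifT; last first.
  apply/asboolP; split; first exact: nu_chamber.
  exact: linked_refl.
have -> : moved_pt nu = qF by exact: nq.
rewrite n0 vpow0 mul1r /fibre_sum.
transitivity (\sum_(lam <- npt_supp) (if mu == lam then 1 else 0 : laurent)).
  apply: eq_big_seq => lam ls.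
  have [<-|ne] := eqVneq mu lam.
    by rewrite ifT ?p0 ?oppr0 ?vpow0 ?mul1r ?npt_diag //; exact/eqP.
  case: eqP => // e; exfalso.
  have lk := npt_supp_linked ls; have [ld nl] := (npt_suppP lam).1 ls.
  have [e'|[lt _]] := npt_neq0 l_gt0 ld mud nl; first by rewrite e' eqxx in ne.
  have lt' := pt_lt_len l_gt0 lt.
  have [g sg E] := ptop_moved e; have [g' sg' E'] := ptop_moved mq.
  have c1 := coset_len l_gt0 qa top_nu nu_chamber sg.
  have c2 := coset_len l_gt0 qa top_nu nu_chamber sg'.
  have d1 := @coset_len_eq lam (ptop nu) g id lk top_nu
    (etrans e (esym nq)) sg (gen_id _) (esym E).
  have d2 := @coset_len_eq mu (ptop nu) g' id (linked_refl _) top_nu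
    (etrans mq (esym nq)) sg' (gen_id _) (esym E').
  move: d1 d2; rewrite nq p0 (len_id l_gt0); move: c1 c2; rewrite -E -E'.
  move: lt'; lia.
rewrite sum_delta ?fset_uniq // ifT //; apply/npt_suppP; split=> //.
by rewrite npt_diag // oner_neq0.
Qed.

Lemma facet_op_leading : @leading R n Phi l nu (facet_op H Lam mu).
Proof.
split; [exact: nud|exact: facet_op_nu|move=> gam].
rewrite -mcoeff_neq0 => /facet_op_le[gd lg le]; have [->|ne] := eqVneq gam nu; first by left.
right; apply/pt_ltP => //; split=> //; split=> // e.
by move/eqP: ne; apply; exact: (ptop_inj l_gt0 lg).
Qed.

End FacetOperator.

Section Descent.
Context (nu r : V) (b : laurent).
Context (ra : spec r a0) (nr : ptop nu r = nu + rho).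
Context (bb : lbar b = b) (b0 : b != 0).

Lemma linked_sym lam gam : linked lam gam -> linked gam lam.
Proof.
move=> /linkedP[w Ww e]; have [x [Wx _ xw]] := Waff_inv l_gt0 Ww.
by apply/linkedP; exists x => //; rewrite e; have /= -> := congr1 (@^~ (gam + rho)) xw.
Qed.

(** The coefficient at [y] is a power of [v] times the coefficient at the
    highest alcove of the point [y r], by [sph_coset], and this alcove has
    larger length. *)
Lemma cf_point y z : spherical_at r z -> cf y z != 0 -> exists lam,
  [/\ dominant lam, linked lam nu, cf (ptop lam) z != 0 & (len y <= len (ptop lam))%N].
Proof.
move=> zs y0; have fy : Wf y by apply: contrapT => /(cf_nf z) e; rewrite e eqxx in y0.
have yC : chamber Phi (y r).
  by apply: contrapT => /(sph_out_chamber l_gt0 ra zs) e; rewrite e eqxx in y0.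
have Wy := Wf_W fy; pose lam := y r - rho.
have lE : lam + rho = y r by rewrite subrK.
have lk : linked lam nu.
  have [x [Wx _ xT]] := Waff_inv l_gt0 (top_W Phi l_gt0 (nu + rho)).
  apply/linkedP; exists (y \o x); first exact: Waff_comp.
  by rewrite lE -nr /=; congr y; exact: (esym (congr1 (@^~ r) xT)).
have Tr := ptop_orbit l_gt0 ra nr lk; have WT := top_W Phi l_gt0 (lam + rho).
have [g sg E] := coset l_gt0 WT Wy ra (etrans Tr lE).
have lC : chamber Phi (ptop lam r) by rewrite Tr lE.
have := sph_coset l_gt0 ra (is_top_ptop Tr) lC zs sg.
have := coset_len l_gt0 ra (is_top_ptop Tr) lC sg; rewrite -E => el ec.
exists lam; split=> //; first by rewrite /Defs.dominant lE.
  by apply: contra_neq y0 => e; rewrite ec e mulr0.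
by rewrite -el leq_addr.
Qed.

(** Induction on the maximal length [k] of the alcoves at the points in the
    support. The coefficients of [B] at length [k] are bar invariant by
    [self_dual_top] applied to [z], after cancelling [b]; subtract the
    corresponding multiples of canonical elements from [B], and from [z] at the
    same time. *)
Lemma self_dual_descent (k : nat) (B : M) (z : indmod H) :
  (forall gam, mcoeff gam B != 0 -> [/\ dominant gam, linked gam nu & (len (ptop gam) < k)%N]) ->
  nbar z = z -> spherical_at r z ->
  (forall gam, dominant gam -> linked gam nu -> cf (ptop gam) z = b * mcoeff gam B) ->
  self_dual H B.
Proof.
elim: k B z => [|k IH] B z Bs zb zs zB.
  have -> : B = 0; last exact: self_dual0.
  apply/malgP => gam; rewrite mcoeff0; apply/eqP/negPn/negP => /Bs[_ _].
  by rewrite ltn0.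
pose top_k gam := len (ptop gam) == k.
have zle y : cf y z != 0 -> (len y <= k)%N.
  move=> /(cf_point zs)[lam [ld lk l0 yl]]; apply: (leq_trans yl).
  have /Bs[_ _ //] : mcoeff lam B != 0.
  by apply: contra_neq l0 => e; rewrite zB // e mulr0.
have Bbar gam : top_k gam -> lbar (mcoeff gam B) = mcoeff gam B.
  move=> /eqP gk; have [->|n0] := eqVneq (mcoeff gam B) 0; first exact: lbar0.
  have [gd lg _] := Bs _ n0; apply: (laurent_cancel b0).
  rewrite -{1}bb -lbarM -zB //; apply: (self_dual_top l_gt0 zb) => y.
  by rewrite gk; exact: zle.
(* The part of [B] of length [k], completed to a combination of canonical
   elements. *)
pose D : M := \sum_(gam <- msupp B | top_k gam) mcoeff gam B *: cpt gam.
pose zD : indmod H :=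
  \sum_(gam <- msupp B | top_k gam) (b * mcoeff gam B) *: canonical H (ptop gam).
have sdD : self_dual H D.
  apply: self_dual_sum => gam gk; have [->|n0] := eqVneq (mcoeff gam B) 0.
    by rewrite scale0r; exact: self_dual0.
  have [gd _ _] := Bs _ n0; apply: self_dualZ; first exact: Bbar.
  exact: self_dual_cpt.
have mD lam : dominant lam ->
    mcoeff lam D = \sum_(gam <- msupp B | top_k gam) mcoeff gam B * npt lam gam.
  move=> ld; rewrite mcoeff_sum big_seq_cond [RHS]big_seq_cond; apply: eq_bigr => gam.
  rewrite -mcoeff_neq0 => /andP[/Bs[gd _ _] _].
  by rewrite mcoeffZ mcoeff_cpt // ifT //; exact/asboolP.
have BD lam : mcoeff lam (B - D) != 0 -> 
    [/\ dominant lam, linked lam nu & (len (ptop lam) < k)%N].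
  move=> h; have [ld lk lek] : [/\ dominant lam, linked lam nu & (len (ptop lam) <= k)%N].
    have [e|/Bs[]//] := eqVneq (mcoeff lam B) 0.
    have [gam [gB /eqP gk g0]] : exists gam, [/\ gam \in msupp B, top_k gam &
        mcoeff lam (cpt gam) != 0].
      apply: contrapT => nex; move/eqP: h; apply; rewrite mcoeffB e sub0r mcoeff_sum.
      rewrite big1_seq ?oppr0 // => gam /andP[gk gB]; rewrite mcoeffZ.
      have [->|g0] := eqVneq (mcoeff lam (cpt gam)) 0; first by rewrite mulr0.
      by case: nex; exists gam.
    have [gd lg _] : [/\ dominant gam, linked gam nu & (len (ptop gam) < k.+1)%N].
      by apply: Bs; rewrite mcoeff_neq0.
    have [->|[lt _]] := cpt_neq0 l_gt0 gd g0; first by rewrite gk.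
    have [ld _ lk _] := (pt_ltP l_gt0 _ _).1 lt.
    split; [exact: ld|exact: (linked_trans lk lg)|].
    by rewrite -gk; exact/ltnW/(pt_lt_len l_gt0 lt).
  split=> //; rewrite ltn_neqAle lek andbT; apply: contra h => /eqP lk'.
  rewrite mcoeffB mD // subr_eq0; apply/eqP/esym.
  rewrite big_mkcond.
  transitivity (\sum_(gam <- msupp B) (if lam == gam then mcoeff lam B else 0)).
    apply: eq_big_seq => gam; rewrite -mcoeff_neq0 => /Bs[gd lg gk].
    have [<-|ne] := eqVneq lam gam.
      by rewrite /top_k lk' eqxx npt_diag // mulr1.
    case: ifP => // /eqP gk'; have [->|n0] := eqVneq (npt lam gam) 0; first by rewrite mulr0.
    have [e|[lt _]] := npt_neq0 l_gt0 ld gd n0; first by rewrite e eqxx in ne.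
    by have := pt_lt_len l_gt0 lt; rewrite lk' gk' ltnn.
  rewrite sum_delta ?fset_uniq //; case: ifP => // /negbT.
  by move=> /mcoeff_outdom ->.
have -> : B = (B - D) + D by rewrite subrK.
apply: self_dualD => //; apply: (IH _ (z - zD)) => //.
- rewrite nbarD nbarN zb nbar_sum; congr (_ - _); rewrite [LHS]big_seq_cond [RHS]big_seq_cond.
  apply: eq_bigr => gam; rewrite -mcoeff_neq0 => /andP[/Bs[gd _ _] gk].
  have [[cb _ _] _] := canonicalP l_gt0 H (ptop_Wf l_gt0 gd).
  by rewrite nbarZ lbarM bb (Bbar _ gk) cb.
- move=> f wf fr; apply: sphD; first exact: zs.
  rewrite -scaleN1r; apply: sphZ; rewrite /zD big_seq_cond.
  apply: big_ind; [exact: sph0|move=> *; exact: sphD|] => gam.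
  rewrite -mcoeff_neq0 => /andP[/Bs[gd lg _] _]; apply: sphZ.
  exact: (canonical_sph ra (ptop_orbit l_gt0 ra nr lg) gd wf fr).
- move=> lam ld lk; rewrite cfN_B zB // mcoeffB mulrBr mD //; congr (_ - _).
  rewrite cfN_sum mulr_sumr [LHS]big_seq_cond [RHS]big_seq_cond; apply: eq_bigr => gam.
  rewrite -mcoeff_neq0 => /andP[/Bs[gd lg _] _].
  by rewrite cfN_Z -mulrA (nptE l_gt0 H ld gd (linked_trans lk (linked_sym lg))).
Qed.

End Descent.

Lemma facet_op_canonical mu Lam : dominant mu -> closure (chamber Phi) Lam ->
  admissible Phi l mu Lam -> canonical_pt H (mu + Lam) = positivity H (facet_op H Lam mu).
Proof.
move=> mud /closure_chamber Lam0 /admissibleP[t [/andP[t0 t1] /=]].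
set qF := mu + rho + t *: Lam => -[aF s0 s1].
have nE : mu + rho + Lam = mu + Lam + rho by rewrite addrAC.
rewrite nE in s1.
have dge s : 0 <= s -> forall i, 0 <= dot (s *: Lam) (simple Phi i).
  by move=> s_ge0 i; rewrite dotZl mulr_ge0.
have addC d p' : chamber Phi p' -> (forall i, 0 <= dot d (simple Phi i)) -> chamber Phi (p' + d).
  by move=> pC d0 i; rewrite dotDl ltr_pwDl.
have qC : chamber Phi qF by apply: addC => //; exact: dge.
have nud : dominant (mu + Lam) by rewrite /Defs.dominant -nE; exact: addC.
have n0 : negc qF (mu + Lam + rho) = 0%N.
  have -> : mu + Lam + rho = qF + (1 - t) *: Lam.
    by rewrite -nE /qF scalerBl scale1r -[RHS]addrA [_ + (Lam - _)]addrC subrK.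
  by apply/negc_add/dge; rewrite subr_ge0.
have p0 : posc qF (mu + rho) = 0%N.
  have -> : mu + rho = qF - t *: Lam by rewrite addrK.
  exact/posc_sub/dge.
have [p [pa mp]] := @base_pt _ _ Phi l l_gt0 (mu + rho).
have [r [ra nr]] := @base_pt _ _ Phi l l_gt0 (mu + Lam + rho).
have [q [qa qq]] := @base_pt _ _ Phi l l_gt0 qF.
have mq : ptop mu q = qF by exact: (ptop_lim (top_W Phi l_gt0 qF) qa qq s0).
have nq : ptop (mu + Lam) q = qF by exact: (ptop_lim (top_W Phi l_gt0 qF) qa qq s1).
have [wp [swp hp lp]] := stab_longest l_gt0 pa.
have [wq [swq hq lq]] := stab_longest l_gt0 qa.
have Lp : exists2 w, stab p w & forall k, stab p k -> (len (k \o w) + len k = len wp)%N.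
  by exists wp.
have Lq : exists2 w, stab q w & forall k, stab q k -> (len (k \o w) + len k = len wq)%N.
  by exists wq.
symmetry; apply: (positivityE l_gt0); last first.
  exact: (facet_op_leading mud nud pa qa ra mp mq nr s0 s1 nq aF hp hq n0 p0 qC).
apply: (@self_dual_descent (mu + Lam) r _ ra nr (avg_factor_bar q pa Lp)
  (avg_factor_neq0 pa qa (len wp)) (len (ptop (mu + Lam))).+1 _ (averaged mu q (len wq))).
- move=> gam /(facet_op_le mud qa ra mp mq nr s0 s1 nq aF n0 qC)[gd lg le].
  split; [exact: gd|exact: lg|]; rewrite ltnS; exact: (bruhat_len_le le).
- exact: (averaged_bar mud qa Lq).
- exact: (averaged_sph qa mp mq nr s0 s1 nq (len wq)).
- exact: (cf_averaged mud pa qa ra mp mq nr s0 s1 nq aF hp hq).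
Qed.

End Crossing.

Theorem theorem2p2 (R : realType) (n : nat) (Phi : rootSystem R n) (l : nat)
  (l_gt0 : (0 < l)%N) (l_gt_dual_coxeter : dual_coxeter Phi < l%:R)
  (H : heckeModule Phi l) (mu Lam : 'rV[R]_n)
  (mu_dominant : chamber Phi (mu + rho Phi))
  (Lam_dominant : closure (chamber Phi) Lam)
  (Lam_admissible : admissible Phi l mu Lam) :
  canonical_pt H (mu + Lam) = positivity H (facet_op H Lam mu).
Proof.
exact: facet_op_canonical.
Qed.
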